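(* Let $\mathbb{K}$ be a field of characteristic neither $2$ nor $3$, $\overline{\mathbb{K}}$ an algebraic closure, and $n\geq 3$. Let $\mathcal{V}$ be a linear subspace of $M_n(\mathbb{K})$ of dimension $\binom{n}{2}+2$ such that every $M\in\mathcal{V}$ has at most two distinct eigenvalues in $\overline{\mathbb{K}}$. (a) If $n=3$ or $n\geq 5$, there is a non-empty proper subset $I$ of $\{1,\dots,n\}$ such that $\mathcal{V}$ is similar to $\mathcal{V}^{(2)}_I$. (b) If $n=4$, then exactly one of the following holds: (i) $\mathcal{V}$ is similar to $\mathcal{V}^{(2)}_I$ for some non-empty proper subset $I$ of $\{1,2,3,4\}$; (ii) $\mathcal{V}$ is similar to $\mathcal{G}_4(\mathbb{K})$; (iii) $\mathcal{V}$ is similar to $\mathcal{G}'_4(\mathbb{K})$.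
   Context: $\mathrm{NT}_n(\mathbb{K})$ is the space of strictly upper-triangular matrices; for non-empty $I\subset\{1,\dots,n\}$, $D_I$ is the diagonal matrix with $(i,i)$ entry $1$ for $i\in I$ and $0$ otherwise; for proper such $I$, $\mathcal{V}^{(2)}_I:=\mathbb{K}I_n\oplus\mathbb{K}D_I\oplus\mathrm{NT}_n(\mathbb{K})$. $\mathcal{G}_4(\mathbb{K})=\left\{\begin{bmatrix}A&B\\0&A\end{bmatrix}: A,B\in M_2(\mathbb{K})\right\}$ and $\mathcal{G}'_4(\mathbb{K})=\left\{\begin{bmatrix}A&B\\0&A^T\end{bmatrix}: A,B\in M_2(\mathbb{K})\right\}$. Similar means conjugate by a single invertible matrix. *)

(* Defs.v *)
From HB Require Import structures.
From mathcomp Require Import all_boot all_order all_algebra all_field.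
Set Implicit Arguments. Unset Strict Implicit. Unset Printing Implicit Defensive.
Import Order.TTheory GRing.Theory Num.Theory.
Local Open Scope ring_scope.

Definition strict_upper (K : fieldType) (n : nat) (M : 'M[K]_n) : Prop :=
  forall i j : 'I_n, (j <= i)%N -> M i j = 0.

Definition DI (K : fieldType) (n : nat) (I : {set 'I_n}) : 'M[K]_n :=
  diag_mx (\row_i (if i \in I then 1 else 0)).

Definition V2 (K : fieldType) (n : nat) (I : {set 'I_n}) (M : 'M[K]_n) : Prop :=
  exists (a b : K) (N : 'M[K]_n),
    strict_upper N /\ M = a%:M + b *: DI K I + N.

Definition G4 (K : fieldType) (M : 'M[K]_(2 + 2)) : Prop :=
  exists A B : 'M[K]_2, M = block_mx A B 0 A.

Definition G4' (K : fieldType) (M : 'M[K]_(2 + 2)) : Prop :=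
  exists A B : 'M[K]_2, M = block_mx A B 0 A^T.

Definition vsimilar (K : fieldType) (n : nat) (V : {vspace 'M[K]_n})
    (W : 'M[K]_n -> Prop) : Prop :=
  exists2 P : 'M[K]_n, P \in unitmx &
    forall M : 'M[K]_n, (M \in V) <-> W (P *m M *m invmx P).

Definition at_most_two_eigenvalues (K L : fieldType) (iota : {rmorphism K -> L})
    (n : nat) (M : 'M[K]_n) : Prop :=
  forall a b c : L,
    eigenvalue (map_mx iota M) a -> eigenvalue (map_mx iota M) b ->
    eigenvalue (map_mx iota M) c -> a = b \/ a = c \/ b = c.

Definition is_alg_closure (K : fieldType) (L : closedFieldType)
    (iota : {rmorphism K -> L}) : Prop :=
  forall x : L, exists p : {poly K}, p != 0 /\ root (map_poly iota p) x.

(* Main.v *)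
Require Import Defs.
From HB Require Import structures.
From Stdlib Require Import Classical.
From mathcomp Require Import all_boot all_order all_algebra all_field.
From mathcomp Require Import ring zify.
Set Implicit Arguments. Unset Strict Implicit. Unset Printing Implicit Defensive.
Import GRing.Theory. Local Open Scope ring_scope.

(** If a rank one matrix y phi with phi(y) = 0 lies in a space V of matrices having
at most two eigenvalues, comparing the characteristic polynomials of M + t y phi
for five values of t yields phi(My) = phi(M^2 y) = phi(M^3 y) = 0 for all M in V.
Counting dimensions along M |-> My then shows that, at the extremal dimension,
every linear form vanishing on Vy produces such a matrix y phi, and that the
elements of V killing y act on K^n / Ky as a space of the extremal dimension for
matrices with at most one nonzero eigenvalue, which is triangularizable by
induction. It follows that Vy is an invariant subspace.

Choose y with Vy of least dimension. If Vy is a line, V is in triangular form. If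
dim Vy >= 3, V acts transitively on Vy with extremal dimension, and the triangular
flags attached to two different vectors contradict each other. If Vy is a plane,
V consists of all block triangular matrices [A C; 0 B] with (A, B) in a
space transitive on K^2; an eigenvalue of a 2x2 matrix cannot depend linearly on it,
so B is neither triangularizable nor of size other than 2, and B is a linear
function of A with the same trace and determinant, that is Q A Q^-1 or Q A^T Q^-1. *)

(** * Pencils of polynomials with few roots *)

(** For fixed y, V is measured by its image Vy, by the matrices y phi it contains and by an action
    on K^n / Ky. As phi annihilates Vy, the first two dimensions add up to at most n whatever dim Vy
    is, so the extremal dimension makes every inequality tight for every y. The induction cannot
    stay in the class of the theorem: on the quotient the spectrum has at most one nonzero point.
    Adjoining the identity leads back, and either raises the dimension by one or, if the identity
    was already present, reveals that every spectrum is a single point. Hence spaces with two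
    eigenvalues and spaces with one are treated in parallel, through a Boolean that is also the
    extra dimension. The enlarged space might be exceptional in size 4; this is excluded because the
    removed scalar would be an eigenvalue of a 2x2 block depending linearly on it, the same
    obstruction as for invariant planes. The hypothesis on the characteristic provides five distinct
    scalars 0, 1, -1, 2, -2 and makes 2, 3, 4 invertible in leading coefficients. *)

Definition at_most_two (T : Type) (P : T -> Prop) :=
  forall a b c, P a -> P b -> P c -> a = b \/ a = c \/ b = c.

Lemma coefM_top (R : nzRingType) (p q : {poly R}) m l :
  (size p <= m.+1)%N -> (size q <= l.+1)%N -> (p * q)`_(m + l) = p`_m * q`_l.
Proof.
move=> hp hq; rewrite coefM.
have hm : (m < (m + l).+1)%N by rewrite ltnS leq_addr.
rewrite (bigD1 (Ordinal hm)) //= addKn big1 ?addr0 // => i /eqP hi.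
have [him|him] := ltnP m i.
  by rewrite nth_default ?mul0r // (leq_trans hp).
rewrite [q`_ _]nth_default ?mulr0 // (leq_trans hq) //.
have : (i : nat) <> m by move=> e; apply: hi; apply: val_inj.
by lia.
Qed.

Section ClosedField.
Variable L : closedFieldType.
Implicit Types (p q h F Q : {poly L}) (ts : seq L).

(* Equal polynomial sizes may carry different canonical structures, which [lia]
   sees as distinct atoms; [psize] normalizes them. *)
Definition psize p : nat := size p.

Lemma psizeE p : size p = psize p. Proof. by []. Qed.

Ltac plia := repeat match goal with
  | H : is_true (leq _ _) |- _ => move: H
  | H : @eq nat _ _ |- _ => move: H end; rewrite ?psizeE; lia.

Lemma sizeM p q : p != 0 -> q != 0 -> size (p * q) = (size p + size q).-1.
Proof. exact: size_mul. Qed.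

Lemma at_most_two_mem (rs : seq L) :
  at_most_two (fun r => r \in rs) ->
  exists a b, all (fun r => (r == a) || (r == b)) rs.
Proof.
case: rs => [|a rs] h2; first by exists 0, 0.
case: (boolP (has (fun r => r != a) (a :: rs))) => [/hasP[b hb ba]|hn].
  exists a, b; apply/allP => r hr.
  case: (h2 r a b hr (mem_head _ _) hb) => [->|[->|e]]; rewrite ?eqxx ?orbT //.
  by rewrite e eqxx in ba.
exists a, a; apply/allP => r hr; rewrite orbb.
by apply/negPn; apply: contra hn => ra; apply/hasP; exists r.
Qed.

Lemma prod_two_roots (rs : seq L) a b :
  all (fun r => (r == a) || (r == b)) rs ->
  exists i j, (i + j)%N = size rs /\
    \prod_(r <- rs) ('X - r%:P) = ('X - a%:P) ^+ i * ('X - b%:P) ^+ j.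
Proof.
elim: rs => [|r rs IH] /=; first by exists 0%N, 0%N; rewrite big_nil mulr1.
case/andP=> hr /IH[i [j [<- e]]]; rewrite big_cons e.
case/orP: hr => /eqP->.
  by exists i.+1, j; rewrite exprS mulrA.
by exists i, j.+1; rewrite addnS exprS mulrCA.
Qed.

(** Each of the two roots loses one factor in [h], whence the loss of at most two in size. A root
    absent from [F] has exponent 0, which the predecessor leaves at 0. *)
Lemma two_roots_gcd_deriv F :
  F != 0 -> at_most_two (root F) ->
  exists h, [/\ h %| F, h %| F^`() & (size F <= (size h).+2)%N].
Proof.
move=> F0 h2; have [rs eF] := closed_field_poly_normal F.
have lF : lead_coef F != 0 by rewrite lead_coef_eq0.
have : at_most_two (fun r => r \in rs).
  have rr r : r \in rs -> root F r by rewrite eF rootZ // root_prod_XsubC.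
  by move=> a b c ha hb hc; apply: h2; apply: rr.
case/at_most_two_mem => a [b /prod_two_roots[i [j [sij e]]]].
have szF : size F = (i + j).+1 by rewrite eF size_scale // size_prod_XsubC sij.
rewrite e in eF; move: lF eF; set c := lead_coef F => c0 eF.
exists (('X - a%:P) ^+ i.-1 * ('X - b%:P) ^+ j.-1); split.
- by rewrite eF dvdpZr // dvdp_mul // dvdp_exp2l // leq_pred.
- rewrite eF derivZ dvdpZr // derivM !deriv_exp !derivB !derivX !derivC !subr0 !mul1r.
  have le (x : L) m : ('X - x%:P) ^+ m.-1 %| ('X - x%:P) ^+ m.
    by rewrite dvdp_exp2l // leq_pred.
  have ln (x : L) m : ('X - x%:P) ^+ m.-1 %| ('X - x%:P) ^+ m.-1 *+ m.
    by rewrite -mulr_natr dvdp_mulr.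
  by rewrite dvdp_add // dvdp_mul.
- rewrite szF sizeM ?expf_neq0 ?polyXsubC_eq0 // !size_exp_XsubC; lia.
Qed.

(** Factors found for distinct parameters have no common root, so their product still divides [w];
    each contributes degree at least [a]. *)
Lemma prod_coprime_dvd ts (F : L -> {poly L}) w a :
  w != 0 -> uniq ts ->
  (forall t, t \in ts -> exists h, [/\ h %| F t, h %| w & (a < size h)%N]) ->
  (forall s t x, s \in ts -> t \in ts -> root (F s) x -> root (F t) x -> s = t) ->
  (size ts * a < size w)%N.
Proof.
move=> w0 hu hh hc.
(* The last clause records where the roots of the partial product come from, which makes the next
   factor coprime to it. *)
suff [H [Hw sH _]] : exists H, [/\ H %| w, (size ts * a < size H)%N &
    forall x, root H x -> exists2 t, t \in ts & root (F t) x].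
  exact: leq_trans sH (dvdp_leq w0 Hw).
elim: ts hu hh hc => [|t ts IH] /=.
  by move=> *; exists 1; rewrite dvd1p size_poly1 mul0n; split=> // x; rewrite (negPf (root1 _)).
case/andP=> tts hu hh hc.
case: IH => // [s hs|s r x hs hr|H [Hw sH rH]].
- by apply: hh; rewrite inE hs orbT.
- by apply: hc; rewrite inE ?hs ?hr orbT.
have [h [hF hw sh]] := hh t (mem_head _ _).
have H0 : H != 0 by apply: contraNneq w0 => e; move: Hw; rewrite e dvd0p.
have h0 : h != 0 by apply: contraNneq w0 => e; move: hw; rewrite e dvd0p.
exists (h * H); split.
- rewrite Gauss_dvdp ?hw ?Hw //; apply: Pdiv.ClosedField.root_coprimep.
  move=> x rx; apply/negP => /rH[s hs rs].
  have rt : root (F t) x by apply: root_dvdp rx.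
  have e := hc t s x (mem_head _ _) _ rt rs.
  by move: tts; rewrite e ?hs // inE hs orbT.
- by rewrite sizeM // mulSn; plia.
- move=> x; rewrite rootM => /orP[rx|/rH[s hs rs]].
    by exists t; [rewrite mem_head | apply: (root_dvdp hF)].
  by exists s => //; rewrite inE hs orbT.
Qed.


(* The Wronskian F'Q - FQ' is common to the whole pencil F - tQ, and it is
   divisible by gcd(F - tQ, (F - tQ)') for every t; these are pairwise coprime
   and each of them is large when F - tQ has few roots. *)
Lemma coprime_pencil_size F Q ts k :
  uniq ts -> size ts = 5 -> coprimep F Q -> (0 < k)%N ->
  size F = (size Q + k.+1)%N -> Q != 0 -> k.+1%:R != 0 :> L ->
  (forall t, t \in ts -> at_most_two (root (F - t *: Q))) ->
  (size F <= 3)%N /\ (k <= 1)%N.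
Proof.
move=> hu h5 cop k0 sz Q0 kL h2.
have sQ : (0 < size Q)%N by rewrite size_poly_gt0.
have sFt t : size (F - t *: Q) = size F.
  rewrite size_polyDl // size_polyN (leq_ltn_trans (size_scale_leq _ _)) // sz; plia.
set w := F^`() * Q - F * Q^`().
(* Multiplying by X turns the derivative into scaling the i-th coefficient by i. The top coefficient
   of ['X * w] is then (deg F - deg Q) = k + 1 times the product of the leading coefficients, so [w]
   is not zero. *)
have e1 : ('X * w)`_((size F).-1 + (size Q).-1) =
    k.+1%:R * (lead_coef F * lead_coef Q).
  rewrite /w mulrBr ['X * (F^`() * _)]mulrA ['X * (F * _)]mulrCA coefB.
  have bd (p : {poly L}) : (0 < size p)%N ->
      (size ('X * p^`())%R <= (size p).-1.+1)%N.
    move=> p0; rewrite prednK // (leq_trans (size_polyMleq _ _)) // size_polyX.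
    by have := lt_size_deriv; move=> /(_ _ p); rewrite -size_poly_gt0 => /(_ p0).
  have cf (p : {poly L}) i : ('X * p^`())`_i = p`_i *+ i.
    by rewrite coefXM coef_deriv; case: i => //=; rewrite mulr0n.
  have sF : (0 < size F)%N by rewrite sz; plia.
  rewrite (coefM_top (bd F sF) (leqSpred (size Q))).
  rewrite (coefM_top (leqSpred (size F)) (bd Q sQ)) !cf -!lead_coefE.
  rewrite !mulrnAl mulrnAr mul1r.
  have -> : (size F).-1 = ((size Q).-1 + k.+1)%N by plia.
  by rewrite mulrnDr addrC addKr.
have w0 : w != 0.
  apply: contraNneq kL => e; move: e1; rewrite e mulr0 coef0 => /esym/eqP.
  by rewrite !mulf_eq0 !lead_coef_eq0 (negPf Q0) -(size_poly_eq0 F) sz addnS !orbF.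
have sw : ((size w).+2 <= size F + size Q)%N.
  have sF' : (size F^`() < size F)%N by rewrite lt_size_deriv // -size_poly_gt0; plia.
  have sQ' : (size Q^`() < size Q)%N by rewrite lt_size_deriv.
  have a1 := size_polyMleq F^`() Q; have a2 := size_polyMleq F Q^`().
  have := size_polyD (F^`() * Q) (- (F * Q^`())); rewrite size_polyN -/w.
  plia.
(* With d = deg F, each of the five members contributes d - 2, while [w] has size at most 2d - k -
   1; this leaves d <= 2. *)
have := @prod_coprime_dvd ts (fun t => F - t *: Q) w (size F - 3)%N w0 hu _ _.
rewrite h5 => H; suff : (5 * (size F - 3) < size w)%N by plia.
apply: H => [t ht|s t x hs ht].
  have Ft0 : F - t *: Q != 0 by rewrite -size_poly_gt0 sFt; plia.
  have [h [h1 h3 sh]] := two_roots_gcd_deriv Ft0 (h2 t ht).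
  exists h; split=> //; last by rewrite sFt in sh; plia.
  have -> : w = (F - t *: Q)^`() * Q - (F - t *: Q) * Q^`().
    by rewrite /w derivB derivZ -!mul_polyC; ring.
  by rewrite dvdp_sub // dvdp_mulr.
move=> rs rt; apply: contraTeq cop => st; apply/coprimepPn => //.
  by rewrite -size_poly_gt0; plia.
have Qx : root Q x.
  move: rs rt; rewrite !rootE !hornerE => /eqP rs /eqP rt.
  have : (t - s) * Q.[x] = 0 by rewrite -[RHS](subrr 0) -{1}rs -rt; ring.
  by move/eqP; rewrite mulf_eq0 subr_eq0 eq_sym (negPf st).
have Fx : root F x by move: rs; rewrite !rootE !hornerE (eqP Qx) mulr0 subr0.
exists ('X - x%:P); rewrite dvdp_gcd !dvdp_XsubCl Fx Qx.
by rewrite -size_poly_eq1 size_XsubC.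
Qed.

(** Dividing by the gcd of [p] and [q] leaves a coprime pencil, which must consist of a quadratic
    plus constants. As [p] has degree at least 3, the gcd has a root [y] common to all members; for
    a suitable [t] the two roots of the quadratic are distinct and differ from [y], which makes
    three. *)
Lemma pencil_two_roots p q ts k n :
  uniq ts -> size ts = 5 -> size p = n.+1 -> (3 <= n)%N -> q != 0 ->
  (0 < k)%N -> (size q + k = n)%N -> 2%:R != 0 :> L -> k.+1%:R != 0 :> L ->
  (forall t, t \in ts -> at_most_two (root (p - t *: q))) -> False.
Proof.
move=> hu h5 sp n3 q0 k0 sq c2 ck h2.
have p0 : p != 0 by rewrite -size_poly_gt0 sp.
set g := gcdp p q; have g0 : g != 0 by rewrite gcdp_eq0 negb_and p0.
set F := p %/ g; set Q := q %/ g.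
have eF : p = F * g by rewrite divpK // dvdp_gcdl.
have eQ : q = Q * g by rewrite divpK // dvdp_gcdr.
have cop : coprimep F Q by rewrite coprimep_div_gcd // p0.
have F0 : F != 0 by apply: contraNneq p0 => e; rewrite eF e mul0r.
have Q0 : Q != 0 by apply: contraNneq q0 => e; rewrite eQ e mul0r.
have sF : n.+1 = (size F + size g).-1 by rewrite -sp eF sizeM.
have sQ : size q = (size Q + size g).-1 by rewrite {1}eQ sizeM.
have pF : (0 < size F)%N by rewrite size_poly_gt0.
have pQ : (0 < size Q)%N by rewrite size_poly_gt0.
have pg : (0 < size g)%N by rewrite size_poly_gt0.
have rF t x : root (F - t *: Q) x -> root (p - t *: q) x.
  by move=> rx; rewrite eF eQ scalerAl -mulrBl rootM rx.
have rg t x : root g x -> root (p - t *: q) x.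
  by move=> rx; rewrite eF eQ scalerAl -mulrBl rootM rx orbT.
have sFQ : size F = (size Q + k.+1)%N by plia.
have h2F t : t \in ts -> at_most_two (root (F - t *: Q)).
  by move=> ht a b c /rF ha /rF hb /rF hc; apply: (h2 t ht).
have [s3 k1] := coprime_pencil_size hu h5 cop k0 sFQ Q0 ck h2F.
have {}sF3 : size F = 3 by plia.
have sQ1 : size Q = 1 by plia.
have [y ry] : exists y, root g y by apply/closed_rootP; apply/eqP; plia.
have cc : lead_coef Q != 0 by rewrite lead_coef_eq0.
move: cc; set c := lead_coef Q => cc.
have eQc : Q = c%:P by rewrite (size1_polyC (eq_leq sQ1)) /c lead_coefE sQ1.
have lF : F`_2 != 0.
  have e : F`_2 = lead_coef F by rewrite lead_coefE sF3.
  by rewrite e lead_coef_eq0.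
pose x0 := - F`_1 / (2%:R * F`_2).
have [t ht [t1 t2]] : exists2 t, t \in ts & t != F.[y] / c /\ t != F.[x0] / c.
  case: (boolP (has (fun t => t \notin [:: F.[y] / c; F.[x0] / c]) ts)).
    by case/hasP => t ht; rewrite !inE negb_or => /andP[? ?]; exists t.
  move/hasPn => hs.
  have sub : {subset ts <= [:: F.[y] / c; F.[x0] / c]} by move=> t /hs; rewrite negbK.
  by have := uniq_leq_size hu sub; rewrite h5.
have Ft x : root (F - t *: Q) x = (t == F.[x] / c).
  rewrite eQc rootE !hornerE subr_eq0.
  by apply/eqP/eqP => ->; rewrite ?mulfK ?divfK.
have [rs ers] := closed_field_poly_normal (F - t *: Q).
have sFt : size (F - t *: Q) = 3.
  by rewrite size_polyDl ?sF3 // size_polyN (leq_ltn_trans (size_scale_leq _ _)) // sQ1.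
have l0 : lead_coef (F - t *: Q) != 0 by rewrite lead_coef_eq0 -size_poly_gt0 sFt.
have srs : size rs = 2 by move: sFt; rewrite {1}ers size_scale // size_prod_XsubC => -[].
case: rs srs ers => [|a [|b []]] // _; rewrite !big_cons big_nil mulr1 => ers.
have ra : root (F - t *: Q) a by rewrite ers rootZ // rootM root_XsubC eqxx.
have rb : root (F - t *: Q) b by rewrite ers rootZ // rootM !root_XsubC eqxx orbT.
have ab : a != b.
  apply: contraNneq t2 => e; rewrite -Ft -[x0](_ : a = _) //.
  have : (F - t *: Q)^`().[a] = 0.
    by rewrite ers e derivZ derivM !derivB !derivX !derivC !hornerE; ring.
  rewrite eQc derivB derivZ derivC scaler0 subr0.
  have : (size F^`() <= 2)%N by have := lt_size_deriv F0; rewrite sF3.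
  move=> hs; rewrite (@horner_coef_wide _ 2) // !big_ord_recl big_ord0 !coef_deriv /=.
  move=> h; apply: (mulIf (mulf_neq0 c2 lF)); rewrite /x0 divfK ?mulf_neq0 //.
  move: h; rewrite /bump /= expr0 expr1 !mulr1 addr0 mulr1n => h.
  apply/eqP; rewrite -subr_eq0 opprK; apply/eqP; rewrite -[RHS]h addn0 -mulr_natl; ring.
have := h2 t ht a b y (rF _ _ ra) (rF _ _ rb) (rg _ _ ry).
case=> [/eqP|[e|e]]; first by rewrite (negPf ab).
  by move: t1; rewrite -Ft -e ra.
by move: t1; rewrite -Ft -e rb.
Qed.

End ClosedField.

(** * Rank one perturbations and the resolvent *)

Lemma mx11_det (R : comNzRingType) (A : 'M[R]_1) : \det A = A 0 0.
Proof. by rewrite {1}[A]mx11_scalar det_scalar expr1. Qed.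

(** Two evaluations of the determinant of the bordered matrix [B]; the factor [d] avoids a
    division. *)
Lemma det_scalar_rank1 (R : comNzRingType) n (d : R) (u : 'cV[R]_n) (v : 'rV[R]_n) :
  d * \det (d%:M + u *m v) = d ^+ n * (d + (v *m u) 0 0).
Proof.
pose B : 'M[R]_(1 + n) := block_mx 1%:M (- v) u d%:M.
have e1 : \det B = \det (d%:M + u *m v).
  have -> : B = block_mx 1%:M 0 u 1%:M *m block_mx 1%:M (- v) 0 (d%:M + u *m v).
    rewrite mulmx_block !mul1mx !mulmx1 !mul0mx ?mulmx0 !addr0 mulmxN.
    by rewrite addrC addrK.
  by rewrite det_mulmx det_lblock det_ublock !det1 !mul1r.
have e2 : \det B * d = d ^+ n * (d + (v *m u) 0 0).
  pose C : 'M[R]_(1 + n) := block_mx d%:M 0 (- u) 1%:M.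
  have dC : \det C = d by rewrite det_lblock det1 mulr1 det_scalar expr1.
  transitivity (\det (B *m C)); first by rewrite det_mulmx dC.
  rewrite mulmx_block !mul1mx !mulmx1 !mulmx0 !add0r mulNmx mulmxN opprK.
  rewrite mulmxN mul_mx_scalar mul_scalar_mx subrr det_ublock det_scalar mulrC.
  by congr (_ * _); rewrite mx11_det !mxE eqxx.
by rewrite -e1 mulrC e2.
Qed.

(** Multiplication by the adjugate turns [A] into a scalar matrix. The setting is a domain because
    the matrices will have polynomial entries. *)
Lemma det_add_rank1 (R : idomainType) n (A : 'M[R]_n) (u : 'cV[R]_n) (v : 'rV[R]_n) :
  \det A != 0 ->
  \det (A + u *m v) = \det A + (v *m \adj A *m u) 0 0.
Proof.
move=> dA; set d := \det A in dA *.
have e : \adj A *m (A + u *m v) = d%:M + (\adj A *m u) *m v.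
  by rewrite mulmxDr mul_adj_mx mulmxA.
have dadj : d * \det (\adj A) = d ^+ n by rewrite -det_mulmx mul_mx_adj det_scalar.
have := det_scalar_rank1 d (\adj A *m u) v.
rewrite -e det_mulmx mulrA dadj mulmxA; apply: mulfI.
by rewrite expf_neq0.
Qed.

Lemma size_det_leq (R : idomainType) n (A : 'M[{poly R}]_n) :
  (forall i j, (size (A i j) <= 2)%N) -> (size (\det A) <= n.+1)%N.
Proof.
move=> hA; apply: (leq_trans (size_sum _ _ _)); apply/bigmax_leqP => s _.
rewrite size_Msign; apply: (leq_trans (size_poly_prod_leq _ _)).
rewrite leq_subLR cardT size_enum_ord addnS ltnS.
have -> : (n + n = \sum_(i < n) 2)%N by rewrite sum_nat_const card_ord; lia.
by apply: leq_sum => i _; apply: hA.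
Qed.

Section Resolvent.
Variables (F : fieldType) (n : nat) (M : 'M[F]_n) (y : 'cV[F]_n).
Implicit Types (v : 'rV[F]_n).

(** The numerator of v (X - M)^-1 y over the characteristic polynomial of [M]. *)
Definition resolvent_poly v : {poly F} :=
  (map_mx polyC v *m \adj (char_poly_mx M) *m map_mx polyC y) 0 0.

Lemma size_resolvent v : (size (resolvent_poly v) <= n)%N.
Proof.
rewrite /resolvent_poly mxE.
apply: (leq_trans (size_sum _ _ _)); apply/bigmax_leqP => i _.
rewrite [map_mx _ _ _ _]mxE mulrC mul_polyC; apply: (leq_trans (size_scale_leq _ _)).
rewrite mxE; apply: (leq_trans (size_sum _ _ _)); apply/bigmax_leqP => j _.
rewrite [map_mx _ _ _ _]mxE mul_polyC; apply: (leq_trans (size_scale_leq _ _)).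
rewrite mxE /cofactor size_Msign.
have n0 : (0 < n)%N by apply: leq_ltn_trans (ltn_ord i).
rewrite -[X in (_ <= X)%N](prednK n0).
apply: size_det_leq => a b; rewrite !mxE.
apply: (leq_trans (size_polyD _ _)); rewrite size_polyN geq_max; apply/andP; split.
  by case: (_ == _); rewrite ?mulr1n ?mulr0n ?size_polyX ?size_poly0.
by rewrite (leq_trans (size_polyC_leq1 _)).
Qed.

(** The identity X (X - M)^-1 = M (X - M)^-1 + 1, denominators cleared. Resolvents have degree below
    n, so degree n is reached on the right exactly when [v y] is nonzero. *)
Lemma mulX_resolvent v :
  'X * resolvent_poly v =
  resolvent_poly (v *m M) + ((v *m y) 0 0) *: char_poly M.
Proof.
have e : 'X%:M *m \adj (char_poly_mx M) =
    map_mx polyC M *m \adj (char_poly_mx M) + (char_poly M)%:M.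
  apply/eqP; rewrite addrC -subr_eq -mulmxBl -/(char_poly_mx M).
  by rewrite mul_mx_adj.
rewrite /resolvent_poly map_mxM -!mulmxA.
have : 'X *: (map_mx polyC v *m (\adj (char_poly_mx M) *m map_mx polyC y)) =
  map_mx polyC v *m (('X%:M *m \adj (char_poly_mx M)) *m map_mx polyC y).
  by rewrite mul_scalar_mx -!scalemxAl -scalemxAr.
rewrite e mulmxDl mulmxDr mul_scalar_mx -scalemxAr -map_mxM => /matrixP/(_ 0 0).
rewrite [LHS]mxE [RHS]mxE => ->; rewrite !mulmxA; congr (_ + _).
by rewrite [LHS]mxE [map_mx _ _ 0 0]mxE mulrC mul_polyC.
Qed.

(** The perturbed characteristic polynomials form a pencil in [t], as required by
    [pencil_two_roots]. *)
Lemma char_poly_add_rank1 v t :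
  char_poly (M + t *: (y *m v)) = char_poly M - t *: resolvent_poly v.
Proof.
rewrite /char_poly; have -> : char_poly_mx (M + t *: (y *m v)) =
   char_poly_mx M + map_mx polyC (- t *: y) *m map_mx polyC v.
  rewrite /char_poly_mx -map_mxM -scalemxAl map_mxD opprD addrA scaleNr.
  by congr (_ + _); apply/matrixP => i j; rewrite !mxE rmorphN.
rewrite det_add_rank1; last first.
  by rewrite -/(char_poly M) monic_neq0 // char_poly_monic.
congr (_ + _); rewrite /resolvent_poly.
have -> : map_mx polyC (- t *: y) = (- t%:P) *: map_mx polyC y.
  by apply/matrixP => i j; rewrite !mxE rmorphM rmorphN.
by rewrite -scalemxAr mxE mulNr mul_polyC.
Qed.

End Resolvent.

(** As long as [v y], [v M y], ... vanish, multiplying by X passes from the resolvent of [v] to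
    those of [v M], [v M^2], and so on. A first nonzero [v M^k y] would give the resolvent of [v]
    degree n - 1 - k, which the pencil lemma excludes when k + 1 is invertible: k = 1, 2, 3 use 2, 3
    and 4. *)
Lemma rank1_orthogonal_closed (L : closedFieldType) n (M : 'M[L]_n)
    (y : 'cV[L]_n) (v : 'rV[L]_n) ts :
  uniq ts -> size ts = 5 -> 2%:R != 0 :> L -> 3%:R != 0 :> L -> (3 <= n)%N ->
  v *m y = 0 ->
  (forall t, t \in ts -> at_most_two (eigenvalue (M + t *: (y *m v)))) ->
  [/\ v *m M *m y = 0, v *m M *m M *m y = 0 & v *m M *m M *m M *m y = 0].
Proof.
move=> hu h5 c2 c3 n3 vy h2.
pose q := resolvent_poly M y.
have hX w : w *m y = 0 -> 'X * q w = q (w *m M).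
  by move=> e; rewrite mulX_resolvent e mxE scale0r addr0.
have h2' t : t \in ts -> at_most_two (root (char_poly M - t *: q v)).
  move=> ht a b c; rewrite -char_poly_add_rank1 -!eigenvalue_root_char.
  exact: h2.
have key k w : (0 < k)%N -> k.+1%:R != 0 :> L -> 'X^k * q v = q w -> w *m y = 0.
  move=> k0 ck e; apply/matrixP => i j; rewrite !ord1 [RHS]mxE.
  apply/eqP; apply/negPn/negP => s0.
  have sz : size ('X * q w) = n.+1.
    rewrite mulX_resolvent addrC size_polyDl size_scale // size_char_poly //.
    by rewrite ltnS size_resolvent.
  have q0 : q v != 0.
    by apply: contraTneq (isT : (0 < n.+1)%N); rewrite -sz -e => ->; rewrite !mulr0 size_poly0.
  have sq : (size (q v) + k = n)%N.
    move: sz; rewrite -e mulrA -exprS mulrC size_mulXn //; lia.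
  exact: (pencil_two_roots hu h5 (size_char_poly M) n3 q0 k0 sq c2 ck h2').
have c4 : 4%:R != 0 :> L by rewrite (natrM _ 2 2) mulf_neq0.
have e1 : 'X * q v = q (v *m M) by rewrite hX.
have s1 : v *m M *m y = 0 by apply: (key 1%N).
have e2 : 'X^2 * q v = q (v *m M *m M) by rewrite exprS expr1 -mulrA e1 hX.
have s2 : v *m M *m M *m y = 0 by apply: (key 2%N).
have e3 : 'X^3 * q v = q (v *m M *m M *m M) by rewrite exprS -mulrA e2 hX.
by split=> //; apply: (key 3%N).
Qed.

(** * Subspaces and linear forms *)

Lemma ex_min_nat (P : nat -> Prop) : (exists n, P n) ->
  exists2 n, P n & forall m, P m -> (n <= m)%N.
Proof.
move=> [n]; elim/ltn_ind: n => n IH Pn.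
case: (classic (exists2 m, P m & (m < n)%N)) => [[m Pm /IH]|hn]; first exact.
exists n => // m Pm; rewrite leqNgt; apply/negP => mn; apply: hn; by exists m.
Qed.

Section Subspaces.
Variables (K : fieldType).

(** No decidability is required of [P]: a subspace inside [P] of least codimension contains all of
    [P], since any further vector could be added to it. *)
Lemma subspace_ex (vT : vectType K) (P : vT -> Prop) :
  P 0 -> (forall a u v, P u -> P v -> P (a *: u + v)) ->
  exists W : {vspace vT}, forall v, v \in W <-> P v.
Proof.
move=> P0 Pl.
have [k [W [dW PW]] kmin] : exists2 k, (exists W : {vspace vT},
    (\dim {:vT} - \dim W)%N = k /\ forall v, v \in W -> P v) &
    forall m, (exists W : {vspace vT},
    (\dim {:vT} - \dim W)%N = m /\ forall v, v \in W -> P v) -> (k <= m)%N.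
  apply: ex_min_nat; exists (\dim {:vT} - 0)%N, 0%VS; rewrite dimv0; split=> // v.
  by rewrite memv0 => /eqP->.
exists W => v; split; first exact: PW.
move=> Pv; apply/negPn/negP => vW.
have PWv u : u \in (<[v]> + W)%VS -> P u.
  by case/memv_addP => a /vlineP[c ->] [b hb ->]; apply: Pl => //; apply: PW.
have := kmin _ (ex_intro _ (<[v]> + W)%VS (conj erefl PWv)).
have dlt : (\dim W < \dim (<[v]> + W))%N.
  rewrite ltn_neqAle dimvS ?addvSr // andbT; apply: contra vW => /eqP e.
  have /eqP -> : W == (<[v]> + W)%VS by rewrite eqEdim addvSr e leqnn.
  by apply: (subvP (addvSl _ _)); apply: memv_line.
have := dimvS (subvf (<[v]> + W)%VS); rewrite -dW; lia.
Qed.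

Lemma ex_hom (aT rT : vectType K) (f : aT -> rT) : linear f ->
  exists h : 'Hom(aT, rT), forall x, h x = f x.
Proof.
move=> hf; pose m := GRing.isLinear.Build K aT rT *:%R f hf.
by pose g : {linear aT -> rT} := HB.pack f m; exists (linfun g) => x; rewrite lfunE.
Qed.

Lemma dim_image_kernel (aT rT : vectType K) (f : aT -> rT)
    (V U : {vspace aT}) (W : {vspace rT}) :
  linear f -> (forall v, v \in U <-> v \in V /\ f v = 0) ->
  (forall w, w \in W <-> exists2 v, v \in V & f v = w) ->
  \dim V = (\dim U + \dim W)%N.
Proof.
move=> /ex_hom[h hE] hU hW; rewrite -(limg_ker_dim h V); congr (_ + _)%N; congr (\dim _).
  apply/vspaceP => v; rewrite memv_cap memv_ker hE; apply/idP/idP.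
    by case/andP=> hv /eqP e; apply/hU.
  by case/hU => -> ->; rewrite eqxx.
apply/vspaceP => w; apply/memv_imgP/idP => [[v hv ->]|/hW[v hv <-]].
  by apply/hW; exists v; rewrite ?hE.
by exists v; rewrite ?hE.
Qed.

Lemma image_ex (aT rT : vectType K) (f : aT -> rT) (V : {vspace aT}) :
  linear f -> exists W : {vspace rT}, forall w, w \in W <-> exists2 v, v \in V & f v = w.
Proof.
move=> hf; apply: subspace_ex.
  exists 0; rewrite ?mem0v //; have := hf (-1) 0 0.
  by rewrite scaler0 addr0 scaleN1r addNr.
move=> a u v [u1 h1 <-] [v1 h2 <-]; exists (a *: u1 + v1); last exact: hf.
by rewrite memvD // memvZ.
Qed.

Lemma kernel_ex (aT rT : vectType K) (f : aT -> rT) (V : {vspace aT}) :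
  linear f -> exists W : {vspace aT}, forall v, v \in W <-> v \in V /\ f v = 0.
Proof.
move=> hf; apply: subspace_ex.
  split; rewrite ?mem0v //; have := hf (-1) 0 0.
  by rewrite scaler0 addr0 scaleN1r addNr.
move=> a u v [h1 e1] [h2 e2]; split; first by rewrite memvD // memvZ.
by rewrite hf e1 e2 scaler0 addr0.
Qed.

Lemma dim_inj_leq (aT rT : vectType K) (f : aT -> rT) (V : {vspace aT}) (W : {vspace rT}) :
  linear f -> (forall v, v \in V -> f v = 0 -> v = 0) ->
  (forall v, v \in V -> f v \in W) -> (\dim V <= \dim W)%N.
Proof.
move=> hf hi hW; have [I hI] := image_ex V hf; have [U hU] := kernel_ex V hf.
rewrite (dim_image_kernel hf hU hI).
have -> : U = 0%VS.
  apply/vspaceP => v; rewrite memv0; apply/idP/eqP => [/hU[hv /hi]|->]; first exact.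
  exact: mem0v.
rewrite dimv0; apply: dimvS; apply/subvP => w /hI[v hv <-]; exact: hW.
Qed.

Lemma dim_inj_onto (aT rT : vectType K) (f : aT -> rT) (V : {vspace aT}) (W : {vspace rT}) :
  linear f -> (forall v, v \in V -> f v = 0 -> v = 0) ->
  (forall v, v \in V -> f v \in W) -> (\dim W <= \dim V)%N ->
  forall w, w \in W -> exists2 v, v \in V & f v = w.
Proof.
move=> hf hi hW hd w hw; have [I hI] := image_ex V hf.
have sIW : (I <= W)%VS by apply/subvP => x /hI[v hv <-]; exact: hW.
have dI : (\dim V <= \dim I)%N.
  by apply: (dim_inj_leq hf hi) => v hv; apply/hI; exists v.
have /eqP e : I == W by rewrite eqEdim sIW (leq_trans hd).
by apply/hI; rewrite e.
Qed.

Lemma dim_cV n : \dim {:'cV[K]_n} = n.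
Proof. by rewrite dimvf dim_matrix mulr1. Qed.

Lemma dim_rV n : \dim {:'rV[K]_n} = n.
Proof. by rewrite dimvf dim_matrix mul1r. Qed.

Lemma dim_annihilator n (U : {vspace 'cV[K]_n}) (A : {vspace 'rV[K]_n}) :
  (forall a u, a \in A -> u \in U -> a *m u = 0) -> (\dim U + \dim A <= n)%N.
Proof.
move=> h.
pose B := \matrix_(i < \dim A) (vbasis A)`_i.
pose C := \matrix_(i < \dim U) ((vbasis U)`_i)^T.
have fB : row_free B.
  apply: inj_row_free => v e; apply/rowP => i; rewrite mxE.
  have /freeP fr := basis_free (vbasisP A).
  apply: (fr (fun i => v 0 i)); rewrite -[RHS]e mulmx_sum_row.
  by apply: eq_bigr => j _; rewrite rowK.
have fC : row_free C.
  apply: inj_row_free => v e; apply/rowP => i; rewrite mxE.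
  have /freeP fr := basis_free (vbasisP U).
  apply: (fr (fun i => v 0 i)); rewrite -[RHS](trmx0 K) -e mulmx_sum_row.
  rewrite linear_sum; apply: eq_bigr => j _.
  by rewrite rowK linearZ /= trmxK.
have : B *m C^T = 0.
  apply/matrixP => i j; rewrite mxE; have := h (vbasis A)`_i (vbasis U)`_j.
  rewrite !vbasis_mem ?mem_nth ?size_tuple // => /(_ isT isT)/matrixP/(_ 0 0).
  by rewrite !mxE => e; rewrite -[RHS]e; apply: eq_bigr => k _; rewrite !mxE.
move/mulmx0_rank_max; rewrite mxrank_tr; move: fB fC; rewrite /row_free => /eqP-> /eqP->.
by rewrite addnC.
Qed.

(** [U] equals its double annihilator, by dimensions: evaluation on a basis of [U] shows that the
    annihilator has dimension at least n - dim U, and [dim_annihilator] bounds the double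
    annihilator from above. *)
Lemma separating_form n (U : {vspace 'cV[K]_n}) v : v \notin U ->
  exists2 a : 'rV[K]_n, (forall u, u \in U -> a *m u = 0) & a *m v != 0.
Proof.
move=> vU; have [A hA] : exists A : {vspace 'rV[K]_n},
    forall a, a \in A <-> forall u, u \in U -> a *m u = 0.
  apply: subspace_ex => [u _|c a b ha hb u hu]; first by rewrite mul0mx.
  by rewrite mulmxDl -scalemxAl ha // hb // scaler0 addr0.
apply: NNPP => hn.
have hAv a : a \in A -> a *m v = 0.
  by move=> /hA ha; apply/eqP/negPn/negP => h; apply: hn; exists a.
have [U' hU'] : exists U' : {vspace 'cV[K]_n},
    forall u, u \in U' <-> forall a, a \in A -> a *m u = 0.
  apply: subspace_ex => [a _|c a b ha hb u hu]; first by rewrite mulmx0.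
  by rewrite mulmxDr -scalemxAr ha // hb // scaler0 addr0.
have dA : (n <= \dim U + \dim A)%N.
  pose f (a : 'rV[K]_n) : 'rV[K]_(\dim U) := \row_j (a *m (vbasis U)`_j) 0 0.
  have lf : linear f.
    by move=> c a b; apply/rowP => j; rewrite [LHS]mxE mulmxDl -scalemxAl /f !mxE.
  have [I hI] := image_ex fullv lf.
  have hker a : a \in A <-> a \in fullv /\ f a = 0.
    split=> [/hA ha|[_ e]].
      rewrite memvf; split=> //; apply/rowP => j; rewrite mxE ha ?mxE //.
      by rewrite vbasis_mem // mem_nth ?size_tuple.
    apply/hA => u /coord_vbasis->; rewrite mulmx_sumr big1 // => j _.
    rewrite -scalemxAr; suff -> : a *m (vbasis U)`_j = 0 by rewrite scaler0.
    by apply/matrixP => x y; rewrite !ord1; move/rowP/(_ j): e; rewrite !mxE.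
  have dI : (\dim I <= \dim U)%N.
    by rewrite (leq_trans (dimvS (subvf I))) // dim_rV.
  have aux a i u m : (i <= u)%N -> m = (a + i)%N -> m = n -> (n <= u + a)%N by lia.
  exact: aux dI (dim_image_kernel lf hker hI) (dim_rV n).
have dU' : (\dim U' + \dim A <= n)%N by apply: dim_annihilator => a u ha /hU'; exact.
have sU : (U <= U')%VS by apply/subvP => u hu; apply/hU' => a /hA; apply.
have /eqP e : U == U' by rewrite eqEdim sU -(leq_add2r (\dim A)) (leq_trans dU').
by case/negP: vU; rewrite e; apply/hU'.
Qed.

Lemma strict_upper_block n (R : 'rV[K]_n) (N : 'M[K]_n) :
  strict_upper N -> strict_upper (block_mx 0 R 0 N : 'M_(1 + n)).
Proof.
move=> hN i j; rewrite mxE; case: splitP => i' ->; rewrite mxE; case: splitP => j' ->;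
  rewrite ?ord1 ?mxE //=.
by rewrite leq_add2l => /hN.
Qed.

Lemma strict_upper_lin n a (M N : 'M[K]_n) :
  strict_upper M -> strict_upper N -> strict_upper (a *: M + N).
Proof. by move=> hM hN i j ij; rewrite !mxE hM // hN // mulr0 addr0. Qed.

Lemma strict_upper0 n : strict_upper (0 : 'M[K]_n).
Proof. by move=> i j _; rewrite mxE. Qed.

(** Pascal's rule: the first row is free to the right of the diagonal, and what lies below it is the
    same space in size n. *)
Lemma strict_upper_ex n : exists W : {vspace 'M[K]_n},
  (forall N, N \in W <-> strict_upper N) /\ \dim W = 'C(n, 2).
Proof.
elim: n => [|n [W [hW dW]]].
  exists 0%VS; split; last by rewrite dimv0.
  move=> N; rewrite memv0; split=> [/eqP->|_]; first exact: strict_upper0.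
  by apply/eqP/matrixP => -[].
have [W' hW'] := subspace_ex (@strict_upper0 n.+1) (@strict_upper_lin n.+1).
exists W'; split=> //.
pose f (N : 'M[K]_(1 + n)) := ursubmx N.
have lf : linear f by move=> a M N; apply/matrixP => i j; rewrite !mxE.
have [I hI] := image_ex W' lf; have [U hU] := kernel_ex W' lf.
rewrite (dim_image_kernel lf hU hI) binS bin1 -dW; congr (_ + _)%N; last first.
  suff -> : I = fullv by rewrite dim_rV.
  apply/vspaceP => R; rewrite memvf; apply/hI; exists (block_mx 0 R 0 0 : 'M_(1 + n)).
    by apply/hW'; apply: strict_upper_block; exact: strict_upper0.
  by rewrite /f block_mxKur.
pose g (N : 'M[K]_(1 + n)) := drsubmx N.
have lg : linear g by move=> a M N; apply/matrixP => i j; rewrite !mxE.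
apply/eqP; rewrite eqn_leq; apply/andP; split.
  apply: (dim_inj_leq lg) => N /hU[/hW' hN e].
    rewrite /g => e2; rewrite -[N]submxK -/(f N) e e2.
    apply/matrixP => i j; rewrite !mxE; case: splitP => i' hi; rewrite mxE; case: splitP => j' hj;
      rewrite !mxE // ?(hN _ _) // ?ord1 //=.
  by apply/hW => i j ij; rewrite !mxE; apply: hN.
pose h (N : 'M[K]_n) : 'M[K]_(1 + n) := block_mx 0 0 0 N.
have lh : linear h.
  move=> a M N; rewrite /h scale_block_mx add_block_mx !scaler0 !addr0 //.
apply: (dim_inj_leq lh) => N hN.
  by move/(congr1 (@drsubmx _ 1 n 1 n)); rewrite block_mxKdr => ->; apply/matrixP => i j; rewrite !mxE.
apply/hU; split; last by rewrite /f block_mxKur.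
by apply/hW'; apply: strict_upper_block; apply/hW.
Qed.

End Subspaces.

(** * Conjugation and transposition of matrix spaces *)

Section Linear.
Variable K : fieldType.

Lemma det0_kernel n (M : 'M[K]_n) :
  \det M = 0 <-> exists2 y : 'cV[K]_n, y != 0 & M *m y = 0.
Proof.
rewrite -det_tr; split=> [/eqP/det0P[v v0 e]|[y y0 e]].
  exists v^T; first by rewrite -(inj_eq trmx_inj) trmxK trmx0.
  by apply: trmx_inj; rewrite trmx_mul trmxK trmx0.
apply/eqP/det0P; exists y^T; first by rewrite -(inj_eq trmx_inj) trmxK trmx0.
by rewrite -trmx_mul e trmx0.
Qed.

Definition conj_mx n (P M : 'M[K]_n) := P *m M *m invmx P.

Definition conj_vs n (P : 'M[K]_n) (V : {vspace 'M[K]_n}) : {vspace 'M[K]_n} :=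
  (linfun (mulmxr (invmx P) \o mulmx P) @: V)%VS.

Lemma conj_mxK n (P M : 'M[K]_n) : P \in unitmx -> conj_mx (invmx P) (conj_mx P M) = M.
Proof. by move=> hP; rewrite /conj_mx invmxK !mulmxA mulVmx // mul1mx mulmxKV. Qed.

Lemma conj_mxVK n (P M : 'M[K]_n) : P \in unitmx -> conj_mx P (conj_mx (invmx P) M) = M.
Proof. by move=> hP; rewrite /conj_mx invmxK !mulmxA mulmxV // mul1mx mulmxK. Qed.

Lemma mem_conj_vs n P (V : {vspace 'M[K]_n}) M : P \in unitmx ->
  (M \in conj_vs P V) = (conj_mx (invmx P) M \in V).
Proof.
move=> hP; apply/memv_imgP/idP => [[N hN ->]|h].
  by rewrite lfunE /= -/(conj_mx P N) conj_mxK.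
by exists (conj_mx (invmx P) M); rewrite // lfunE /= -/(conj_mx P _) conj_mxVK.
Qed.

Lemma memv_conj n P (V : {vspace 'M[K]_n}) M : P \in unitmx -> M \in V ->
  conj_mx P M \in conj_vs P V.
Proof. by move=> hP hM; rewrite mem_conj_vs // conj_mxK. Qed.

Lemma dim_conj_vs n P (V : {vspace 'M[K]_n}) : P \in unitmx -> \dim (conj_vs P V) = \dim V.
Proof.
move=> hP; apply: limg_dim_eq; apply/eqP; rewrite -subv0; apply/subvP => M.
rewrite memv_cap memv_ker memv0 lfunE /= => /andP[_ /eqP e].
have : conj_mx P M = 0 by [].
by move/(congr1 (conj_mx (invmx P))); rewrite conj_mxK // /conj_mx mulmx0 mul0mx => ->.
Qed.

Lemma conj_mxM n (P M N : 'M[K]_n) : P \in unitmx ->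
  conj_mx P (M *m N) = conj_mx P M *m conj_mx P N.
Proof. by move=> hP; rewrite /conj_mx !mulmxA mulmxKV. Qed.

Lemma conj_mx_scalar n (P : 'M[K]_n) c : P \in unitmx -> conj_mx P c%:M = c%:M.
Proof. by move=> hP; rewrite /conj_mx mul_mx_scalar -scalemxAl mulmxV // scalemx1. Qed.

Lemma conj_mx_lin n (P M N : 'M[K]_n) a : conj_mx P (a *: M + N) = a *: conj_mx P M + conj_mx P N.
Proof. by rewrite /conj_mx mulmxDr mulmxDl -scalemxAr -scalemxAl. Qed.

Lemma invmx_mul n (P Q : 'M[K]_n) : P \in unitmx -> Q \in unitmx ->
  invmx (P *m Q) = invmx Q *m invmx P.
Proof.
move=> hP hQ; have hPQ : P *m Q \in unitmx by rewrite unitmx_mul hP.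
by rewrite -[RHS](mulmxK hPQ) [_ *m (P *m Q)]mulmxA mulmxKV // mulVmx // mul1mx.
Qed.

Lemma conj_mx_mul n (P Q M : 'M[K]_n) : P \in unitmx -> Q \in unitmx ->
  conj_mx (P *m Q) M = conj_mx P (conj_mx Q M).
Proof. by move=> hP hQ; rewrite /conj_mx invmx_mul // !mulmxA. Qed.

Lemma conj_vs_mul n (P Q : 'M[K]_n) V : P \in unitmx -> Q \in unitmx ->
  conj_vs (P *m Q) V = conj_vs P (conj_vs Q V).
Proof.
move=> hP hQ; apply/vspaceP => M; rewrite !mem_conj_vs ?unitmx_mul ?hP //.
by rewrite invmx_mul // conj_mx_mul // unitmx_inv.
Qed.

Definition tr_vs n (V : {vspace 'M[K]_n}) : {vspace 'M[K]_n} := (linfun trmx @: V)%VS.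

Lemma mem_tr_vs n (V : {vspace 'M[K]_n}) M : (M \in tr_vs V) = (M^T \in V).
Proof.
apply/memv_imgP/idP => [[N hN ->]|h]; first by rewrite lfunE /= trmxK.
by exists M^T; rewrite // lfunE /= trmxK.
Qed.

Lemma dim_tr_vs n (V : {vspace 'M[K]_n}) : \dim (tr_vs V) = \dim V.
Proof.
apply: limg_dim_eq; apply/eqP; rewrite -subv0; apply/subvP => M.
rewrite memv_cap memv_ker memv0 lfunE /= => /andP[_ /eqP e].
by rewrite -[M]trmxK e trmx0.
Qed.

End Linear.

(** * Eigenvalues in the closure and the classes used in the induction *)

Section Spectrum.
Variables (K : fieldType) (L : closedFieldType) (iota : {rmorphism K -> L}).

Definition spec n (M : 'M[K]_n) (a : L) := eigenvalue (map_mx iota M) a.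

Lemma eigenvalue_det (F : fieldType) n (M : 'M[F]_n) a :
  eigenvalue M a = (\det (a%:M - M) == 0).
Proof.
rewrite /eigenvalue /eigenspace kermx_eq0 row_free_unit unitmxE unitfE negbK.
by rewrite -opprB -scaleN1r detZ mulf_eq0 signr_eq0.
Qed.

Lemma specE n (M : 'M[K]_n) a : spec M a = (\det (a%:M - map_mx iota M) == 0).
Proof. exact: eigenvalue_det. Qed.

Lemma spec_ublock m n (A : 'M[K]_m) B (D : 'M[K]_n) a :
  spec (block_mx A B 0 D) a = spec A a || spec D a.
Proof.
rewrite !specE map_block_mx map_mx0 scalar_mx_block.
by rewrite opp_block_mx add_block_mx oppr0 addr0 det_ublock mulf_eq0.
Qed.

Lemma spec_tr n (M : 'M[K]_n) a : spec M^T a = spec M a.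
Proof. by rewrite !specE -map_trmx -det_tr linearB /= trmxK tr_scalar_mx. Qed.

Lemma spec_conj n (P M : 'M[K]_n) a : P \in unitmx -> spec (conj_mx P M) a = spec M a.
Proof.
move=> hP; rewrite !specE; set P' := map_mx iota P.
have hP' : P' \in unitmx by rewrite map_unitmx.
have -> : a%:M - map_mx iota (conj_mx P M) =
   P' *m (a%:M - map_mx iota M) *m invmx P'.
  rewrite mulmxBr mulmxBl mul_mx_scalar -scalemxAl mulmxV // scalemx1.
  by rewrite /conj_mx !map_mxM map_invmx.
rewrite !det_mulmx !mulf_eq0; move: hP'; rewrite unitmxE unitfE => /negPf h.
by rewrite h /= det_inv invr_eq0 h orbF.
Qed.

Lemma spec_addc n (M : 'M[K]_n) c a : spec (M + c%:M) a = spec M (a - iota c).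
Proof.
by rewrite !specE map_mxD map_scalar_mx opprD addrCA addrC -raddfB addrC.
Qed.

Lemma spec_tri n (M : 'M[K]_n) a : (forall i j : 'I_n, (j < i)%N -> M i j = 0) ->
  spec M a -> exists i, a = iota (M i i).
Proof.
move=> h; rewrite -spec_tr specE det_trig.
  by move/prodf_eq0 => [i _]; rewrite !mxE eqxx mulr1n subr_eq0 => /eqP->; exists i.
apply/is_trig_mxP => i j ij; rewrite !mxE h // rmorph0 subr0.
by case: eqP ij => // ->; rewrite ltnn.
Qed.

Lemma spec_diag n (M : 'M[K]_n) i : (forall i j : 'I_n, (j < i)%N -> M i j = 0) ->
  spec M (iota (M i i)).
Proof.
move=> h; rewrite -spec_tr specE det_trig.
  by apply/prodf_eq0; exists i => //; rewrite !mxE eqxx mulr1n subrr.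
apply/is_trig_mxP => i' j ij; rewrite !mxE (h j i') // rmorph0 subr0.
by case: eqP ij => // ->; rewrite ltnn.
Qed.

Lemma spec_eigvec n (M : 'M[K]_n) (y : 'cV[K]_n) c : y != 0 -> M *m y = c *: y ->
  spec M (iota c).
Proof.
move=> y0 e; rewrite /spec eigenvalue_map eigenvalue_det.
apply/eqP/det0_kernel; exists y => //.
by rewrite mulmxBl e mul_scalar_mx subrr.
Qed.

Lemma spec_K n (M : 'M[K]_n) c :
  spec M (iota c) -> exists2 y : 'cV[K]_n, y != 0 & M *m y = c *: y.
Proof.
rewrite /spec eigenvalue_map eigenvalue_det => /eqP/det0_kernel[y y0 e].
exists y => //; apply/esym/eqP; rewrite -subr_eq0; apply/eqP.
by rewrite -[RHS]e mulmxBl mul_scalar_mx.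
Qed.

Lemma spec_ex n (M : 'M[K]_n) : (0 < n)%N -> exists a, spec M a.
Proof.
move=> n0; have : size (char_poly (map_mx iota M)) != 1.
  by rewrite size_char_poly; case: n n0 M.
by case/closed_rootP => a; exists a; rewrite /spec eigenvalue_root_char.
Qed.

Definition nil_mx n (M : 'M[K]_n) := forall a, spec M a -> a = 0.

Definition one_nonzero n (M : 'M[K]_n) :=
  forall a b, spec M a -> spec M b -> a != 0 -> b != 0 -> a = b.

(** The Boolean also counts: read as 0 or 1, it is the dimension contributed by a diagonal part in
    the bounds below. *)
Definition good (e : bool) n (M : 'M[K]_n) := if e then one_nonzero M else nil_mx M.

Definition two_spec n (V : {vspace 'M[K]_n}) :=
  forall M, M \in V -> at_most_two_eigenvalues iota M.

(* The classes to which the induction applies. [e = true]: at most two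
   eigenvalues; [e = false]: moreover a matrix having an eigenvalue in the ground
   field has no other eigenvalue. *)
Definition spectral (e : bool) n (V : {vspace 'M[K]_n}) :=
  [/\ 1%:M \in V, two_spec V & forall M, M \in V -> \det M = 0 -> good e M].

Lemma two_spec_one n (M : 'M[K]_n) : at_most_two_eigenvalues iota M -> \det M = 0 ->
  one_nonzero M.
Proof.
move=> h /det0_kernel[y y0 e] a b ha hb a0 b0.
have h0 : spec M 0 by rewrite -(rmorph0 iota); apply: (spec_eigvec y0); rewrite e scale0r.
by case: (h _ _ _ h0 ha hb) => [e0|[e0|]] //; move: a0 b0; rewrite -e0 eqxx.
Qed.

Lemma good_spec e n m (M : 'M[K]_n) (N : 'M[K]_m) :
  (forall a, spec N a -> spec M a) -> good e M -> good e N.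
Proof. by case: e => h g => [a b /h ha /h hb|a /h]; [apply: g | apply: g]. Qed.

Lemma spectral_conj e n P (V : {vspace 'M[K]_n}) : P \in unitmx ->
  spectral e V -> spectral e (conj_vs P V).
Proof.
move=> hP [h1 h2 h3]; split.
- by rewrite mem_conj_vs // conj_mx_scalar // unitmx_inv.
- move=> M; rewrite mem_conj_vs // => /h2 h a b c.
  rewrite -!/(spec _ _) -!(@spec_conj _ (invmx P) M) ?unitmx_inv //; exact: h.
- move=> M; rewrite mem_conj_vs // => /h3 h /det0_kernel[y y0 e0].
  apply: (@good_spec _ _ _ (conj_mx (invmx P) M)).
    by move=> a; rewrite spec_conj ?unitmx_inv.
  apply: h; apply/det0_kernel; exists (invmx P *m y).
    apply: contraNneq y0 => e1; rewrite -[y](mulKVmx hP) e1 mulmx0 //.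
  by rewrite /conj_mx invmxK -!mulmxA mulKVmx // e0 mulmx0.
Qed.

Lemma spectral_tr e n (V : {vspace 'M[K]_n}) : spectral e V -> spectral e (tr_vs V).
Proof.
move=> [h1 h2 h3]; split.
- by rewrite mem_tr_vs tr_scalar_mx.
- move=> M; rewrite mem_tr_vs => /h2 h a b c.
  by rewrite -!/(spec _ _) -!(@spec_tr _ M); apply: h.
- move=> M; rewrite mem_tr_vs -det_tr => /h3 h /h; apply: good_spec => a.
  by rewrite spec_tr.
Qed.

Hypotheses (c2 : 2%:R != 0 :> K) (c3 : 3%:R != 0 :> K).

(** Distinct because 2 and 3, hence 4, are invertible. Five points determine a polynomial of degree
    4. *)
Definition five : seq K := [:: 0; 1; -1; 2%:R; - 2%:R].

Lemma uniq_five : uniq five.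
Proof.
have c1 : 1 != 0 :> K := oner_neq0 _.
have c4 : 4%:R != 0 :> K by rewrite (natrM _ 2 2) mulf_neq0.
have ne (x y : K) : x - y != 0 -> x != y by rewrite subr_eq0.
rewrite /five /= !inE !negb_or !andbT -!andbA.
do ![apply/andP; split]; apply: ne.
- by rewrite sub0r oppr_eq0.
- by rewrite sub0r opprK.
- by rewrite sub0r oppr_eq0.
- by rewrite sub0r opprK.
- by rewrite opprK.
- by rewrite (_ : _ - _ = -1) ?oppr_eq0 //; ring.
- by rewrite (_ : _ - _ = 3%:R) //; ring.
- by rewrite (_ : _ - _ = - 3%:R) ?oppr_eq0 //; ring.
- by rewrite (_ : _ - _ = 1) //; ring.
- by rewrite (_ : _ - _ = 4%:R) //; ring.
Qed.

Lemma five_avoid (s : seq L) : (size s < 5)%N -> exists t : K, iota t \notin s.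
Proof.
move=> hs; apply: NNPP => hn.
have sub : {subset map iota five <= s}.
  move=> x /mapP[t _ ->]; apply/negPn/negP => h; apply: hn; by exists t.
have := uniq_leq_size _ sub; rewrite map_inj_uniq ?uniq_five; last exact: fmorph_inj.
by move=> /(_ isT); rewrite size_map leqNgt hs.
Qed.

Lemma avoidK (s : seq K) : (size s < 5)%N -> exists t : K, t \notin s.
Proof.
move=> hs; have [|t ht] := @five_avoid (map iota s); first by rewrite size_map.
by exists t; apply: contra ht => h; apply: map_f.
Qed.

(** The five parameters are taken in [K], so that the perturbed matrices stay in [V]; only their
    eigenvalues live in the closure. *)
Lemma rank1_orthogonal n (V : {vspace 'M[K]_n}) (M : 'M[K]_n) (y : 'cV[K]_n) (v : 'rV[K]_n) :
  two_spec V -> (3 <= n)%N -> M \in V -> y *m v \in V -> v *m y = 0 ->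
  [/\ v *m M *m y = 0, v *m M *m M *m y = 0 & v *m M *m M *m M *m y = 0].
Proof.
move=> h2 n3 hM hA vy.
have inj0 m (N : 'M[K]_(m, 1)) : map_mx iota N = 0 -> N = 0.
  by move/(congr1 (fun X : 'M_(m, 1) => X)) => e; apply: (map_mx_inj (f := iota)); rewrite e map_mx0.
have := @rank1_orthogonal_closed L n (map_mx iota M) (map_mx iota y) (map_mx iota v) (map iota five).
rewrite -!map_mxM vy map_mx0 map_inj_uniq ?uniq_five; last exact: fmorph_inj.
case=> //.
- by rewrite -(rmorph_nat iota) fmorph_eq0.
- by rewrite -(rmorph_nat iota) fmorph_eq0.
- move=> t /mapP[s _ ->] a b c; rewrite -map_mxZ -map_mxD.
  by apply: h2; rewrite memvD // memvZ.
by move=> e1 e2 e3; split; apply: inj0.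
Qed.

End Spectrum.

(** * Flags *)

Section FirstVector.
Variable K : fieldType.

Definition vec0 m : 'cV[K]_(1 + m) := delta_mx 0 0.

Lemma vec0_neq0 m : vec0 m != 0.
Proof.
apply: contraTneq (isT : true) => /matrixP/(_ 0 0); rewrite !mxE !eqxx => /eqP.
by rewrite oner_eq0.
Qed.

Lemma vec0_col m : vec0 m = col_mx 1%:M 0.
Proof.
apply/matrixP => i j; rewrite !ord1 !mxE eqxx andbT.
have -> : (i == 0) = (i == 0%N :> nat) by [].
by case: splitP => k ->; rewrite mxE ?ord1.
Qed.

Lemma mul_block_vec0 m (a : 'M[K]_1) R C (N : 'M[K]_m) :
  block_mx a R C N *m vec0 m = col_mx a C.
Proof. by rewrite vec0_col mul_block_col !mulmx1 !mulmx0 !addr0. Qed.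

Lemma mul_vec0_eq0 m (M : 'M[K]_(1 + m)) : M *m vec0 m = 0 ->
  M = block_mx 0 (ursubmx M) 0 (drsubmx M).
Proof.
rewrite -{1 2}[M]submxK mul_block_vec0 => e.
have := (congr1 usubmx e, congr1 dsubmx e).
rewrite col_mxKu col_mxKd => -[-> ->].
by congr block_mx; apply/matrixP => i j; rewrite !mxE.
Qed.

Lemma vec0_mul_row m (R : 'rV[K]_m) : vec0 m *m row_mx 0 R = block_mx (0 : 'M_1) R (0 : 'M_(m, 1)) 0.
Proof. by rewrite vec0_col mul_col_row !mul1mx !mul0mx. Qed.

Lemma unit_to_vec0 m (y : 'cV[K]_(1 + m)) : y != 0 ->
  exists2 P : 'M[K]_(1 + m), P \in unitmx & P *m y = vec0 m.
Proof.
move=> y0; have ry : \rank y = 1.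
  by apply/eqP; rewrite eqn_leq rank_leq_col lt0n mxrank_eq0.
have e := mulmx_ebase y; set P := col_ebase y in e; set c := row_ebase y in e.
have hP : P \in unitmx by apply: col_ebase_unit.
have hc : c 0 0 != 0.
  by have := row_ebase_unit y; rewrite -/c unitmxE unitfE mx11_det.
exists ((c 0 0)^-1 *: invmx P).
  by rewrite unitmxZ ?unitfE ?invr_eq0 // unitmx_inv.
rewrite -scalemxAl -e -!mulmxA mulKmx // ry [X in pid_mx 1 *m X]mx11_scalar mul_mx_scalar scalerA.
rewrite mulVf // scale1r; apply/matrixP => i j; rewrite !ord1 !mxE.
by rewrite eqxx andbT /=; case: i => -[|i] hi.
Qed.

Lemma conj_block1 m (P : 'M[K]_m) (a : 'M[K]_1) R C N : P \in unitmx ->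
  conj_mx (block_mx 1%:M 0 0 P : 'M_(1 + m)) (block_mx a R C N) =
  block_mx a (R *m invmx P) (P *m C) (conj_mx P N).
Proof.
move=> hP; rewrite /conj_mx.
have -> : invmx (block_mx 1%:M 0 0 P : 'M_(1 + m)) = block_mx 1%:M 0 0 (invmx P).
  have hB : (block_mx 1%:M 0 0 P : 'M_(1 + m)) \in unitmx.
    by rewrite unitmxE det_ublock det1 mul1r -unitmxE.
  rewrite -[RHS](mulKmx hB) mulmx_block !mulmx0 !mul0mx !mulmx1 !addr0 !add0r mulmxV //.
  by rewrite -scalar_mx_block mulmx1.
by rewrite !mulmx_block !mul1mx !mulmx0 !mul0mx !mulmx1 !addr0 !add0r.
Qed.

Lemma unit_block1 m (P : 'M[K]_m) : P \in unitmx ->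
  (block_mx 1%:M 0 0 P : 'M_(1 + m)) \in unitmx.
Proof. by move=> hP; rewrite unitmxE det_ublock det1 mul1r -unitmxE. Qed.

End FirstVector.

Section Flags.
Variables (K : fieldType) (L : closedFieldType) (iota : {rmorphism K -> L}).
Hypotheses (c2 : 2%:R != 0 :> K) (c3 : 3%:R != 0 :> K).

(** For [e = false] this is Gerstenhaber's theorem on spaces of nilpotent matrices; for [e = true]
    one nonzero eigenvalue is allowed and the line K D_I is the extra dimension. [I] may be the
    whole index set. *)
Definition bound (e : bool) m :=
  forall V : {vspace 'M[K]_m}, (forall M, M \in V -> good iota e M) ->
  (\dim V <= 'C(m, 2) + e)%N /\
  (\dim V = ('C(m, 2) + e)%N -> exists P (I : {set 'I_m}),
     [/\ P \in unitmx, (I != set0) = e & forall M, M \in V <->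
       exists b N, strict_upper N /\ conj_mx P M = b *: DI K I + N]).

(** The two clauses together: the elements killing the first basis vector act on the quotient
    exactly as K D_I + NT_m. Their first row is left open. *)
Definition flagged m (V : {vspace 'M[K]_(1 + m)}) (I : {set 'I_m}) :=
  (forall M, M \in V -> M *m vec0 K m = 0 ->
     exists b N, strict_upper N /\ drsubmx M = b *: DI K I + N) /\
  (forall b N, strict_upper N -> exists R, block_mx 0 R 0 (b *: DI K I + N) \in V).

(** The converse of the orthogonality relation: every form vanishing on Vy gives an element of
    [V]. *)
Definition saturated n (V : {vspace 'M[K]_n}) :=
  forall (y : 'cV[K]_n) (v : 'rV[K]_n), y != 0 ->
  (forall M, M \in V -> v *m M *m y = 0) -> y *m v \in V.

Lemma binS2 m : 'C(1 + m, 2) = ('C(m, 2) + m)%N.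
Proof. by rewrite add1n binS bin1. Qed.

(** dim V is the sum of the dimensions of [S] = Vy, of [G], the action on the quotient, and of [U],
    the elements killing y with values in Ky. [U] embeds into [A], which annihilates [S], so the sum
    cannot exceed the assumed lower bound and all estimates are equalities. *)
Lemma spectral_first_vector e m (V : {vspace 'M[K]_(1 + m)}) :
  (2 <= m)%N -> spectral iota e V -> bound e m -> ('C(1 + m, 2) + 1 + e <= \dim V)%N ->
  [/\ \dim V = ('C(1 + m, 2) + 1 + e)%N,
      forall v, (forall M, M \in V -> v *m M *m vec0 K m = 0) -> vec0 K m *m v \in V
    & exists P I, [/\ P \in unitmx, P *m vec0 K m = vec0 K m, (I != set0) = e
        & flagged (conj_vs P V) I]].
Proof.
move=> m2 [hI h2 hg] hB hd; set y := vec0 K m.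
pose f (M : 'M[K]_(1 + m)) := M *m y.
have lf : linear f by move=> a M N; rewrite /f mulmxDl -scalemxAl.
have [S hS] := image_ex V lf; have [W hW] := kernel_ex V lf.
pose g (M : 'M[K]_(1 + m)) := drsubmx M.
have lg : linear g by move=> a M N; apply/matrixP => i j; rewrite !mxE.
have [G hG] := image_ex W lg; have [U hU] := kernel_ex W lg.
have dV := dim_image_kernel lf hW hS; have dW := dim_image_kernel lg hU hG.
have [A hA] : exists A : {vspace 'rV[K]_(1 + m)},
    forall v, v \in A <-> v *m y = 0 /\ y *m v \in V.
  apply: subspace_ex; first by rewrite mul0mx mulmx0 mem0v.
  move=> a u v [h1 h3] [h4 h5]; split.
    by rewrite mulmxDl -scalemxAl h1 h4 scaler0 addr0.
  by rewrite mulmxDr -scalemxAr memvD // memvZ.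
have dU : (\dim U <= \dim A)%N.
  pose h (M : 'M[K]_(1 + m)) := usubmx M : 'rV_(1 + m).
  have lh : linear h by move=> a M N; apply/matrixP => i j; rewrite !mxE.
  have eM M : M \in U -> M = block_mx 0 (ursubmx M) 0 0.
    case/hU => /hW[_ /mul_vec0_eq0 e1] e2; rewrite {1}e1; congr block_mx; exact: e2.
  apply: (dim_inj_leq lh) => M hM.
    move=> hM0; rewrite (eM _ hM) /ursubmx -/(h M) hM0.
    by apply/matrixP => i j; rewrite !mxE; do 2!(case: splitP => * //; rewrite !mxE).
  apply/hA; rewrite (eM _ hM) /h block_mxEv col_mxKu vec0_mul_row -(eM _ hM) /y vec0_col mul_row_col mul0mx mulmx0 addr0.
  by split=> //; case/hU: hM => /hW[].
have orth a u : a \in A -> u \in S -> a *m u = 0.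
  case/hA => a0 ha /hS[M hM <-].
  by case: (rank1_orthogonal c2 c3 h2 _ hM ha a0) => //; rewrite mulmxA.
have dSA := dim_annihilator orth.
(* Elements killing y are singular, hence [good e], and the eigenvalues of the quotient action are
   among theirs. *)
have [dG eG] : (\dim G <= 'C(m, 2) + e)%N /\
  (\dim G = ('C(m, 2) + e)%N -> exists P (I : {set 'I_m}),
     [/\ P \in unitmx, (I != set0) = e & forall M, M \in G <->
       exists b N, strict_upper N /\ conj_mx P M = b *: DI K I + N]).
  apply: hB => N /hG[M /hW[hM e0] <-].
  apply: (@good_spec _ _ _ _ _ _ M).
    by move=> a ha; rewrite (mul_vec0_eq0 e0) spec_ublock ha orbT.
  by apply: hg => //; apply/det0_kernel; exists y; rewrite // vec0_neq0.
have b2 := binS2 m.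
have aux (v w s u g' a b b' m' e' : nat) : v = (w + s)%N -> w = (u + g')%N ->
    (u <= a)%N -> (s + a <= 1 + m')%N -> (g' <= b' + e')%N -> b = (b' + m')%N ->
    (b + 1 + e' <= v)%N -> [/\ v = (b + 1 + e')%N, g' = (b' + e')%N & (s + a = 1 + m')%N].
  by clear => *; split; lia.
have [dimV dimG dimSA] := aux _ _ _ _ _ _ _ _ _ _ dV dW dU dSA dG b2 hd.
split=> //.
  move=> v hv; have vy : v *m y = 0 by rewrite -(hv _ hI) mulmx1.
  suff /hA[] : v \in A by [].
  (* Adding [v] to [A] keeps it orthogonal to [S]; the dimensions of [S] and [A] already add up to 1
     + m, so [v] was in [A]. *)
  pose A' := (A + <[v]>)%VS.
  have orth' a u : a \in A' -> u \in S -> a *m u = 0.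
    case/memv_addP => a1 h1 [_ /vlineP[c ->] ->] hu.
    rewrite mulmxDl orth // add0r -scalemxAl; case/hS: hu => M hM <-.
    by rewrite /f mulmxA hv // scaler0.
  have := dim_annihilator orth' => dSA'.
  have /eqP e1 : A == A'.
    by rewrite eqEdim addvSl -(leq_add2l (\dim S)) (leq_trans dSA') // dimSA.
  by rewrite e1; apply: (subvP (addvSr _ _)); apply: memv_line.
have [P [I [hP eI hPI]]] := eG dimG.
pose Q := block_mx 1%:M 0 0 P : 'M_(1 + m).
have hQ : Q \in unitmx by apply: unit_block1.
have Q0 : Q *m y = y by rewrite /Q mul_block_vec0 /y vec0_col.
exists Q, I; split=> //; split.
  move=> M; rewrite mem_conj_vs // => hM e0.
  set M' := conj_mx (invmx Q) M in hM.
  have eM : M = conj_mx Q M' by rewrite conj_mxVK.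
  have e1 : M' *m y = 0.
    by rewrite /M' /conj_mx invmxK -!mulmxA Q0 e0 mulmx0.
  have : drsubmx M' \in G by apply/hG; exists M' => //; apply/hW.
  move/hPI => [b [N [hN eN]]]; exists b, N; split=> //; rewrite -eN eM.
  by rewrite (mul_vec0_eq0 e1) conj_block1 // block_mxKdr block_mxKdr.
move=> b N hN; have : conj_mx (invmx P) (b *: DI K I + N) \in G.
  by apply/hPI; exists b, N; rewrite conj_mxVK.
case/hG => M /hW[hM e1] e2; exists (ursubmx M *m invmx P).
have := memv_conj hQ hM; rewrite (mul_vec0_eq0 e1) conj_block1 // mulmx0 block_mxKur.
by rewrite -/(g M) e2 conj_mxVK.
Qed.

Lemma spectral_flag e m (V : {vspace 'M[K]_(1 + m)}) :
  (2 <= m)%N -> spectral iota e V -> bound e m -> ('C(1 + m, 2) + 1 + e <= \dim V)%N ->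
  [/\ \dim V = ('C(1 + m, 2) + 1 + e)%N, saturated V
    & forall y, y != 0 -> exists P I, [/\ P \in unitmx, P *m y = vec0 K m,
        (I != set0) = e & flagged (conj_vs P V) I]].
Proof.
move=> m2 hs hB hd.
have main y : y != 0 -> exists P, [/\ P \in unitmx, P *m y = vec0 K m &
    [/\ \dim V = ('C(1 + m, 2) + 1 + e)%N,
      forall v, (forall M, M \in V -> v *m M *m y = 0) -> y *m v \in V
    & exists P I, [/\ P \in unitmx, P *m y = vec0 K m, (I != set0) = e
        & flagged (conj_vs P V) I]]].
  case/unit_to_vec0 => P hP Py; exists P; split=> //.
  have hd' : ('C(1 + m, 2) + 1 + e <= \dim (conj_vs P V))%N by rewrite dim_conj_vs.
  have [d1 d2 [Q [I [hQ Q0 eI hf]]]] :=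
    spectral_first_vector m2 (spectral_conj hP hs) hB hd'.
  have yE : y = invmx P *m vec0 K m by rewrite -Py mulKmx.
  split; first by rewrite -d1 dim_conj_vs.
    move=> v hv; suff : vec0 K m *m (v *m invmx P) \in conj_vs P V.
      rewrite mem_conj_vs // /conj_mx invmxK !mulmxA -yE mulmxKV //.
    apply: d2 => M; rewrite mem_conj_vs // => /hv <-.
    by rewrite yE /conj_mx invmxK !mulmxA mulmxK // mulmxK.
  exists (Q *m P), I; split=> //; first by rewrite unitmx_mul hQ.
    by rewrite -mulmxA Py.
  by rewrite conj_vs_mul.
split; first by case: (main _ (vec0_neq0 K m)) => P [_ _ []].
  by move=> y v /main[P [_ _ [_ h _]]]; apply: h.
by move=> y /main[P [_ _ [_ _ h]]].
Qed.

(** Vy is spanned by the basis vectors up to [k], the last index reached by some [M y]. The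
    relations [v M^2 y = 0] and [v M^3 y = 0] are compared for [M] and [M + N], where [N] kills y
    and is almost an elementary matrix; this isolates [v N M y] and [v M N M y]. *)
Lemma flag_orbit m (V : {vspace 'M[K]_(1 + m)}) I :
  (2 <= m)%N -> two_spec iota V -> 1%:M \in V -> saturated V -> flagged V I ->
  exists k : 'I_(1 + m),
    (forall M (i j : 'I_(1 + m)), M \in V -> (k < i)%N -> (j <= k)%N -> M i j = 0) /\
    (forall v : 'cV[K]_(1 + m), (forall i : 'I_(1 + m), (k < i)%N -> v i 0 = 0) ->
       exists2 M, M \in V & M *m vec0 K m = v).
Proof.
move=> m2 h2 hI sat [fa fb]; set y := vec0 K m.
have yE (M : 'M[K]_(1 + m)) i : (M *m y) i 0 = M i 0.
  rewrite mxE (bigD1 0) //= mxE !eqxx mulr1 big1 ?addr0 // => j j0.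
  by rewrite mxE (negPf j0) mulr0.
have [S hS] : exists S : {vspace 'cV[K]_(1 + m)},
    forall w, w \in S <-> exists2 M, M \in V & M *m y = w.
  by apply: (image_ex V) => a M N; rewrite mulmxDl -scalemxAl.
have orth (v : 'rV[K]_(1 + m)) M : M \in V -> (forall M, M \in V -> v *m M *m y = 0) ->
    v *m M *m M *m y = 0 /\ v *m M *m M *m M *m y = 0.
  move=> hM hv; have vy : v *m y = 0 by rewrite -(hv _ hI) mulmx1.
  by case: (rank1_orthogonal c2 c3 h2 _ hM (sat _ _ (vec0_neq0 K m) hv) vy).
pose hit i := exists2 M, M \in V & M i 0 != 0.
have [k hk kmax] : exists2 k : 'I_(1 + m), hit k & forall i : 'I_(1 + m), hit i -> (i <= k)%N.
  have [d [k hk ek] dmin] : exists2 d, (exists2 k : 'I_(1 + m), hit k & d = (m - k)%N) &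
      forall d', (exists2 k : 'I_(1 + m), hit k & d' = (m - k)%N) -> (d <= d')%N.
    apply: ex_min_nat; exists (m - 0)%N, ord0 => //.
    by exists 1%:M => //; rewrite mxE eqxx oner_neq0.
  exists k => // i hi; have := dmin _ (ex_intro2 _ _ i hi erefl).
  have := ltn_ord i; have := ltn_ord k; rewrite ek; lia.
have kill M (i : 'I_(1 + m)) : M \in V -> (k < i)%N -> M i 0 = 0.
  move=> hM ki; apply/eqP/negPn/negP => h.
  by have := kmax i (ex_intro2 _ _ M hM h); rewrite leqNgt ki.
(* N is the elementary matrix E_{l j} up to its first row *)
have elem (l j : 'I_(1 + m)) : (0 < l)%N -> (l < j)%N -> exists N,
    [/\ N \in V, N *m y = 0 & forall w : 'cV[K]_(1 + m),
      exists c, N *m w = w j 0 *: delta_mx l 0 + c *: y].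
  move=> l0 lj; have [l' el] : exists l' : 'I_m, l = rshift 1 l'.
    by case: (splitP l) l0 => [a ->|a e _]; [rewrite ord1 | exists a; apply: val_inj].
  have [j' ej] : exists j' : 'I_m, j = rshift 1 j'.
    case: (splitP j) lj => [a ->|a e _]; first by rewrite ord1 ltn0.
    by exists a; apply: val_inj.
  have su : strict_upper (delta_mx l' j' : 'M[K]_m).
    move=> a b ab; rewrite mxE; case: eqP => // ea; case: eqP => //= eb.
    by move: lj ab; rewrite el ej ea eb /= ltn_add2l ltnNge => /negPf->.
  have [R hR] := fb 0 _ su; rewrite scale0r add0r in hR.
  exists (block_mx 0 R 0 (delta_mx l' j')); split=> //.
    by rewrite mul_block_vec0 col_mx0.
  move=> w; exists ((R *m dsubmx w) 0 0); rewrite -{1}[w]vsubmxK mul_block_col !mul0mx !add0r.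
  rewrite /y vec0_col; apply/matrixP => a b; rewrite !ord1 {b} !mxE.
  case: splitP => a' ea.
    rewrite !ord1 !mxE eqxx mulr1 (_ : (a == l) = false) ?mulr0 ?add0r //.
    by apply/eqP => e; move: l0; rewrite -e ea ord1.
  rewrite !mxE mulr0 addr0 (bigD1 j') //= big1 ?addr0.
    rewrite !mxE eqxx ej !andbT mulrC; congr (_ * (nat_of_bool _)%:R).
    rewrite el; apply/eqP/eqP => e; first by apply: val_inj; rewrite /= ea e.
    by apply: val_inj; apply: (@addnI 1); rewrite /= -ea e.
  by move=> b bj; rewrite !mxE (negPf bj) andbF mul0r.
(* A form vanishing on Vy vanishes at every index up to [k]: below [k] by the quadratic relation
   with N close to E_{jk}, at [k] by evaluation on an [M y] with nonzero coordinate there. *)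
have ann (v : 'rV[K]_(1 + m)) : (forall M, M \in V -> v *m M *m y = 0) ->
    forall j : 'I_(1 + m), (j <= k)%N -> v 0 j = 0.
  move=> hv; have vy : v *m y = 0 by rewrite -(hv _ hI) mulmx1.
  have v0 : v 0 0 = 0.
    move/matrixP/(_ 0 0): vy; rewrite !mxE (bigD1 0) //= mxE !eqxx mulr1 big1 ?addr0 //.
    by move=> j j0; rewrite mxE (negPf j0) mulr0.
  have low (j : 'I_(1 + m)) : (j < k)%N -> v 0 j = 0.
    move=> jk; have [j0|j0] := posnP j; first by rewrite (_ : j = 0) //; apply: val_inj.
    have [N [hN Ny Nw]] := elem j k j0 jk; case: hk => M hM Mk.
    have [e1 _] := orth v _ (memvD hM hN) hv; have [e2 _] := orth v _ hM hv.
    have [c ec] := Nw (M *m y).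
    have : v *m (N *m (M *m y)) = 0.
      move: e1 e2; rewrite -!mulmxA [(M + N) *m y]mulmxDl Ny addr0.
      rewrite [(M + N) *m _]mulmxDl mulmxDr; by move=> /[swap] ->; rewrite add0r.
    rewrite ec yE mulmxDr -!scalemxAr vy scaler0 addr0 => /matrixP/(_ 0 0).
    rewrite !mxE => /eqP; rewrite mulf_eq0 (negPf Mk) /= => /eqP.
    rewrite (bigD1 j) //= mxE !eqxx mulr1 big1 ?addr0 // => b bj.
    by rewrite mxE (negPf bj) mulr0.
  move=> j; rewrite leq_eqVlt => /orP[/eqP jk|/low//].
  have -> : j = k by apply: val_inj.
  case: hk => M hM Mk; have := hv _ hM; rewrite -mulmxA => /matrixP/(_ 0 0).
  rewrite !mxE (bigD1 k) //= yE big1 ?addr0.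
    by move/eqP; rewrite mulf_eq0 (negPf Mk) orbF => /eqP.
  move=> b bk; rewrite yE; have [bk'|bk'|/val_inj e] := ltngtP b k.
  - by rewrite low ?mul0r.
  - by rewrite kill ?mulr0.
  - by rewrite e eqxx in bk.
have inS (v : 'cV[K]_(1 + m)) : (forall i : 'I_(1 + m), (k < i)%N -> v i 0 = 0) -> v \in S.
  move=> hv; apply/negPn/negP => /separating_form[a ha].
  rewrite (_ : a *m v = 0) ?eqxx //; apply/matrixP => i j; rewrite !ord1 !mxE.
  apply: big1 => b _; have [bk|bk] := leqP b k; last by rewrite hv ?mulr0.
  rewrite ann ?mul0r // => M hM; rewrite -mulmxA; apply: ha; apply/hS; exists M => //.
exists k; split; last by move=> v /inS/hS.
have form (i : 'I_(1 + m)) : (k < i)%N ->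
    forall M, M \in V -> (delta_mx 0 i : 'rV_(1 + m)) *m M *m y = 0.
  move=> ki M hM; rewrite -mulmxA -rowE; apply/matrixP => a b.
  by rewrite !ord1 [LHS]mxE yE kill // mxE.
have [Mk hMk eMk] : exists2 M, M \in V & M *m y = delta_mx k 0.
  by apply/hS/inS => i ki; rewrite mxE; case: eqP ki => // ->; rewrite ltnn.
have Mkk : Mk k 0 != 0 by rewrite -yE eMk mxE !eqxx oner_neq0.
(* A property that passes to differences need only be checked when [M k 0] is nonzero, since [Mk]
   can be added otherwise. *)
have perturb (P : 'M[K]_(1 + m) -> Prop) : (forall M N, P M -> P (M + N) -> P N) ->
    (forall M, M \in V -> M k 0 != 0 -> P M) -> forall M, M \in V -> P M.
  move=> hP h M hM; have [e0|] := eqVneq (M k 0) 0; last exact: h.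
  by apply: (hP Mk); apply: h; rewrite ?memvD // mxE e0 addr0.
(* Columns before [k] need the cubic relation, with N close to E_{lk}; column [k] will follow from
   the quadratic one. *)
have low M (i l : 'I_(1 + m)) : M \in V -> (k < i)%N -> (l < k)%N -> M i l = 0.
  move=> hM ki lk; have [l0|l0] := posnP l.
    by rewrite (_ : l = 0) ?kill //; apply: val_inj.
  move: M hM; apply: perturb => [M N|M hM Mk0].
    by rewrite mxE => ->; rewrite add0r.
  have [N [hN Ny Nw]] := elem l k l0 lk; pose v : 'rV[K]_(1 + m) := delta_mx 0 i.
  have hv (M' : 'M[K]_(1 + m)) : M' \in V -> v *m M' *m y = 0 := form i ki M'.
  have eN (w : 'cV[K]_(1 + m)) : v *m (N *m w) = 0.
    have [c ->] := Nw w; rewrite mulmxDr -!scalemxAr.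
    have -> : v *m y = 0 by rewrite -(hv _ hI) mulmx1.
    rewrite (_ : v *m delta_mx l 0 = 0) ?scaler0 ?addr0 //.
    rewrite mul_delta_mx_0 //; apply: contraTneq ki => ->; rewrite -leqNgt; exact: ltnW.
  have [_ e1] := orth v _ (memvD hM hN) hv; have [_ e2] := orth v _ hM hv.
  have [c ec] := Nw (M *m y).
  have : v *m (M *m (N *m (M *m y))) = 0.
    move: e1 e2; rewrite -!mulmxA [(M + N) *m y]mulmxDl Ny addr0.
    rewrite [(M + N) *m (M *m y)]mulmxDl [(M + N) *m (_ + _)]mulmxDl !mulmxDr.
    by rewrite !eN !addr0 => /[swap] ->; rewrite add0r.
  rewrite ec mulmxDr -!scalemxAr mulmxDr -!scalemxAr [v *m (M *m y)]mulmxA hv // scaler0 addr0.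
  rewrite yE -[v *m _]rowE => /matrixP/(_ 0 0); rewrite [LHS]mxE [RHS]mxE.
  move/eqP; rewrite mulf_eq0 (negPf Mk0) /= => /eqP.
  rewrite [LHS]mxE mxE (bigD1 l) //= mxE !eqxx mulr1 big1 ?addr0 // => b bl.
  by rewrite mxE (negPf bl) mulr0.
move=> M i j hM ki; rewrite leq_eqVlt => /orP[/eqP jk|]; last exact: low.
have -> : j = k by apply: val_inj.
move: M hM; apply: perturb => [M N|M hM Mk0].
  by rewrite mxE => ->; rewrite add0r.
have [e1 _] := orth _ _ hM (form i ki).
move/matrixP/(_ 0 0): e1; rewrite -!mulmxA -rowE mxE [RHS]mxE mxE (bigD1 k) //= big1 ?addr0.
  by rewrite yE => /eqP; rewrite mulf_eq0 (negPf Mk0) orbF => /eqP.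
move=> b bk; rewrite yE; have [bk'|bk'|/val_inj e] := ltngtP b k.
- by rewrite low ?mul0r.
- by rewrite [M b 0]kill ?mulr0.
- by rewrite e eqxx in bk.
Qed.

End Flags.

(** * Characteristic polynomials of small matrices *)

Section SmallDeterminants.
Variable R : comNzRingType.

Definition det2f (a b c d : R) := a * d - b * c.

Definition det3f (a b c d e f g h i : R) :=
  a * det2f e f h i - b * det2f d f g i + c * det2f d e g h.

(** Natural indices make concrete entries compute. An index beyond [n] is read as 0, whence the
    bounds on indices in later lemmas. *)
Definition ent n (A : 'M[R]_n.+1) i j := A (inord i) (inord j).

Definition det_nat n (f : nat -> nat -> R) := \det (\matrix_(i < n, j < n) f i j).

Lemma det_nat_expand n (f : nat -> nat -> R) :
  det_nat n.+1 f =
  \sum_(0 <= j < n.+1) (-1) ^+ j * f 0 j * det_nat n (fun a b => f a.+1 (bump j b)).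
Proof.
rewrite /det_nat (expand_det_row _ ord0) big_mkord; apply: eq_bigr => j _.
rewrite /cofactor mxE add0n mulrCA mulrA; congr (_ * \det _).
by apply/matrixP => a b; rewrite !mxE.
Qed.

Lemma det_ent n (A : 'M[R]_n.+1) : \det A = det_nat n.+1 (ent A).
Proof. by congr (\det _); apply/matrixP => i j; rewrite mxE /ent !inord_val. Qed.

Lemma det_nat1 (f : nat -> nat -> R) : det_nat 1 f = f 0 0.
Proof. by rewrite /det_nat mx11_det mxE. Qed.

Lemma det_nat2 (f : nat -> nat -> R) : det_nat 2 f =
  det2f (f 0 0) (f 0 1) (f 1 0) (f 1 1).
Proof.
rewrite det_nat_expand !big_nat_recr //= big_nil !det_nat1 /bump /= /det2f.
by rewrite add0r expr0 expr1 !mul1r mulN1r mulNr.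
Qed.

Lemma det_nat3 (f : nat -> nat -> R) : det_nat 3 f =
  det3f (f 0 0) (f 0 1) (f 0 2) (f 1 0) (f 1 1) (f 1 2) (f 2 0) (f 2 1) (f 2 2).
Proof.
rewrite det_nat_expand !big_nat_recr //= big_nil !det_nat2 /bump /= /det3f.
ring.
Qed.

Definition minor2 (a : nat -> nat -> R) i j := a i i * a j j - a i j * a j i.

Definition minor3 (a : nat -> nat -> R) i j k :=
  det3f (a i i) (a i j) (a i k) (a j i) (a j j) (a j k) (a k i) (a k j) (a k k).

Definition det4f (a : nat -> nat -> R) :=
    a 0 0 * det3f (a 1 1) (a 1 2) (a 1 3) (a 2 1) (a 2 2) (a 2 3) (a 3 1) (a 3 2) (a 3 3)
  - a 0 1 * det3f (a 1 0) (a 1 2) (a 1 3) (a 2 0) (a 2 2) (a 2 3) (a 3 0) (a 3 2) (a 3 3)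
  + a 0 2 * det3f (a 1 0) (a 1 1) (a 1 3) (a 2 0) (a 2 1) (a 2 3) (a 3 0) (a 3 1) (a 3 3)
  - a 0 3 * det3f (a 1 0) (a 1 1) (a 1 2) (a 2 0) (a 2 1) (a 2 2) (a 3 0) (a 3 1) (a 3 2).

Lemma det_mx2 (A : 'M[R]_2) : let a i j := ent A i j in
  \det A = det2f (a 0 0) (a 0 1) (a 1 0) (a 1 1).
Proof. by rewrite det_ent det_nat2. Qed.

Lemma det_mx3 (A : 'M[R]_3) : let a i j := ent A i j in
  \det A = det3f (a 0 0) (a 0 1) (a 0 2) (a 1 0) (a 1 1) (a 1 2) (a 2 0) (a 2 1) (a 2 2).
Proof. by rewrite det_ent det_nat3. Qed.

Lemma det_mx4 (A : 'M[R]_4) : \det A = det4f (ent A).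
Proof.
rewrite det_ent det_nat_expand !big_nat_recr //= big_nil !det_nat3 /bump /= /det4f.
ring.
Qed.

Lemma det4f_char (X : R) (a : nat -> nat -> R) :
  a 0 0 + a 1 1 + a 2 2 + a 3 3 = 0 ->
  det4f (fun i j => (if i == j then X else 0) - a i j) =
  X ^+ 4 + (minor2 a 0 1 + minor2 a 0 2 + minor2 a 0 3
      + minor2 a 1 2 + minor2 a 1 3 + minor2 a 2 3) * X ^+ 2
    - (minor3 a 0 1 2 + minor3 a 0 1 3 + minor3 a 0 2 3 + minor3 a 1 2 3) * X
    + det4f a.
Proof.
move=> tr0; have e2 : a 3 3 = - (a 0 0 + a 1 1 + a 2 2).
  by apply/eqP; rewrite -addr_eq0 addrC tr0.
rewrite /det4f /minor2 /minor3 /det3f /det2f /= e2; ring.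
Qed.

End SmallDeterminants.

Section CharPoly.
Variable F : fieldType.

Lemma ent_char_poly_mx n (A : 'M[F]_n.+1) i j : (i <= n)%N -> (j <= n)%N ->
  ent (char_poly_mx A) i j = (if i == j then 'X else 0) - (ent A i j)%:P.
Proof.
move=> hi hj; rewrite /ent /char_poly_mx !mxE; congr (_ - _).
by rewrite -val_eqE /= !inordK //; case: eqP.
Qed.

Lemma char_poly3 (A : 'M[F]_3) : let a i j := ent A i j in
  a 0 0 + a 1 1 + a 2 2 = 0 ->
  char_poly A = 'X^3 + (minor2 a 0 1 + minor2 a 0 2 + minor2 a 1 2)%:P * 'X
    - (minor3 a 0 1 2)%:P.
Proof.
move=> a tr0; have e2 : a 2 2 = - (a 0 0 + a 1 1) by apply/eqP; rewrite -addr_eq0 addrC tr0.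
rewrite /char_poly det_mx3 !ent_char_poly_mx //= -!/(a _ _) /minor2 /minor3 /det3f /det2f e2.
by rewrite !(rmorphD, rmorphN, rmorphM) /=; ring.
Qed.

Lemma det3f_polyC (a b c d e f g h i : F) :
  (det3f a b c d e f g h i)%:P = det3f a%:P b%:P c%:P d%:P e%:P f%:P g%:P h%:P i%:P.
Proof. by rewrite /det3f /det2f !(polyCD, polyCN, polyCM). Qed.

Lemma char_poly4 (A : 'M[F]_4) : let a i j := ent A i j in
  a 0 0 + a 1 1 + a 2 2 + a 3 3 = 0 ->
  char_poly A = 'X^4 + (minor2 a 0 1 + minor2 a 0 2 + minor2 a 0 3
      + minor2 a 1 2 + minor2 a 1 3 + minor2 a 2 3)%:P * 'X^2
    + (- (minor3 a 0 1 2 + minor3 a 0 1 3 + minor3 a 0 2 3 + minor3 a 1 2 3))%:P * 'X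
    + (\det A)%:P.
Proof.
move=> a tr0; rewrite /char_poly !det_mx4.
have e : det4f (ent (char_poly_mx A)) =
    det4f (fun i j => (if i == j then 'X else 0) - (a i j)%:P).
  by rewrite /det4f !ent_char_poly_mx.
rewrite e det4f_char -?polyCD ?tr0 // polyCN mulNr.
by rewrite /det4f /minor2 /minor3 !(polyCD, polyCN, polyCM, det3f_polyC).
Qed.

End CharPoly.

(** * Equations satisfied by cubics and quartics with two roots *)

Section Discriminants.
Variable L : closedFieldType.

Lemma cubic_coefs (u1 u0 v2 v1 v0 : L) :
  'X^3 + u1%:P * 'X + u0%:P = 'X^3 + v2%:P * 'X^2 + v1%:P * 'X + v0%:P ->
  [/\ v2 = 0, u1 = v1 & u0 = v0].
Proof.
move=> e; have c i := congr1 (fun p : {poly L} => p`_i) e.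
have := (c 0, c 1, c 2); rewrite !(coefD, coefCM, coefXn, coefX, coefC) /=.
by rewrite !(mulr0, mulr1, addr0, add0r) => -[[-> ->] <-].
Qed.

Lemma quartic_coefs (u2 u1 u0 v3 v2 v1 v0 : L) :
  'X^4 + u2%:P * 'X^2 + u1%:P * 'X + u0%:P =
  'X^4 + v3%:P * 'X^3 + v2%:P * 'X^2 + v1%:P * 'X + v0%:P ->
  [/\ v3 = 0, u2 = v2, u1 = v1 & u0 = v0].
Proof.
move=> e; have c i := congr1 (fun p : {poly L} => p`_i) e.
have := (c 0, c 1, c 2, c 3); rewrite !(coefD, coefCM, coefXn, coefX, coefC) /=.
by rewrite !(mulr0, mulr1, addr0, add0r) => -[[[-> ->] ->] <-].
Qed.

Lemma monic_two_roots (p : {poly L}) n : p \is monic -> size p = n.+1 ->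
  at_most_two (root p) ->
  exists a b i j, (i + j)%N = n /\ p = ('X - a%:P) ^+ i * ('X - b%:P) ^+ j.
Proof.
move=> /monicP lp sp h2; have [rs ers] := closed_field_poly_normal p.
rewrite lp scale1r in ers.
have : at_most_two (fun r => r \in rs).
  have rr r : r \in rs -> root p r by rewrite ers root_prod_XsubC.
  by move=> a b c ha hb hc; apply: h2; apply: rr.
case/at_most_two_mem => a [b /prod_two_roots[i [j [sij e]]]].
exists a, b, i, j; split; last by rewrite ers.
by move: sp; rewrite ers size_prod_XsubC sij => -[].
Qed.

Lemma cubic_disc (p q : L) : let P := 'X^3 + p%:P * 'X - q%:P in
  P \is monic -> size P = 4 -> at_most_two (root P) ->
  4%:R * p ^+ 3 + 27%:R * q ^+ 2 = 0.
Proof.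
move=> P mP sP /(monic_two_roots mP sP)[a [b [i [j [ij e]]]]].
suff main c d : P = ('X - c%:P) ^+ 2 * ('X - d%:P) -> 4%:R * p ^+ 3 + 27%:R * q ^+ 2 = 0.
  case: i ij e => [|[|[|[|]]]] //= ij e.
  - have ej : j = 3 by lia.
    by rewrite ej in e; apply: (main b b); rewrite e; ring.
  - have ej : j = 2 by lia.
    by rewrite ej in e; apply: (main b a); rewrite e; ring.
  - have ej : j = 1 by lia.
    by rewrite ej in e; apply: (main a b); rewrite e; ring.
  - have ej : j = 0 by lia.
    by rewrite ej in e; apply: (main a a); rewrite e; ring.
move=> {}e; have [] := @cubic_coefs p (- q) (- (c + c + d)) (c * c + 2%:R * c * d) (- (c * c * d)).
  rewrite rmorphN /= -/P e !(rmorphD, rmorphN, rmorphM, rmorph_nat) /=; ring.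
move/eqP; rewrite oppr_eq0 addrC addr_eq0 => /eqP-> ->.
move/eqP; rewrite eqr_opp => /eqP->; ring.
Qed.

(** One isobaric equation of weight 6 covers both root patterns, 3 + 1 and 2 + 2; with root sum zero
    they read d = -3c and d = -c. *)
Lemma quartic_disc (p q r : L) : 2%:R != 0 :> L ->
  let P := 'X^4 + p%:P * 'X^2 + (- q)%:P * 'X + r%:P in
  P \is monic -> size P = 5 -> at_most_two (root P) ->
  2%:R * p ^+ 3 - 8%:R * p * r + 9%:R * q ^+ 2 = 0.
Proof.
move=> n2 P mP sP /(monic_two_roots mP sP)[a [b [i [j [ij e]]]]].
have m31 c d : P = ('X - c%:P) ^+ 3 * ('X - d%:P) -> 2%:R * p ^+ 3 - 8%:R * p * r + 9%:R * q ^+ 2 = 0.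
  move=> {}e; have [] := @quartic_coefs p (- q) r (- (c + c + c + d)) (3%:R * c * c + 3%:R * c * d)
    (- (c * c * c + 3%:R * c * c * d)) (c * c * c * d).
    rewrite -/P e !(rmorphD, rmorphN, rmorphM, rmorph_nat) /=; ring.
  move/eqP; rewrite oppr_eq0 addrC addr_eq0 => /eqP-> ->.
  move/eqP; rewrite eqr_opp => /eqP-> ->; ring.
have m22 c d : P = ('X - c%:P) ^+ 2 * ('X - d%:P) ^+ 2 -> 2%:R * p ^+ 3 - 8%:R * p * r + 9%:R * q ^+ 2 = 0.
  move=> {}e; have [] := @quartic_coefs p (- q) r (- (2%:R * (c + d))) (c * c + d * d + 4%:R * c * d)
    (- (2%:R * c * d * (c + d))) (c * c * d * d).
    rewrite -/P e !(rmorphD, rmorphN, rmorphM, rmorph_nat) /=; ring.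
  move/eqP; rewrite oppr_eq0 mulf_eq0 (negPf n2) /= addrC addr_eq0 => /eqP-> ->.
  move/eqP; rewrite eqr_opp => /eqP-> ->; ring.
case: i ij e => [|[|[|[|[|]]]]] //= ij e.
- have ej : j = 4 by lia.
  by rewrite ej in e; apply: (m31 b b); rewrite e; ring.
- have ej : j = 3 by lia.
  by rewrite ej in e; apply: (m31 b a); rewrite e; ring.
- have ej : j = 2 by lia.
  by rewrite ej in e; apply: (m22 a b); rewrite e; ring.
- have ej : j = 1 by lia.
  by rewrite ej in e; apply: (m31 a b); rewrite e; ring.
- have ej : j = 0 by lia.
  by rewrite ej in e; apply: (m31 a a); rewrite e; ring.
Qed.

End Discriminants.

(** * Pencils directed by a strictly triangular matrix *)

Section Pencils.
Variables (K : fieldType) (L : closedFieldType) (iota : {rmorphism K -> L}).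
Hypotheses (c2 : 2%:R != 0 :> K) (c3 : 3%:R != 0 :> K).

Lemma ent_map n (A : 'M[K]_n.+1) i j : ent (map_mx iota A) i j = iota (ent A i j).
Proof. by rewrite /ent mxE. Qed.

Lemma iota_det3f (a b c d e f g h i : K) : iota (det3f a b c d e f g h i) =
  det3f (iota a) (iota b) (iota c) (iota d) (iota e) (iota f) (iota g) (iota h) (iota i).
Proof. by rewrite /det3f /det2f !(rmorphD, rmorphN, rmorphM). Qed.

Lemma two_spec_disc3 (A : 'M[K]_3) : let a := ent A in
  at_most_two_eigenvalues iota A -> a 0 0 + a 1 1 + a 2 2 = 0 ->
  4%:R * (minor2 a 0 1 + minor2 a 0 2 + minor2 a 1 2) ^+ 3
    + 27%:R * (minor3 a 0 1 2) ^+ 2 = 0.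
Proof.
move=> a h2 tr0; set p := minor2 _ _ _ + _ + _; set q := minor3 _ _ _ _.
have e : char_poly (map_mx iota A) = 'X^3 + (iota p)%:P * 'X - (iota q)%:P.
  rewrite char_poly3; last by rewrite !ent_map -!rmorphD tr0 rmorph0.
  rewrite /p /q /minor2 /minor3 !ent_map iota_det3f.
  by rewrite !(rmorphD, rmorphN, rmorphM).
have := @cubic_disc L (iota p) (iota q); cbv zeta; rewrite -e char_poly_monic size_char_poly.
move=> /(_ isT erefl); have H : at_most_two (root (char_poly (map_mx iota A))).
  by move=> x y z; rewrite -!eigenvalue_root_char; apply: h2.
move=> /(_ H) e1; apply: (fmorph_inj iota).
rewrite rmorph0 -[RHS]e1 rmorphD.
by rewrite !(rmorphM _ (_%:R)) !(rmorphXn iota) !rmorph_nat.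
Qed.

Lemma iota_quartic (p q r : K) :
  2%:R * iota p ^+ 3 - 8%:R * iota p * iota r + 9%:R * iota q ^+ 2 = 0 ->
  2%:R * p ^+ 3 - 8%:R * p * r + 9%:R * q ^+ 2 = 0.
Proof.
rewrite -!(rmorph_nat iota) -!rmorphXn -!rmorphM -rmorphB -rmorphD => /eqP.
by rewrite fmorph_eq0 => /eqP.
Qed.

Lemma two_spec_disc4 (A : 'M[K]_4) : let a := ent A in
  at_most_two_eigenvalues iota A -> a 0 0 + a 1 1 + a 2 2 + a 3 3 = 0 ->
  let p := minor2 a 0 1 + minor2 a 0 2 + minor2 a 0 3
      + minor2 a 1 2 + minor2 a 1 3 + minor2 a 2 3 in
  2%:R * p ^+ 3 - 8%:R * p * det4f a
    + 9%:R * (minor3 a 0 1 2 + minor3 a 0 1 3 + minor3 a 0 2 3 + minor3 a 1 2 3) ^+ 2 = 0.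
Proof.
move=> a h2 tr0 p; set q := minor3 _ _ _ _ + _ + _ + _.
have e : char_poly (map_mx iota A) =
    'X^4 + (iota p)%:P * 'X^2 + (- iota q)%:P * 'X + (iota (det4f a))%:P.
  rewrite char_poly4; last by rewrite !ent_map -!rmorphD tr0 rmorph0.
  rewrite det_map_mx det_mx4; congr (_ + _%:P * _ + _%:P * _ + _).
    by rewrite /p /minor2 !ent_map !(rmorphD, rmorphN, rmorphM).
  congr (- _); rewrite /q /minor3 !ent_map /det3f /det2f.
  by rewrite !(rmorphD, rmorphN, rmorphM).
have n2 : 2%:R != 0 :> L by rewrite -(rmorph_nat iota) fmorph_eq0.
have := @quartic_disc L (iota p) (iota q) (iota (det4f a)) n2; cbv zeta.
rewrite -e char_poly_monic size_char_poly.
move=> /(_ isT erefl); have H : at_most_two (root (char_poly (map_mx iota A))).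
  by move=> x y z; rewrite -!eigenvalue_root_char; apply: h2.
move=> /(_ H) e1; exact: iota_quartic e1.
Qed.

Lemma n24 : 24%:R != 0 :> K.
Proof. by rewrite (natrM _ 8 3) (natrM _ 4 2) (natrM _ 2 2) !mulf_neq0. Qed.

(* Fourth finite difference of a quartic in t. *)
Lemma top_coef3 (a0 a1 b0 b1 b2 : K) :
  (forall t, 4%:R * (a0 + t * a1) ^+ 3 + 27%:R * (b0 + t * b1 + t ^+ 2 * b2) ^+ 2 = 0) ->
  b2 = 0.
Proof.
move=> h; have e : 24%:R * (27%:R * b2 ^+ 2) = 0.
  pose f t := 4%:R * (a0 + t * a1) ^+ 3 + 27%:R * (b0 + t * b1 + t ^+ 2 * b2) ^+ 2.
  transitivity (f 2%:R - 4%:R * f 1 + 6%:R * f 0 - 4%:R * f (-1) + f (-2%:R)).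
    by rewrite /f; ring.
  by rewrite /f !h; ring.
apply/eqP; move/eqP: e; rewrite !mulf_eq0 (negPf n24) /=.
by rewrite (natrM _ 9 3) (natrM _ 3 3) !mulf_eq0 (negPf c3) /= orbb.
Qed.

(** The coefficient of t^4 on the left is 9 b2^2 - 8 a1 g3; the values at -2, ..., 2 combine to 24
    times it. *)
Lemma top_coef4 (a0 a1 b0 b1 b2 g0 g1 g2 g3 : K) :
  (forall t, 2%:R * (a0 + t * a1) ^+ 3
    - 8%:R * (a0 + t * a1) * (g0 + t * g1 + t ^+ 2 * g2 + t ^+ 3 * g3)
    + 9%:R * (b0 + t * b1 + t ^+ 2 * b2) ^+ 2 = 0) ->
  9%:R * b2 ^+ 2 = 8%:R * a1 * g3.
Proof.
move=> h; apply: (mulfI n24); apply/eqP; rewrite -subr_eq0; apply/eqP.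
pose f t := 2%:R * (a0 + t * a1) ^+ 3
    - 8%:R * (a0 + t * a1) * (g0 + t * g1 + t ^+ 2 * g2 + t ^+ 3 * g3)
    + 9%:R * (b0 + t * b1 + t ^+ 2 * b2) ^+ 2.
transitivity (f 2%:R - 4%:R * f 1 + 6%:R * f 0 - 4%:R * f (-1) + f (-2%:R)).
  by rewrite /f; ring.
by rewrite /f !h; ring.
Qed.

Lemma ent_strict n (N : 'M[K]_n.+1) i j : strict_upper N -> (i <= n)%N -> (j <= i)%N ->
  ent N i j = 0.
Proof. by move=> hN hi ji; rewrite /ent hN // !inordK // ltnS (leq_trans ji). Qed.

Lemma entD n (M N : 'M[K]_n.+1) t i j : ent (M + t *: N) i j = ent M i j + t * ent N i j.
Proof. by rewrite /ent !mxE. Qed.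

(** Along M + tN the sum of the principal 2-minors is affine in [t], and the determinant is
    quadratic with the stated product as top coefficient. The discriminant equation is thus quartic
    in [t]. *)
Lemma strict_pencil3 (M N : 'M[K]_3) : strict_upper N ->
  (forall t, at_most_two_eigenvalues iota (M + t *: N)) ->
  ent M 0 0 + ent M 1 1 + ent M 2 2 = 0 ->
  ent N 0 1 * ent N 1 2 * ent M 2 0 = 0.
Proof.
move=> hN h2 tr0.
have hs i j : (i <= 2)%N -> (j <= i)%N -> ent N i j = 0 by apply: ent_strict.
set m := ent M in tr0 *; set n := ent N in hs *.
have hz := (hs 0 0 isT isT, hs 1 0 isT isT, hs 1 1 isT isT, hs 2 0 isT isT, hs 2 1 isT isT, hs 2 2 isT isT).
apply: (@top_coef3 (minor2 m 0 1 + minor2 m 0 2 + minor2 m 1 2)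
   (- (n 0 1 * m 1 0 + n 0 2 * m 2 0 + n 1 2 * m 2 1))
   (minor3 m 0 1 2)
   (* The linear coefficient of the determinant, from its value at t = 1. *)
   (minor3 (fun i j => m i j + n i j) 0 1 2 - minor3 m 0 1 2 - n 0 1 * n 1 2 * m 2 0)).
move=> t; have := @two_spec_disc3 (M + t *: N) (h2 t); cbv zeta.
rewrite /minor2 /minor3 !entD -/m -/n !hz !mulr0 !addr0 => /(_ tr0) => e.
rewrite -[RHS]e; congr (_ * _ ^+ 3 + _ * _ ^+ 2); first by ring.
rewrite /det3f /det2f; ring.
Qed.

(** Coefficient of t^4 again: the left side comes from the square of the 3-minors, the right side
    from the 2-minors times the determinant. *)
Lemma strict_pencil4 (M N : 'M[K]_4) : strict_upper N ->
  (forall t, at_most_two_eigenvalues iota (M + t *: N)) ->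
  let m := ent M in let n := ent N in
  m 0 0 + m 1 1 + m 2 2 + m 3 3 = 0 ->
  9%:R * (n 0 1 * n 1 2 * m 2 0 + (n 0 1 * n 1 3 + n 0 2 * n 2 3) * m 3 0
    + n 1 2 * n 2 3 * m 3 1) ^+ 2 =
  8%:R * (n 0 1 * m 1 0 + n 0 2 * m 2 0 + n 0 3 * m 3 0 + n 1 2 * m 2 1
    + n 1 3 * m 3 1 + n 2 3 * m 3 2) * (n 0 1 * n 1 2 * n 2 3 * m 3 0).
Proof.
move=> hN h2 m n tr0.
have hs i j : (i <= 3)%N -> (j <= i)%N -> n i j = 0 by apply: ent_strict.
have hz := (hs 0 0 isT isT, hs 1 0 isT isT, hs 1 1 isT isT, hs 2 0 isT isT, hs 2 1 isT isT, hs 2 2 isT isT, hs 3 0 isT isT, hs 3 1 isT isT, hs 3 2 isT isT, hs 3 3 isT isT).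
pose p (a : nat -> nat -> K) := minor2 a 0 1 + minor2 a 0 2 + minor2 a 0 3
      + minor2 a 1 2 + minor2 a 1 3 + minor2 a 2 3.
pose q (a : nat -> nat -> K) :=
  minor3 a 0 1 2 + minor3 a 0 1 3 + minor3 a 0 2 3 + minor3 a 1 2 3.
pose s1 := n 0 1 * m 1 0 + n 0 2 * m 2 0 + n 0 3 * m 3 0 + n 1 2 * m 2 1
    + n 1 3 * m 3 1 + n 2 3 * m 3 2.
pose s2 := n 0 1 * n 1 2 * m 2 0 + (n 0 1 * n 1 3 + n 0 2 * n 2 3) * m 3 0
    + n 1 2 * n 2 3 * m 3 1.
pose s3 := n 0 1 * n 1 2 * n 2 3 * m 3 0.
pose mn i j := m i j + n i j; pose mn' i j := m i j - n i j.
(* The cubic t -> det (M + tN), interpolated from t = 0, 1, -1 and its top coefficient [- s3]. *)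
pose g0 := det4f m; pose g2 := (det4f mn + det4f mn') / 2%:R - g0.
pose g1 := det4f mn - g0 - g2 + s3.
rewrite -/s1 -/s2 -/s3; suff : 9%:R * s2 ^+ 2 = 8%:R * - s1 * - s3.
  by move=> ->; ring.
apply: (@top_coef4 (p m) (- s1) (q m) (q mn - q m - s2) s2 g0 g1 g2 (- s3)) => t.
have := @two_spec_disc4 (M + t *: N) (h2 t); cbv zeta.
have tr1 : ent (M + t *: N) 0 0 + ent (M + t *: N) 1 1 + ent (M + t *: N) 2 2 +
    ent (M + t *: N) 3 3 = 0 by rewrite !entD -/m -/n !hz !mulr0 !addr0.
move=> /(_ tr1) /=; rewrite -/(p _) -/(q _).
have -> : p (ent (M + t *: N)) = p m + t * - s1.
  by rewrite /p /minor2 !entD -/m -/n !hz /s1; ring.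
have -> : q (ent (M + t *: N)) = q m + t * (q mn - q m - s2) + t ^+ 2 * s2.
  by rewrite /q /minor3 /mn !entD -/m -/n !hz /s2 /det3f /det2f; ring.
have -> // : det4f (ent (M + t *: N)) = g0 + t * g1 + t ^+ 2 * g2 + t ^+ 3 * - s3.
rewrite /g1 /g2 /g0 /det4f /mn /mn' !entD -/m -/n !hz /s3 /det3f /det2f.
by field.
Qed.

End Pencils.

(** * Transitive spaces *)

Section Transitive.
Variables (K : fieldType) (L : closedFieldType) (iota : {rmorphism K -> L}).
Hypotheses (c2 : 2%:R != 0 :> K) (c3 : 3%:R != 0 :> K).

Definition transitive_vs n (V : {vspace 'M[K]_n}) :=
  forall z : 'cV[K]_n, z != 0 -> forall v, exists2 M, M \in V & M *m z = v.

Lemma transitive_conj n P (V : {vspace 'M[K]_n}) : P \in unitmx ->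
  transitive_vs V -> transitive_vs (conj_vs P V).
Proof.
move=> hP hV z z0 v.
have z1 : invmx P *m z != 0.
  by apply: contraNneq z0 => e; rewrite -[z](mulKVmx hP) e mulmx0.
have [M hM e] := hV _ z1 (invmx P *m v).
exists (conj_mx P M); first exact: memv_conj.
by rewrite /conj_mx -!mulmxA e mulKVmx.
Qed.

Lemma rV_eq0 n (v : 'rV[K]_n) : (forall w : 'cV[K]_n, v *m w = 0) -> v = 0.
Proof.
move=> h; apply/rowP => j; have := h (delta_mx j 0).
by rewrite -colE => /colP/(_ 0); rewrite !mxE.
Qed.

(** A form [a] vanishing on the orbit of z under the transposes gives z^T M a^T = 0 for all [M] in
    [V]; as the vectors M a^T fill the space, z would be zero. *)
Lemma transitive_tr n (V : {vspace 'M[K]_n}) :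
  transitive_vs V -> transitive_vs (tr_vs V).
Proof.
move=> hV z z0 v.
have [S hS] : exists S : {vspace 'cV[K]_n},
    forall w, w \in S <-> exists2 M, M \in tr_vs V & M *m z = w.
  by apply: (image_ex (tr_vs V)) => a M N; rewrite mulmxDl -scalemxAl.
suff : v \in S by move/hS.
apply/negPn/negP => /separating_form[a ha av].
have a0 : a^T != 0 by apply: contraNneq av => /(congr1 trmx); rewrite trmxK trmx0 => ->; rewrite mul0mx.
case/negP: z0; apply/eqP; rewrite -[z]trmxK (_ : z^T = 0) ?trmx0 //.
apply: rV_eq0 => w; have [M hM <-] := hV _ a0 w.
apply: trmx_inj; rewrite !trmx_mul !trmxK trmx0 -mulmxA.
by apply: ha; apply/hS; exists M^T; rewrite ?mem_tr_vs ?trmxK.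
Qed.

(** By orthogonality [v] vanishes on Vy, which is the whole space. *)
Lemma transitive_no_rank1 n (V : {vspace 'M[K]_n}) (y : 'cV[K]_n) (v : 'rV[K]_n) :
  two_spec iota V -> (3 <= n)%N -> transitive_vs V ->
  y *m v \in V -> v *m y = 0 -> y != 0 -> v = 0.
Proof.
move=> h2 n3 hV hyv vy y0; apply: rV_eq0 => w.
have [M hM <-] := hV _ y0 w; rewrite mulmxA.
have [e _ _] := rank1_orthogonal c2 c3 h2 n3 hM hyv vy.
exact: e.
Qed.

Lemma strict_upper_vec0 m (M : 'M[K]_(1 + m)) : strict_upper M -> M *m vec0 K m = 0.
Proof.
move=> hM; apply/matrixP => i j; rewrite !mxE big1 // => k _.
have [->|k0] := eqVneq k 0; first by rewrite hM ?mul0r.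
by rewrite mxE (negPf k0) mulr0.
Qed.

Lemma strict_upper_dr m (M : 'M[K]_(1 + m)) : strict_upper M -> strict_upper (drsubmx M).
Proof. by move=> hM i j ij; rewrite !mxE hM // leq_add2l. Qed.

Lemma strict_upper_nil n (M : 'M[K]_n) : strict_upper M -> nil_mx iota M.
Proof.
move=> hM a ha; have [i ->] : exists i, a = iota (M i i).
  by apply: spec_tri ha => i j ij; rewrite hM // ltnW.
by rewrite hM ?rmorph0.
Qed.

Lemma DI_diag n (I : {set 'I_n}) i j : DI K I i j = ((i == j) && (i \in I))%:R.
Proof. by rewrite /DI !mxE; case: eqP => // ->; case: (_ \in _). Qed.

(** The diagonal entries of the triangular quotient action are eigenvalues, so nilpotency leaves no
    multiple of D_I. *)
Lemma flagged_nil m (V : {vspace 'M[K]_(1 + m)}) I M : flagged V I -> M \in V ->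
  M *m vec0 K m = 0 -> nil_mx iota M -> strict_upper M.
Proof.
move=> [fa _] hM M0 nM; have [b [N [hN e]]] := fa M hM M0.
rewrite (mul_vec0_eq0 M0); apply: strict_upper_block => i j ij.
rewrite e !mxE hN // addr0; have := DI_diag I i j; rewrite /DI !mxE => ->.
have [eij|_] := eqP; last by rewrite mulr0.
have tri (i' j' : 'I_m) : (j' < i')%N -> (b *: DI K I + N) i' j' = 0.
  move=> ji; rewrite !mxE hN; last exact: ltnW.
  by case: eqP ji => [->|_ _]; rewrite ?ltnn // mulr0n mulr0 addr0.
have : iota ((b *: DI K I + N) i i) = 0.
  apply: nM; rewrite (mul_vec0_eq0 M0) spec_ublock e spec_diag ?orbT //.
move/eqP; rewrite fmorph_eq0 mxE hN // addr0 mxE => /eqP.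
by rewrite DI_diag eqxx /=.
Qed.

(** A strictly triangular element of [V] with zero lower right block would be of rank one and square
    zero, which transitivity excludes. So the first row is a function of that block, and every
    strictly triangular block occurs. *)
Lemma strict_space m (V : {vspace 'M[K]_(1 + m)}) I : (2 <= m)%N ->
  two_spec iota V -> transitive_vs V -> flagged V I ->
  (forall M, M \in V -> strict_upper M -> drsubmx M = 0 -> M = 0) /\
  exists U : {vspace 'M[K]_(1 + m)},
    (forall M, M \in U <-> M \in V /\ strict_upper M) /\ \dim U = 'C(m, 2).
Proof.
move=> m2 h2 tV [fa fb].
have inj M : M \in V -> strict_upper M -> drsubmx M = 0 -> M = 0.
  move=> hM sM d0; have eM := mul_vec0_eq0 (strict_upper_vec0 sM).
  rewrite d0 in eM; rewrite eM -vec0_mul_row.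
  rewrite (_ : row_mx 0 _ = 0) ?mulmx0 //.
  apply: (@transitive_no_rank1 _ _ (vec0 K m) _ h2 _ tV); rewrite ?vec0_neq0 //.
    by rewrite vec0_mul_row -eM.
  by rewrite vec0_col mul_row_col mul0mx mulmx0 addr0.
split=> //.
have [U hU] : exists U : {vspace 'M[K]_(1 + m)},
    forall M, M \in U <-> M \in V /\ strict_upper M.
  apply: subspace_ex; first by split; [exact: mem0v | exact: strict_upper0].
  move=> a M N [h1 h3] [h4 h5]; split; first by rewrite memvD // memvZ.
  exact: strict_upper_lin.
exists U; split=> //; have [W [hW dW]] := strict_upper_ex K m.
pose g (M : 'M[K]_(1 + m)) := drsubmx M.
have lg : linear g by move=> a M N; apply/matrixP => i j; rewrite !mxE.
have [G hG] := image_ex U lg; have [Z hZ] := kernel_ex U lg.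
rewrite (dim_image_kernel lg hZ hG).
have -> : Z = 0%VS.
  apply/vspaceP => M; rewrite memv0; apply/idP/eqP => [|->]; last exact: mem0v.
  by case/hZ => /hU[h1 h3] h4; apply: inj.
rewrite dimv0 add0n -dW; congr (\dim _); apply/vspaceP => N; apply/idP/idP.
  by case/hG => M /hU[_ sM] <-; apply/hW; apply: strict_upper_dr.
move/hW => sN; have [R hR] := fb 0 N sN; rewrite scale0r add0r in hR.
apply/hG; exists (block_mx 0 R 0 N : 'M_(1 + m)); last by rewrite /g block_mxKdr.
by apply/hU; split=> //; apply: strict_upper_block.
Qed.

(** A form of [strict_space] free of coordinates: [U] depends only on [V] and z, so that different z
    can be compared. The row [c] is the last coordinate form of the flag. *)
Lemma nilpotent_annihilator e m (V : {vspace 'M[K]_(1 + m)}) :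
  (2 <= m)%N -> spectral iota e V -> bound iota e m ->
  ('C(1 + m, 2) + 1 + e <= \dim V)%N -> transitive_vs V ->
  forall z : 'cV[K]_(1 + m), z != 0 -> exists U : {vspace 'M[K]_(1 + m)},
    [/\ forall M, M \in U <-> [/\ M \in V, M *m z = 0 & nil_mx iota M],
        \dim U = 'C(m, 2)
      & exists2 c : 'rV[K]_(1 + m), c != 0 & forall M, M \in U -> c *m M = 0].
Proof.
move=> m2 hs hB hd tV z z0.
have [_ _ /(_ z z0)[P [I [hP Pz _ hf]]]] := spectral_flag c2 c3 m2 hs hB hd.
have [_ [U' [hU' dU']]] := strict_space m2 (let: And3 _ h _ := spectral_conj hP hs in h)
  (transitive_conj hP tV) hf.
have hiP : invmx P \in unitmx by rewrite unitmx_inv.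
exists (conj_vs (invmx P) U'); split.
- move=> M; rewrite mem_conj_vs // invmxK; split.
    case/hU'; rewrite mem_conj_vs // conj_mxK // => hM sM; split=> //.
      have := strict_upper_vec0 sM; rewrite -Pz /conj_mx !mulmxA mulmxKV // => e1.
      by rewrite -[_ *m z](mulKmx hP) [P *m _]mulmxA e1 mulmx0.
    by move=> a ha; apply: (strict_upper_nil sM); rewrite spec_conj.
  case=> hM Mz nM; apply/hU'; split; first exact: memv_conj.
  apply: (flagged_nil hf); first exact: memv_conj.
    by rewrite -Pz /conj_mx !mulmxA mulmxKV // -mulmxA Mz mulmx0.
  by move=> a; rewrite spec_conj //; apply: nM.
- by rewrite dim_conj_vs.
pose d : 'rV[K]_(1 + m) := delta_mx 0 ord_max.
exists (d *m P).
  apply: contraTneq (isT : true) => /(congr1 (mulmx^~ (invmx P))).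
  rewrite mulmxK // mul0mx => /matrixP/(_ 0 ord_max)/eqP.
  by rewrite !mxE !eqxx oner_eq0.
move=> M; rewrite mem_conj_vs // invmxK => /hU'[_ sM].
have : d *m conj_mx P M = 0.
  rewrite -rowE; apply/rowP => j; rewrite [LHS]mxE [RHS]mxE.
  by apply: sM; rewrite -ltnS ltn_ord.
rewrite /conj_mx !mulmxA => e0; by rewrite -[LHS](mulmxKV hP) e0 mul0mx.
Qed.

Lemma inordK' m i : (i <= m)%N -> (inord i : 'I_(1 + m)) = i :> nat.
Proof. by move=> im; apply: (@inordK m). Qed.

Lemma ent_dr m (M : 'M[K]_(1 + m)) i j (i0 : (0 < i)%N) (hi : (i.-1 < m)%N)
    (j0 : (0 < j)%N) (hj : (j.-1 < m)%N) :
  ent M i j = drsubmx M (Ordinal hi) (Ordinal hj).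
Proof.
rewrite /ent !mxE; congr (M _ _); apply: val_inj; rewrite /= inordK' //; lia.
Qed.

(* A transitive space of maximal dimension does not exist: compare the strictly
   triangular part of V at e_0 with the nilpotents killing e_1 and e_2. *)
Section Coordinates.
Variables (m : nat) (V : {vspace 'M[K]_(1 + m)}) (I : {set 'I_m}).
Hypotheses (m2 : (2 <= m)%N) (hI : 1%:M \in V) (h2 : two_spec iota V).
Hypotheses (tV : transitive_vs V) (hf : flagged V I).
Hypothesis nilC : forall z : 'cV[K]_(1 + m), z != 0 -> exists U : {vspace 'M[K]_(1 + m)},
    [/\ forall M, M \in U <-> [/\ M \in V, M *m z = 0 & nil_mx iota M],
        \dim U = 'C(m, 2)
      & exists2 c : 'rV[K]_(1 + m), c != 0 & forall M, M \in U -> c *m M = 0].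
Hypothesis nilR : forall z : 'rV[K]_(1 + m), z != 0 -> exists U : {vspace 'M[K]_(1 + m)},
    (forall M, M \in U <-> [/\ M \in V, z *m M = 0 & nil_mx iota M]) /\
    \dim U = 'C(m, 2).

Lemma strict_dr a b : (0 < a)%N -> (a < b)%N -> (b <= m)%N ->
  exists N, [/\ N \in V, strict_upper N & forall i j, (0 < i)%N -> (i <= m)%N ->
    (0 < j)%N -> (j <= m)%N -> ent N i j = ((i == a) && (j == b))%:R].
Proof.
move=> a0 ab bm; case: hf => _ fb.
pose f i j : K := ((i == a.-1) && (j == b.-1))%:R.
pose D : 'M[K]_m := \matrix_(i < m, j < m) f i j.
have sD : strict_upper D.
  move=> i j ij; rewrite !mxE /f; case: eqP => // ei; case: eqP => // ej.
  by move: ij; rewrite ei ej; lia.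
have [R hR] := fb 0 D sD; rewrite scale0r add0r in hR.
exists (block_mx 0 R 0 D); split=> //; first exact: strict_upper_block.
move=> i j i0 im j0 jm.
have hi : (i.-1 < m)%N by lia.
have hj : (j.-1 < m)%N by lia.
rewrite (ent_dr _ i0 hi j0 hj) block_mxKdr mxE /f /=; congr (nat_of_bool _)%:R.
by apply/idP/idP => /andP[/eqP h3 /eqP h4]; apply/andP; split; apply/eqP; lia.
Qed.

(** A strictly triangular element with zero upper left block lives in its last column, so it is of
    rank one and square zero, hence zero. By dimension the upper left block can be prescribed as
    freely as the lower right one. *)
Lemma strict_ul a b : (a < b)%N -> (b < m)%N ->
  exists N, [/\ N \in V, strict_upper N & forall i j, (i < m)%N -> (j < m)%N ->
    ent N i j = ((i == a) && (j == b))%:R].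
Proof.
move=> ab bm; have [_ [U [hU dU]]] := strict_space m2 h2 tV hf.
have [W [hW dW]] := strict_upper_ex K m.
pose f (M : 'M[K]_(1 + m)) : 'M[K]_m := \matrix_(i < m, j < m) ent M i j.
have lf : linear f by move=> c M N; apply/matrixP => i j; rewrite !mxE /ent !mxE.
pose g i j : K := ((i == a) && (j == b))%:R.
have hD : (\matrix_(i < m, j < m) g i j : 'M_m) \in W.
  apply/hW => i j ij; rewrite !mxE /g; case: eqP => // ei; case: eqP => // ej.
  by move: ij; rewrite ei ej; lia.
have fin M : M \in U -> f M \in W.
  case/hU => _ sM; apply/hW => i j ij; rewrite mxE; apply: ent_strict => //.
  exact: ltnW.
have finj M : M \in U -> f M = 0 -> M = 0.
  case/hU => hM sM e0.
  pose d : 'rV[K]_(1 + m) := delta_mx 0 ord_max; pose u := col ord_max M.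
  have eM : M = u *m d.
    apply/matrixP => i j; rewrite mxE big_ord1 !mxE eqxx /=.
    have [->|jm] := eqVneq j ord_max; first by rewrite mulr1.
    rewrite mulr0; have hj : (j < m)%N.
      by rewrite ltn_neqAle -ltnS ltn_ord andbT; apply: contra jm => /eqP e; apply/eqP/val_inj.
    have [hi|hi] := ltnP i m; last by rewrite sM // (leq_trans (ltnW hj)).
    have := congr1 (fun A : 'M_m => A (Ordinal hi) (Ordinal hj)) e0.
    by rewrite !mxE /ent /= !inord_val.
  apply/eqP/negPn/negP => M0.
  have u0 : u != 0 by apply: contraNneq M0 => e; rewrite eM e mul0mx.
  have du : d *m u = 0.
    rewrite -rowE; apply/matrixP => i j; rewrite [LHS]mxE [LHS]mxE [RHS]mxE.
    by apply: sM; rewrite leqnn.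
  have hud : u *m d \in V by rewrite -eM.
  have := transitive_no_rank1 h2 m2 tV hud du u0.
  by move/matrixP/(_ 0 ord_max)/eqP; rewrite !mxE !eqxx oner_eq0.
have dWU : (\dim W <= \dim U)%N by rewrite dU dW.
have [N /hU[hN sN] eN] := dim_inj_onto lf finj fin dWU hD.
exists N; split=> // i j im jm; have := congr1 (fun A : 'M_m => A (Ordinal im) (Ordinal jm)) eN.
by rewrite !mxE.
Qed.


(** The strictly triangular elements killing e_j are among the nilpotents killing e_j, so they share
    a left annihilator [c]. Both relations are c N = 0 read in the two columns after the first
    nonzero coordinate [i0] of [c]. *)
Lemma strict_column_relation j : (0 < j)%N -> (j < m)%N -> exists i0 (c : nat -> K),
  [/\ (i0 < m)%N, c i0 != 0 & forall N, N \in V -> strict_upper N ->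
    (forall i, (i < j)%N -> ent N i j = 0) ->
    ent N i0 i0.+1 = 0 /\
    ((i0.+2 <= m)%N -> c i0 * ent N i0 i0.+2 + c i0.+1 * ent N i0.+1 i0.+2 = 0)].
Proof.
move=> j0 jm.
pose z : 'cV[K]_(1 + m) := delta_mx (inord j) 0.
have z0 : z != 0.
  by apply: contraTneq (isT : true) => /matrixP/(_ (inord j) 0)/eqP; rewrite !mxE !eqxx oner_eq0.
have [U [hU dU [c c0 cU]]] := nilC z0.
have hUz N : N \in V -> strict_upper N -> (forall i, (i < j)%N -> ent N i j = 0) -> c *m N = 0.
  move=> hN sN e; apply: cU; apply/hU; split=> //; last exact: strict_upper_nil.
  rewrite -colE; apply/matrixP => i i'; rewrite [LHS]mxE [RHS]mxE.
  have [ij|ij] := ltnP i j; first by have := e i ij; rewrite /ent inord_val.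
  by apply: sN; rewrite inordK' // ltnW.
(* If [c] were a multiple of the last coordinate form, the nilpotents annihilated by [c], those
   killing e_j and the strict part of [V] would coincide by dimension; but the strict part contains
   an element moving e_j. *)
have [i1 i1m ci1] : exists2 i : 'I_(1 + m), (i < m)%N & c 0 i != 0.
  apply: NNPP => hn.
  have cd : c = c 0 ord_max *: delta_mx 0 ord_max.
    apply/rowP => i; rewrite !mxE eqxx /=; have [->|im] := eqVneq i ord_max.
      by rewrite mulr1.
    rewrite mulr0; apply/eqP/negPn/negP => h; apply: hn; exists i => //.
    rewrite ltn_neqAle -ltnS ltn_ord andbT; apply: contra im => /eqP e; exact/eqP/val_inj.
  have [U' [hU' dU']] := nilR c0.
  have [_ [U0 [hU0 dU0]]] := strict_space m2 h2 tV hf.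
  have s1 : (U <= U')%VS.
    by apply/subvP => N hN; apply/hU'; case/hU: (hN) => h1 h3 h4; split=> //; apply: cU.
  have s2 : (U0 <= U')%VS.
    apply/subvP => N /hU0[hN sN]; apply/hU'; split=> //; last exact: strict_upper_nil.
    rewrite cd -scalemxAl -rowE; apply/rowP => i; rewrite !mxE sN ?mulr0 //.
    by rewrite -ltnS ltn_ord.
  have /eqP e1 : U == U' by rewrite eqEdim s1 dU dU' leqnn.
  have /eqP e2 : U0 == U' by rewrite eqEdim s2 dU0 dU' leqnn.
  have [N [hN sN eN]] := strict_ul j0 jm.
  have : N \in U by rewrite e1 -e2; apply/hU0.
  case/hU => _ + _; rewrite -colE => /matrixP/(_ (inord 0) 0)/eqP; rewrite !mxE.
  by rewrite -/(ent N 0 j) eN ?(ltnW m2) // ?eqxx ?oner_eq0 //; lia.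
have [i0 [i0m ci0] i0min] : exists2 i, (i < m)%N /\ c 0 (inord i) != 0 &
    forall i', (i' < m)%N /\ c 0 (inord i') != 0 -> (i <= i')%N.
  by apply: ex_min_nat; exists i1; rewrite inord_val.
have cz i : (i < i0)%N -> c 0 (inord i) = 0.
  move=> ii; apply/eqP/negPn/negP => h.
  have /i0min : (i < m)%N /\ c 0 (inord i) != 0 by split=> //; exact: ltn_trans i0m.
  by rewrite leqNgt ii.
exists i0, (fun i => c 0 (inord i)); split=> // N hN sN eN.
have := hUz N hN sN eN => cN.
have col_sum k : (k <= m)%N -> \sum_(i < m.+1) c 0 (inord i) * ent N i k = 0.
  move=> km; move/matrixP/(_ 0 (inord k)): cN; rewrite !mxE => e; rewrite -[RHS]e.
  by apply: eq_bigr => i _; rewrite /ent !inord_val.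
(* Terms before [i0] vanish by minimality, those from [k] on by triangularity. *)
have partial k : (k <= m)%N -> \sum_(i0 <= i < k) c 0 (inord i) * ent N i k = 0.
  move=> km; rewrite -[RHS](col_sum k km).
  pose F i := c 0 (inord i) * ent N i k.
  rewrite -(big_mkord xpredT F).
  have a1 l : (l <= i0)%N -> \sum_(0 <= i < l) F i = 0.
    move=> li; rewrite big_nat big1 // => i /andP[_ ii].
    by rewrite /F cz ?mul0r // (leq_trans ii).
  have a2 l : (k <= l)%N -> \sum_(l <= i < m.+1) F i = 0.
    move=> kl; rewrite big_nat big1 // => i /andP[li im].
    by rewrite /F [ent _ _ _]ent_strict ?mulr0 // (leq_trans kl).
  have im1 : (i0 <= m.+1)%N by rewrite ltnW // ltnS ltnW.
  rewrite [RHS](@big_cat_nat _ _ _ i0) //= a1 // add0r.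
  have [ik|ki] := leqP i0 k; last by rewrite a2 ?(ltnW ki) // big_geq ?(ltnW ki).
  by rewrite [RHS](@big_cat_nat _ _ _ k) //= ?a2 ?addr0 // ltnW.
split.
  have := partial i0.+1 i0m; rewrite big_nat1 => /eqP; rewrite mulf_eq0 (negPf ci0) /=.
  by move/eqP.
move=> i0m2; have := partial i0.+2 i0m2.
by rewrite big_nat_recr ?leqnSn //= big_nat1.
Qed.

Lemma strict_unit_neq (a b i j : nat) : (i, j) != (a, b) -> ((i == a) && (j == b))%:R = 0 :> K.
Proof. by rewrite -pair_eqE /= => /negPf->. Qed.

(** Take j = 1. Elements with one prescribed entry in the upper left block rule out every [i0]
    except m - 1, and the first relation is then the claim. *)
Lemma strict_corner1 N : (3 <= m)%N -> N \in V -> strict_upper N ->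
  ent N 0 1 = 0 -> ent N m.-1 m = 0.
Proof.
move=> m3 hN sN e01.
have m1 : (1 < m)%N by lia.
have [i0 [c [i0m ci0 h]]] := strict_column_relation (isT : (0 < 1)%N) m1.
have [e|i00] := posnP i0.
  have [N0 [hN0 sN0 eN0]] := strict_ul (isT : (0 < 2)%N) m3.
  have [|_] := h N0 hN0 sN0.
    by case=> // _; rewrite eN0 ?strict_unit_neq //; lia.
  rewrite e m2 !eN0; try lia; rewrite /= => /(_ isT).
  by rewrite mulr1 mulr0 addr0 => /eqP; rewrite -e (negPf ci0).
have [lt|ge] := ltnP i0.+1 m.
  have [N0 [hN0 sN0 eN0]] := strict_ul (ltnSn i0) lt.
  have [|] := h N0 hN0 sN0.
    by case=> // _; rewrite eN0 ?strict_unit_neq //; [case: (i0) i00 | lia..].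
  by rewrite eN0 ?eqxx //= => /eqP; rewrite oner_eq0.
have ei : i0 = m.-1 by lia.
have [|+ _] := h N hN sN; first by case.
by rewrite ei prednK //; lia.
Qed.

(** The same with j = 2. Both indices 0 and 1 have to be ruled out separately, which takes one more
    dimension. *)
Lemma strict_corner2 N : (4 <= m)%N -> N \in V -> strict_upper N ->
  ent N 0 2 = 0 -> ent N 1 2 = 0 -> ent N m.-1 m = 0.
Proof.
move=> m4 hN sN e02 e12.
have m3 : (2 < m)%N by lia.
have [i0 [c [i0m ci0 h]]] := strict_column_relation (isT : (0 < 2)%N) m3.
have [e|i00] := posnP i0.
  have [N0 [hN0 sN0 eN0]] := strict_ul (isT : (0 < 1)%N) m2.
  have [|+ _] := h N0 hN0 sN0.
    by case=> [|[|]] // _; rewrite eN0 ?strict_unit_neq //; lia.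
  by rewrite e eN0 //= ?(ltnW m2) // => /eqP; rewrite oner_eq0.
have [e|i01] := eqVneq i0 1.
  have [N0 [hN0 sN0 eN0]] := strict_ul (isT : (1 < 3)%N) m4.
  have [|_] := h N0 hN0 sN0.
    by case=> [|[|]] // _; rewrite eN0 ?strict_unit_neq //; lia.
  rewrite e m3 => /(_ isT); rewrite !eN0 //=.
  by rewrite mulr1 mulr0 addr0 => /eqP; rewrite -e (negPf ci0).
have [lt|ge] := ltnP i0.+1 m.
  have [N0 [hN0 sN0 eN0]] := strict_ul (ltnSn i0) lt.
  have [|] := h N0 hN0 sN0.
    move=> i i2; rewrite eN0 ?strict_unit_neq //; last by lia.
    by rewrite xpair_eqE negb_and; apply/orP; right; lia.
  by rewrite eN0 ?eqxx //= => /eqP; rewrite oner_eq0.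
have ei : i0 = m.-1 by lia.
have [|+ _] := h N hN sN; first by case=> [|[|]].
by rewrite ei prednK //; lia.
Qed.

(** An element with corner entry 1 is corrected by a multiple of one with entry 1 at (0, 1), whose
    corner entry is 0 by the second relation; the result contradicts the first. *)
Lemma transitive_size : (m <= 3)%N.
Proof.
rewrite leqNgt; apply/negP => m4.
have [N0 [hN0 sN0 eN0]] := strict_ul (isT : (0 < 1)%N) m2.
have c0 : ent N0 m.-1 m = 0.
  by apply: strict_corner2 => //; rewrite eN0 ?strict_unit_neq //; lia.
have m1 : (0 < m.-1)%N by lia.
have m1m : (m.-1 < m)%N by lia.
have [N [hN sN eN]] := strict_dr m1 m1m (leqnn m).
have : ent (N + (- ent N 0 1) *: N0) m.-1 m = 0.
  apply: strict_corner1; first by lia.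
  - by rewrite memvD // memvZ.
  - by rewrite addrC; apply: strict_upper_lin.
  - by rewrite entD (eN0 0 1) // ?(ltnW m2) //= mulr1 subrr.
rewrite entD c0 mulr0 addr0 eN ?eqxx //=; try lia.
by move/eqP; rewrite oner_eq0.
Qed.

End Coordinates.

(** A scalar shift makes [M] traceless without changing the entries that occur. *)
Lemma strict_relation3 (V : {vspace 'M[K]_3}) M N : 1%:M \in V -> two_spec iota V ->
  M \in V -> N \in V -> strict_upper N -> ent N 0 1 * ent N 1 2 * ent M 2 0 = 0.
Proof.
move=> hI h2 hM hN sN; pose c := - ((ent M 0 0 + ent M 1 1 + ent M 2 2) / 3%:R).
have eM i j : (i <= 2)%N -> (j <= 2)%N ->
    ent (M + c *: 1%:M) i j = ent M i j + (if i == j then c else 0).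
  move=> hi hj; rewrite entD /ent [1%:M _ _]mxE -val_eqE /= !inordK //.
  by case: eqP; rewrite ?mulr1 ?mulr0.
rewrite -[ent M 2 0]addr0 -(eM 2 0)%N //; apply: (strict_pencil3 c2 c3 sN (iota := iota)).
  by move=> t; apply: h2; rewrite !memvD // memvZ.
by rewrite !eM //= /c; field.
Qed.

Lemma strict_relation4 (V : {vspace 'M[K]_4}) M N : 1%:M \in V -> two_spec iota V ->
  M \in V -> N \in V -> strict_upper N -> let m := ent M in let n := ent N in
  9%:R * (n 0 1 * n 1 2 * m 2 0 + (n 0 1 * n 1 3 + n 0 2 * n 2 3) * m 3 0
    + n 1 2 * n 2 3 * m 3 1) ^+ 2 =
  8%:R * (n 0 1 * m 1 0 + n 0 2 * m 2 0 + n 0 3 * m 3 0 + n 1 2 * m 2 1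
    + n 1 3 * m 3 1 + n 2 3 * m 3 2) * (n 0 1 * n 1 2 * n 2 3 * m 3 0).
Proof.
move=> hI h2 hM hN sN m n; have n4 : 4%:R != 0 :> K by rewrite (natrM _ 2 2) mulf_neq0.
pose c := - ((m 0 0 + m 1 1 + m 2 2 + m 3 3) / 4%:R).
have eM i j : (i <= 3)%N -> (j <= 3)%N ->
    ent (M + c *: 1%:M) i j = m i j + (if i == j then c else 0).
  move=> hi hj; rewrite entD /m /ent [1%:M _ _]mxE -val_eqE /= !inordK //.
  by case: eqP; rewrite ?mulr1 ?mulr0.
have := @strict_pencil4 _ _ iota c2 c3 (M + c *: 1%:M) N sN.
cbv zeta; rewrite !eM //= !addr0 -/n; apply.
  by move=> t; apply: h2; rewrite !memvD // memvZ.
by rewrite /c; field.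
Qed.

(** Transitivity provides [M] with M_20 = 1, so the relation gives N_12 = 0; then [N] has zero
    quotient block and must vanish, although N_01 = 1. *)
Lemma no_transitive3 (V : {vspace 'M[K]_(1 + 2)}) I : 1%:M \in V -> two_spec iota V ->
  transitive_vs V -> flagged V I -> False.
Proof.
move=> hI h2 tV hf.
have [N [hN sN eN]] := strict_ul (isT : (2 <= 2)%N) hI h2 tV hf (isT : (0 < 1)%N) (isT : (1 < 2)%N).
have [inj _] := strict_space (isT : (2 <= 2)%N) h2 tV hf.
have [M hM eM] := tV _ (vec0_neq0 K 2) (delta_mx (inord 2) 0).
have := strict_relation3 hI h2 hM hN sN; rewrite eN //= mul1r.
have -> : ent M 2 0 = 1.
  move/matrixP/(_ (inord 2) 0): eM; rewrite -colE !mxE !eqxx /= => e0; rewrite -[RHS]e0 /ent.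
  by congr (M _ _); apply: val_inj; rewrite /= inordK.
rewrite mulr1 => e12; have : N = 0.
  apply: inj => //; apply/matrixP => i j; rewrite [RHS]mxE.
  have -> : drsubmx N i j = ent N i.+1 j.+1.
    rewrite (@ent_dr 2 N i.+1 j.+1 isT (ltn_ord i) isT (ltn_ord j)).
    by congr (drsubmx N _ _); apply: val_inj.
  case: i j => -[|[|//]] hi [[|[|//]] hj] /=; try exact: (ent_strict sN).
  exact: e12.
by move=> N0; have := eN 0 1 isT isT; rewrite N0 /ent mxE => /esym/eqP; rewrite oner_eq0.
Qed.

(** In size 4 only the first corner relation is available, so the quartic relation is applied to the
    family A + bB + cC. Varying [b] and [c] gives 1 + x = 0 and 1 - x = 0 for x =
    [g * ent M2 3 1]. *)
Lemma no_transitive4 (V : {vspace 'M[K]_(1 + 3)}) I : 1%:M \in V -> two_spec iota V ->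
  transitive_vs V -> flagged V I ->
  (forall N, N \in V -> strict_upper N -> ent N 0 1 = 0 -> ent N 2 3 = 0) -> False.
Proof.
move=> hI h2 tV hf corner.
have m2 : (2 <= 3)%N by [].
have [A [hA sA eA]] := strict_ul m2 hI h2 tV hf (isT : (0 < 1)%N) (isT : (1 < 3)%N).
have [B [hB sB eB]] := strict_ul m2 hI h2 tV hf (isT : (0 < 2)%N) (isT : (2 < 3)%N).
have [C [hC sC eC]] := strict_ul m2 hI h2 tV hf (isT : (1 < 2)%N) (isT : (2 < 3)%N).
have [D [hD sD eD]] := strict_dr m2 hI hf (isT : (0 < 2)%N) (isT : (2 < 3)%N) (isT : (3 <= 3)%N).
have B23 : ent B 2 3 = 0 by apply: corner => //; rewrite eB.
have C23 : ent C 2 3 = 0 by apply: corner => //; rewrite eC.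
set g := ent A 2 3.
have g0 : g != 0.
  apply/negP => /eqP e0.
  have : ent (D + (- ent D 0 1) *: A) 2 3 = 0.
    apply: corner; first by rewrite memvD // memvZ.
    - by rewrite addrC; apply: strict_upper_lin.
    - by rewrite entD eA //= mulr1 subrr.
  by rewrite entD -/g e0 mulr0 addr0 eD //= => /eqP; rewrite oner_eq0.
have ents M : exists2 M', M' \in V & forall i, (i <= 3)%N -> ent M' i 0 = M i.
  have [M' hM' eM'] := tV _ (vec0_neq0 K 3) (\col_i M i).
  exists M' => // i hi; move/matrixP/(_ (inord i) 0): eM'; rewrite -colE !mxE inordK // => e0.
  by rewrite -[RHS]e0 /ent; congr (M' _ _); apply: val_inj; rewrite /= inordK.
pose la := ent A 1 3; pose lb := ent B 1 3; pose lc := ent C 1 3.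
(* the relation for N = A + b B + c C *)
have rel M b c : M \in V ->
   9%:R * (c * ent M 2 0 + (la + b * lb + c * lc + b * g) * ent M 3 0
     + c * g * ent M 3 1) ^+ 2 =
   8%:R * (ent M 1 0 + b * ent M 2 0 + (ent A 0 3 + b * ent B 0 3 + c * ent C 0 3) * ent M 3 0
     + c * ent M 2 1 + (la + b * lb + c * lc) * ent M 3 1 + g * ent M 3 2)
     * (c * g * ent M 3 0).
  move=> hM; have hN : A + b *: B + c *: C \in V by rewrite !memvD // memvZ.
  have sN : strict_upper (A + b *: B + c *: C).
    by rewrite addrC; apply: strict_upper_lin => //; rewrite addrC; apply: strict_upper_lin.
  have := strict_relation4 hI h2 hM hN sN; cbv zeta; rewrite !entD B23 C23 -/g -/la -/lb -/lc.
  rewrite !(eA 0 1 isT isT, eA 0 2 isT isT, eA 1 2 isT isT,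
    eB 0 1 isT isT, eB 0 2 isT isT, eB 1 2 isT isT,
    eC 0 1 isT isT, eC 0 2 isT isT, eC 1 2 isT isT) /=.
  rewrite !(mulr0, mulr1, addr0, add0r, mul1r) => e; rewrite e; ring.
have n9 : 9%:R != 0 :> K by rewrite (natrM _ 3 3) mulf_neq0.
have n8 : 8%:R != 0 :> K by rewrite (natrM _ 4 2) (natrM _ 2 2) !mulf_neq0.
(* For c = 0 the right-hand side of [rel] vanishes, so the square does, for every [b]. *)
have [M1 hM1 e1] := ents (fun i => (i == 3)%:R).
have r1 b : la + b * lb + b * g = 0.
  have := rel M1 b 0 hM1; rewrite !e1 //= !(mulr0, mul0r, addr0, add0r, mulr1).
  by move/eqP; rewrite mulf_eq0 (negPf n9) /= mulf_eq0 orbb => /eqP.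
have la0 : la = 0 by have := r1 0; rewrite !mul0r !addr0.
have lbg : lb = - g.
  by have := r1 1; rewrite la0 add0r !mul1r => /eqP; rewrite addr_eq0 => /eqP.
have [M2 hM2 e2] := ents (fun i => (i == 2)%:R).
(* M_30 = 0 : the square vanishes *)
have s2 : 1 + g * ent M2 3 1 = 0.
  have := rel M2 0 1 hM2; rewrite !e2 //= !(mulr0, mul0r, addr0, add0r, mulr1, mul1r).
  by move/eqP; rewrite mulf_eq0 (negPf n9) /= mulf_eq0 orbb => /eqP.
(* M_30 = 1 : the left-hand side does not depend on b *)
have diff M : M \in V -> ent M 3 0 = 1 ->
    ent M 2 0 + ent B 0 3 * ent M 3 0 - g * ent M 3 1 = 0.
  move=> hM M30; have := rel M 0 1 hM; have := rel M 1 1 hM.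
  rewrite la0 lbg M30 !(mulr0, mul0r, addr0, add0r, mulr1, mul1r) => r2 r3.
  have : 8%:R * g * (ent M 2 0 + ent B 0 3 - g * ent M 3 1) = 0.
    move: r2 r3; set X := (X in 9%:R * X ^+ 2 = _ -> _) => r2.
    set Y := (X in 9%:R * X ^+ 2 = _) => r3.
    have XY : X = Y by rewrite /X /Y; ring.
    move: r3; rewrite -XY r2 => /eqP; rewrite -subr_eq0 => /eqP r4.
    by rewrite -[RHS]r4; ring.
  by move/eqP; rewrite !mulf_eq0 (negPf n8) (negPf g0) /= => /eqP.
have d1 := diff M1 hM1 (e1 3 isT).
have M12 : M1 + M2 \in V by rewrite memvD.
have eD12 i j : ent (M1 + M2) i j = ent M1 i j + ent M2 i j by rewrite /ent mxE.
have := diff _ M12; rewrite !eD12 e1 // e2 // e1 // e2 //= => /(_ (addr0 _)) d2.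
move: d1; rewrite !e1 //= => d1.
have : 1 - g * ent M2 3 1 = 0.
  by rewrite -[RHS](subrr 0) -{1}d2 -d1; ring.
move=> d3; have : 2%:R = 0 :> K by rewrite -[RHS](addr0 0) -{1}s2 -d3; ring.
by apply/eqP.
Qed.

Lemma no_transitive e m (V : {vspace 'M[K]_(1 + m)}) : (2 <= m)%N ->
  spectral iota e V -> bound iota e m -> ('C(1 + m, 2) + 1 + e <= \dim V)%N ->
  transitive_vs V -> False.
Proof.
move=> m2 hs hB hd tV.
have [_ _ /(_ _ (vec0_neq0 K m))[P [I [hP _ _ hf]]]] := spectral_flag c2 c3 m2 hs hB hd.
have {tV} := transitive_conj hP tV.
have {hs} := spectral_conj hP hs.
have {hd} : ('C(1 + m, 2) + 1 + e <= \dim (conj_vs P V))%N by rewrite dim_conj_vs.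
move: (conj_vs P V) hf {hP} => {P V}V hf hd hs tV; have [hI h2 _] := hs.
have nC := nilpotent_annihilator m2 hs hB hd tV.
have hd' : ('C(1 + m, 2) + 1 + e <= \dim (tr_vs V))%N by rewrite dim_tr_vs.
have nT := nilpotent_annihilator m2 (spectral_tr hs) hB hd' (transitive_tr tV).
have nR (z : 'rV[K]_(1 + m)) : z != 0 -> exists U : {vspace 'M[K]_(1 + m)},
    (forall M, M \in U <-> [/\ M \in V, z *m M = 0 & nil_mx iota M]) /\
    \dim U = 'C(m, 2).
  move=> z0; have z1 : z^T != 0.
    by apply: contraNneq z0 => /(congr1 trmx); rewrite trmxK trmx0 => ->.
  have [U [hU dU _]] := nT _ z1; exists (tr_vs U); rewrite dim_tr_vs; split=> // M.
  rewrite mem_tr_vs; split.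
    case/hU; rewrite mem_tr_vs trmxK -trmx_mul => h3 h4 h5; split=> //.
      by rewrite -[z *m M]trmxK h4 trmx0.
    by move=> a ha; apply: h5; rewrite spec_tr.
  case=> h3 h4 h5; apply/hU; split; rewrite ?mem_tr_vs ?trmxK //.
    by rewrite -trmx_mul h4 trmx0.
  by move=> a; rewrite spec_tr; apply: h5.
have m3 := transitive_size m2 hI h2 tV hf nC nR.
have [em|em] : m = 2 \/ m = 3 by lia.
  by move: V I hf tV hI h2 {hs hd hd' nC nT nR hB}; rewrite em => V I hf tV hI h2;
    exact: (no_transitive3 hI h2 tV hf).
have := fun N => strict_corner1 m2 hI h2 tV hf nC nR (N := N).
move: V I hf tV hI h2 {hs hd hd' nC nT nR hB}; rewrite em => V I hf tV hI h2 h.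
by apply: (no_transitive4 hI h2 tV hf) => N; apply: h.
Qed.

End Transitive.

(** * Two by two matrices *)

Section TwoByTwo.
Variable K : fieldType.
Implicit Types (A B : 'M[K]_2) (x y z u w : 'cV[K]_2).

Lemma ord2_ind (P : 'I_2 -> Prop) : P 0 -> P 1 -> forall i, P i.
Proof.
move=> P0 P1 [[|[|//]] hi].
  by rewrite (_ : Ordinal hi = 0) //; apply: val_inj.
by rewrite (_ : Ordinal hi = 1) //; apply: val_inj.
Qed.

Lemma sum2 (F : 'I_2 -> K) : \sum_i F i = F 0 + F 1.
Proof. by rewrite !big_ord_recl big_ord0 addr0; congr (_ + F _); apply: val_inj. Qed.

Lemma det2E A : \det A = A 0 0 * A 1 1 - A 0 1 * A 1 0.
Proof.
rewrite det_mx2 /det2f /ent.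
have -> : inord 0 = 0 :> 'I_2 by apply: val_inj; rewrite /= inordK.
by have -> : inord 1 = 1 :> 'I_2 by apply: val_inj; rewrite /= inordK.
Qed.

Lemma tr2E A : \tr A = A 0 0 + A 1 1.
Proof. by rewrite /mxtrace sum2. Qed.

Definition disc2 A := (\tr A) ^+ 2 - 4%:R * \det A.

(** The determinant of the matrix with columns [x] and [y]. *)
Definition bracket x y := x 0 0 * y 1 0 - x 1 0 * y 0 0.

Lemma mul2E A x i : (A *m x) i 0 = A i 0 * x 0 0 + A i 1 * x 1 0.
Proof. by rewrite mxE sum2. Qed.

Lemma bracket_det A x y : bracket (A *m x) (A *m y) = \det A * bracket x y.
Proof. by rewrite /bracket !mul2E det2E; ring. Qed.

Lemma bracket_eq0 x w : w != 0 -> bracket x w = 0 -> exists c, x = c *: w.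
Proof.
move=> w0 e; have [w00|w00] := eqVneq (w 0 0) 0.
  have w10 : w 1 0 != 0.
    apply: contraNneq w0 => w10; apply/eqP/matrixP => i j; rewrite ord1 mxE.
    by move: i; apply: ord2_ind.
  exists (x 1 0 / w 1 0); apply/matrixP => i j; rewrite ord1 mxE; move: i.
  apply: ord2_ind; last by rewrite divfK.
  move: e; rewrite /bracket w00 !mulr0 subr0 => /eqP.
  by rewrite mulf_eq0 (negPf w10) orbF => /eqP.
exists (x 0 0 / w 0 0); apply/matrixP => i j; rewrite ord1 mxE; move: i.
apply: ord2_ind; first by rewrite divfK.
move/eqP: e; rewrite /bracket subr_eq0 => /eqP e.
by rewrite mulrAC e mulfK.
Qed.

Lemma bracketZ a x z : bracket (a *: x) z = a * bracket x z.
Proof. by rewrite /bracket !mxE; ring. Qed.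

Lemma bracket0 z : bracket 0 z = 0.
Proof. by rewrite /bracket !mxE; ring. Qed.

(* A space of singular 2x2 matrices has a common kernel or a common image,
   hence a common eigenvector. *)
Lemma no_singular (X : {vspace 'M[K]_2}) : (forall A, A \in X -> \det A = 0) ->
  (forall z, z != 0 -> exists2 A, A \in X & forall c, A *m z <> c *: z) -> False.
Proof.
move=> sX tX.
have br A x y : A \in X -> bracket (A *m x) (A *m y) = 0.
  by move=> /sX d0; rewrite bracket_det d0 mul0r.
have polar A B x y : A \in X -> B \in X ->
    bracket (A *m x) (B *m y) + bracket (B *m x) (A *m y) = 0.
  move=> hA hB; transitivity (bracket ((A + B) *m x) ((A + B) *m y)
      - bracket (A *m x) (A *m y) - bracket (B *m x) (B *m y)).
    by rewrite /bracket !mul2E !mxE; ring.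
  by rewrite !br ?memvD // !subr0.
have e0 : (delta_mx 0 0 : 'cV[K]_2) != 0.
  by apply: contraTneq (isT : true) => /matrixP/(_ 0 0)/eqP; rewrite !mxE !eqxx oner_eq0.
have [A1 hA1 nA1] := tX _ e0.
have /det0_kernel[u u0 A1u] := sX _ hA1.
set y : 'cV[K]_2 := delta_mx 0 0 in e0 nA1.
set w := A1 *m y; have w0 : w != 0.
  by apply/eqP => e; apply: (nA1 0); rewrite scale0r.
have hw B : B \in X -> bracket (B *m u) w = 0.
  move=> hB; have := polar A1 B u y hA1 hB.
  by rewrite A1u bracket0 add0r.
have [A3 hA3 nA3] := tX _ u0.
have [l el] := bracket_eq0 w0 (hw _ hA3).
have l0 : l != 0.
  by apply/eqP => e; apply: (nA3 0); rewrite el e !scale0r.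
have [A2 hA2 nA2] := tX _ w0.
have bw : bracket w (A2 *m w) != 0.
  apply/eqP => e; have e' : bracket (A2 *m w) w = 0.
    by rewrite -[RHS]oppr0 -e /bracket; ring.
  by have [c ec] := bracket_eq0 w0 e'; apply: (nA2 c).
have A2u : A2 *m u = 0.
  have [c ec] := bracket_eq0 w0 (hw _ hA2).
  have := br _ u w hA2; rewrite ec bracketZ => /eqP.
  by rewrite mulf_eq0 (negPf bw) orbF => /eqP->; rewrite scale0r.
have := polar A2 A3 u w hA2 hA3.
rewrite A2u bracket0 add0r el bracketZ => /eqP.
by rewrite mulf_eq0 (negPf bw) (negPf l0).
Qed.

Lemma detD2 A B t : \det (A + t *: B) = \det A
  + t * (A 0 0 * B 1 1 + A 1 1 * B 0 0 - A 0 1 * B 1 0 - A 1 0 * B 0 1) + t ^+ 2 * \det B.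
Proof. by rewrite !det2E !mxE; ring. Qed.

Hypotheses (c2 : 2%:R != 0 :> K) (c3 : 3%:R != 0 :> K).

(** The product of the two quadratics has degree at most 4 and vanishes at the five scalars, so one
    factor is zero; it is not the second. *)
Lemma quadratic_alternative (a0 a1 a2 b0 b1 b2 : K) : b2 != 0 ->
  (forall t, a0 + t * a1 + t ^+ 2 * a2 = 0 \/ b0 + t * b1 + t ^+ 2 * b2 = 0) -> a0 = 0.
Proof.
move=> n0 h; pose p := Poly [:: a0; a1; a2]; pose q := Poly [:: b0; b1; b2].
have ev (x0 x1 x2 t : K) : (Poly [:: x0; x1; x2]).[t] = x0 + t * x1 + t ^+ 2 * x2.
  by rewrite horner_Poly /=; ring.
have r5 : all (root (p * q)) (five K).
  apply/allP => t _; rewrite rootM !rootE !ev.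
  by case: (h t) => ->; rewrite eqxx ?orbT.
have pq : p * q = 0.
  apply/eqP/negPn/negP => n; have := max_poly_roots n r5 (uniq_five c2 c3).
  rewrite ltnNge => /negP; apply; apply: (leq_trans (size_polyMleq _ _)).
  have aux a b : (a <= 3)%N -> (b <= 3)%N -> ((a + b).-1 <= 5)%N by lia.
  exact: (aux _ _ (size_Poly [:: a0; a1; a2]) (size_Poly [:: b0; b1; b2])).
have q0 : q != 0.
  by apply: contraNneq n0 => /(congr1 (fun r : {poly K} => r`_2)); rewrite coef_Poly coef0 /= => ->.
move/eqP: pq; rewrite mulf_eq0 (negPf q0) orbF => /eqP/(congr1 (fun r : {poly K} => r`_0)).
by rewrite coef_Poly coef0.
Qed.

(** A linear choice of eigenvalue makes the [f M - l M] a space of singular matrices, against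
    [no_singular]. On a line directed by an element of nonzero discriminant the first alternative
    holds identically; if all discriminants vanish, half the trace is a linear eigenvalue
    instead. *)
Lemma no_eigenvalue_form (vT : vectType K) (U : {vspace vT}) (f : vT -> 'M[K]_2) (l : vT -> K) :
  linear f -> (forall a (u v : vT), l (a *: u + v) = a * l u + l v) ->
  (forall M, M \in U -> \det (f M - (l M)%:M) = 0 \/ disc2 (f M) = 0) ->
  (forall z, z != 0 -> exists2 M, M \in U & forall c, f M *m z <> c *: z) -> False.
Proof.
move=> lf ll hU tU.
have shift (k : vT -> K) : (forall a (u v : vT), k (a *: u + v) = a * k u + k v) ->
    (forall M, M \in U -> \det (f M - (k M)%:M) = 0) -> False.
  move=> lk hk; pose g M := f M - (k M)%:M.
  have lg : linear g.
    move=> a u v; rewrite /g lf lk raddfD /= -scale_scalar_mx scalerBr.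
    by rewrite opprD addrACA.
  have [X hX] := image_ex U lg.
  apply: (@no_singular X) => [A /hX[M hM <-]|z z0]; first exact: hk.
  have [M hM nM] := tU z z0; exists (g M); first by apply/hX; exists M.
  move=> c e; apply: (nM (c + k M)); rewrite scalerDl -e /g mulmxBl mul_scalar_mx.
  by rewrite subrK.
case: (classic (exists2 M, M \in U & disc2 (f M) != 0)) => [[M0 hM0 d0]|hn].
  apply: (shift l ll) => M hM.
  set A := f M; set B := f M0; pose A' := A - (l M)%:M; pose B' := B - (l M0)%:M.
  pose beta (X Y : 'M[K]_2) := X 0 0 * Y 1 1 + X 1 1 * Y 0 0 - X 0 1 * Y 1 0 - X 1 0 * Y 0 1.
  apply: (@quadratic_alternative _ (beta A' B') (\det B')
    (disc2 A) (2%:R * (\tr A * \tr B) - 4%:R * beta A B) (disc2 B)) => // t.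
  have hMt : t *: M0 + M \in U by rewrite memvD // memvZ.
  have := hU _ hMt; rewrite lf ll -/A -/B.
  have -> : t *: B + A - (t * l M0 + l M)%:M = A' + t *: B'.
    by rewrite raddfD /= -scale_scalar_mx /A' /B' scalerBr opprD addrACA addrC.
  rewrite -/(beta A' B') detD2 -/(beta _ _).
  case=> e; [by left | right; rewrite -[RHS]e].
  by rewrite /disc2 addrC detD2 -/(beta A B) linearD linearZ /=; ring.
apply: (shift (fun M => \tr (f M) / 2%:R)).
  by move=> a u v; rewrite lf linearD linearZ /= mulrDl mulrA.
move=> M hM; have d0 : disc2 (f M) = 0.
  by apply/eqP/negPn/negP => h; apply: hn; exists M.
have n4 : 4%:R != 0 :> K by rewrite (natrM _ 2 2) mulf_neq0.
apply: (mulfI n4); rewrite mulr0 -[RHS]oppr0 -d0 /disc2 det2E !mxE tr2E det2E /=.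
by rewrite !mulr1n !mulr0n; field.
Qed.

Lemma mx2P A B : A 0 0 = B 0 0 -> A 0 1 = B 0 1 -> A 1 0 = B 1 0 -> A 1 1 = B 1 1 -> A = B.
Proof.
move=> h1 h2 h3 h4; apply/matrixP => i j; move: i j.
by apply: ord2_ind; apply: ord2_ind.
Qed.

Definition mx2 (a b c d : K) : 'M[K]_2 :=
  \matrix_(i, j) (if i == 0 then (if j == 0 then a else b) else (if j == 0 then c else d)).

Lemma mx2E (a b c d : K) : (mx2 a b c d 0 0 = a) * (mx2 a b c d 0 1 = b) *
  (mx2 a b c d 1 0 = c) * (mx2 a b c d 1 1 = d).
Proof. by rewrite !mxE. Qed.

Lemma mul2mxE A B i j : (A *m B) i j = A i 0 * B 0 j + A i 1 * B 1 j.
Proof. by rewrite mxE sum2. Qed.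

(** For the matrix with entries p, q, r, t: its determinant is 0, stays 0 after adding E_00 and
    becomes 1 after adding the identity. *)
Lemma off_diagonal (p q r t : K) : p * t - q * r = 0 -> (1 + p) * t - q * r = 0 ->
  (1 + p) * (1 + t) - q * r = 1 -> [/\ p = 0, t = 0 & q * r = 0].
Proof.
move=> h1 h2 h3.
have t0 : t = 0.
  rewrite (_ : t = ((1 + p) * t - q * r) - (p * t - q * r)); last by ring.
  by rewrite h1 h2 subr0.
move: h1 h3; rewrite t0 mulr0 sub0r addr0 mulr1 => /eqP; rewrite oppr_eq0 => /eqP qr.
rewrite qr subr0 => h3; split=> //.
by apply: (addrI 1); rewrite h3 addr0.
Qed.

(** The image of E_00 is an idempotent of rank one, which a conjugation brings back to E_00. The
    images of E_01 and E_10 are then off-diagonal with zero determinant, and the side on which E_01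
    lands decides between [A] and its transpose. *)
Lemma det_preserver (f : 'M[K]_2 -> 'M[K]_2) : linear f -> f 1%:M = 1%:M ->
  (forall A, \det (f A) = \det A) ->
  exists2 Q, Q \in unitmx & (forall A, f A = conj_mx Q A) \/ (forall A, f A = conj_mx Q A^T).
Proof.
move=> lf f1 df.
have fD A B : f (A + B) = f A + f B by have := lf 1 A B; rewrite !scale1r.
pose F := f (mx2 1 0 0 0).
have dF : \det F = 0 by rewrite df det2E !mx2E; ring.
(* From det (1 + F) = 1 + tr F + det F. *)
have tF : \tr F = 1.
  have h : \det (f (1%:M + mx2 1 0 0 0)) = 1 + 1 by rewrite df det2E !mxE /=; ring.
  apply: (addrI 1); rewrite -h fD f1 -/F -[LHS]addr0 -dF !det2E tr2E.
  by rewrite ![(1%:M + F) _ _]mxE ![1%:M _ _]mxE /= !(mulr1n, mulr0n); ring.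
(* a basis diagonalizing the rank one idempotent F *)
have [Q hQ FQ] : exists2 Q, Q \in unitmx & F *m Q = Q *m mx2 1 0 0 0.
  have tF' := tF; have dF' := dF; rewrite tr2E in tF'; rewrite det2E in dF'.
  have eF : F 1 1 = 1 - F 0 0 by rewrite -tF'; ring.
  rewrite eF in dF'.
  have [a0|a0] := eqVneq (F 0 0) 0.
    move: dF'; rewrite a0 !mul0r sub0r => /eqP; rewrite oppr_eq0 => /eqP bc.
    exists (mx2 (F 0 1) 1 1 (- F 1 0)).
      rewrite unitmxE det2E !mx2E unitfE mulrN bc oppr0 mulr1 sub0r.
      by rewrite oppr_eq0 oner_neq0.
    apply: mx2P; rewrite !mul2mxE !mx2E ?eF ?a0.
    - ring.
    - rewrite mulrN bc; ring.
    - by rewrite [F 1 0 * _]mulrC bc; ring.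
    - ring.
  exists (mx2 (F 0 0) (- F 0 1) (F 1 0) (F 0 0)).
    rewrite unitmxE det2E !mx2E unitfE.
    suff -> : F 0 0 * F 0 0 - - F 0 1 * F 1 0 = F 0 0 by [].
    apply/eqP; rewrite -subr_eq0.
    rewrite (_ : _ - _ = - (F 0 0 * (1 - F 0 0) - F 0 1 * F 1 0)); last by ring.
    by rewrite dF' oppr0.
  apply: mx2P; rewrite !mul2mxE !mx2E ?eF.
  - apply/eqP; rewrite -subr_eq0.
    rewrite (_ : _ - _ = - (F 0 0 * (1 - F 0 0) - F 0 1 * F 1 0)); last by ring.
    by rewrite dF' oppr0.
  - ring.
  - ring.
  - apply/eqP; rewrite -subr_eq0.
    rewrite (_ : _ - _ = F 0 0 * (1 - F 0 0) - F 0 1 * F 1 0); last by ring.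
    by rewrite dF'.
pose g A := conj_mx (invmx Q) (f A).
have lg : linear g by move=> a A B; rewrite /g lf conj_mx_lin.
have gD A B : g (A + B) = g A + g B by have := lg 1 A B; rewrite !scale1r.
have dg A : \det (g A) = \det A.
  rewrite /g /conj_mx invmxK !det_mulmx det_inv df mulrAC mulVf ?mul1r //.
  by move: hQ; rewrite unitmxE unitfE.
have gE : g (mx2 1 0 0 0) = mx2 1 0 0 0 by rewrite /g /conj_mx -/F invmxK -mulmxA FQ mulKmx.
have g1 : g 1%:M = 1%:M by rewrite /g f1 conj_mx_scalar // unitmx_inv.
have offdiag A : A 0 0 = 0 -> A 1 1 = 0 -> A 0 1 * A 1 0 = 0 ->
    [/\ g A 0 0 = 0, g A 1 1 = 0 & g A 0 1 * g A 1 0 = 0].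
  move=> a0 a1 a2.
  have h1 : \det (g A) = 0 by rewrite dg det2E a0 a2 mul0r subr0.
  have h2 : \det (g (mx2 1 0 0 0 + A)) = 0.
    rewrite dg det2E ![(_ + A) _ _]mxE !mx2E a0 a1 !add0r !addr0 a2; ring.
  have h3 : \det (g (1%:M + A)) = 1.
    by rewrite dg det2E ![(_ + A) _ _]mxE !mxE /= a0 a1 !add0r !addr0 a2; ring.
  move: h1 h2 h3; rewrite !gD gE g1 !det2E ![(_ + g A) _ _]mxE !mx2E ![1%:M _ _]mxE /=.
  rewrite !mulr1n !mulr0n !add0r => h1 h2 h3.
  exact: off_diagonal h1 h2 h3.
have [] := offdiag (mx2 0 1 0 0); rewrite ?mx2E ?mulr0 //.
set N := g _ => N0 N1 N2.
have [] := offdiag (mx2 0 0 1 0); rewrite ?mx2E ?mul0r //.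
set N' := g (mx2 0 0 1 0) => N0' N1' N2'.
(* The matrix E_01 + E_10 has determinant -1, and so has its image. *)
have NN : (N 0 1 + N' 0 1) * (N 1 0 + N' 1 0) = 1.
  have : \det (g (mx2 0 1 0 0 + mx2 0 0 1 0)) = -1.
    by rewrite dg det2E !mxE /=; ring.
  rewrite gD -/N -/N' det2E ![(N + N') _ _]mxE N0 N1 N0' N1' => h.
  by apply: oppr_inj; rewrite -[RHS]h; ring.
have gA A : g A = A 0 0 *: mx2 1 0 0 0 + A 0 1 *: N + A 1 0 *: N' + A 1 1 *: mx2 0 0 0 1.
  have g4 : g (mx2 0 0 0 1) = mx2 0 0 0 1.
    have e : 1%:M = mx2 1 0 0 0 + mx2 0 0 0 1.
      by apply: mx2P; rewrite !mxE /= ?addr0 ?add0r.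
    have := g1; rewrite {1 2}e gD gE => /addrI //.
  have eA : A = A 0 0 *: mx2 1 0 0 0 + (A 0 1 *: mx2 0 1 0 0 + (A 1 0 *: mx2 0 0 1 0
      + (A 1 1 *: mx2 0 0 0 1 + 0))).
    by apply: mx2P; rewrite !mxE /=; ring.
  have g0 : g 0 = 0 by have := lg (-1) 0 0; rewrite scaler0 addr0 scaleN1r addNr.
  by rewrite {1}eA !lg gE g4 g0 -/N -/N' addr0 !addrA.
clearbody N N'.
have conjQ R : R \in unitmx -> (forall A, g A = conj_mx R A) ->
    forall A, f A = conj_mx (Q *m R) A.
  by move=> hR h A; rewrite conj_mx_mul // -h /g conj_mxVK.
have conjQT R : R \in unitmx -> (forall A, g A = conj_mx R A^T) ->
    forall A, f A = conj_mx (Q *m R) A^T.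
  by move=> hR h A; rewrite conj_mx_mul // -h /g conj_mxVK.
have unitD d : d != 0 -> mx2 d 0 0 1 \in unitmx.
  by move=> d0; rewrite unitmxE det2E !mx2E mul0r subr0 mulr1 unitfE.
have conjD d A B : d != 0 -> B *m mx2 d 0 0 1 = mx2 d 0 0 1 *m A -> B = conj_mx (mx2 d 0 0 1) A.
  by move=> d0 h; rewrite /conj_mx -h mulmxK // unitD.
have [n0|n0] := eqVneq (N 1 0) 0.
  move: NN; rewrite n0 add0r => NN.
  have m0 : N' 1 0 != 0.
    by apply: contraTneq (oner_neq0 K) => e; rewrite -NN e mulr0 eqxx.
  have m1 : N' 0 1 = 0.
    by move/eqP: N2'; rewrite mulf_eq0 (negPf m0) orbF => /eqP.
  rewrite m1 addr0 in NN.
  have d0 : N 0 1 != 0.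
    by apply: contraTneq (oner_neq0 K) => e; rewrite -NN e mul0r eqxx.
  exists (Q *m mx2 (N 0 1) 0 0 1); first by rewrite unitmx_mul hQ unitD.
  left; apply: conjQ; first exact: unitD.
  move=> A; rewrite gA; apply: conjD => //; apply: mx2P;
    rewrite !mul2mxE !mxE /= ?N0 ?N1 ?N0' ?N1' ?n0 ?m1; try by ring.
  by transitivity (A 1 0 * (N 0 1 * N' 1 0)); [ring | rewrite NN; ring].
have n1 : N 0 1 = 0.
  by move/eqP: N2; rewrite mulf_eq0 (negPf n0) orbF => /eqP.
move: NN; rewrite n1 add0r => NN.
have m0 : N' 0 1 != 0.
  by apply: contraTneq (oner_neq0 K) => e; rewrite -NN e mul0r eqxx.
have m1 : N' 1 0 = 0.
  by move/eqP: N2'; rewrite mulf_eq0 (negPf m0) => /eqP.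
rewrite m1 addr0 in NN.
exists (Q *m mx2 (N' 0 1) 0 0 1); first by rewrite unitmx_mul hQ unitD.
right; apply: conjQT; first exact: unitD.
move=> A; rewrite gA; apply: conjD => //; apply: mx2P;
  rewrite !mul2mxE !mxE /= ?N0 ?N1 ?N0' ?N1' ?n1 ?m1; try by ring.
by transitivity (A 0 1 * (N' 0 1 * N 1 0)); [ring | rewrite NN; ring].
Qed.

End TwoByTwo.

Section Eigenvalues2.
Variables (K : fieldType) (L : closedFieldType) (iota : {rmorphism K -> L}).

Lemma spec2 (A : 'M[K]_2) : exists a b, [/\ spec iota A a, spec iota A b,
  iota (\tr A) = a + b & iota (\det A) = a * b].
Proof.
set A' := map_mx iota A.
have [rs ers] := closed_field_poly_normal (char_poly A').
have := monicP (char_poly_monic A') => lc; rewrite lc scale1r in ers.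
have srs : size rs = 2.
  by have := size_char_poly A'; rewrite ers size_prod_XsubC => -[].
case: rs srs ers => [|a [|b []]] // _; rewrite !big_cons big_nil mulr1 => ers.
exists a, b; rewrite /spec !eigenvalue_root_char -/A' ers !rootM !root_XsubC !eqxx orbT.
split=> //.
  have := @char_poly_trace _ _ A' isT; rewrite ers => h.
  rewrite -trace_map_mx -/A' -[\tr A']opprK -h.
  rewrite (_ : ('X - a%:P) * ('X - b%:P) = 'X^2 - (a + b)%:P * 'X + (a * b)%:P).
    by rewrite !(coefD, coefN, coefCM, coefXn, coefX, coefC) /= mulr1 addr0 add0r opprK.
  by rewrite rmorphD rmorphM /=; ring.
have := @char_poly_det _ _ A'; rewrite ers => h.
rewrite -det_map_mx -/A'.
have -> : \det A' = (('X - a%:P) * ('X - b%:P))`_0 by rewrite h expr2 mulrNN !mul1r.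
by rewrite coef0M !coefB !coefX !coefC /= !sub0r mulrNN.
Qed.

End Eigenvalues2.

(** * Spaces transitive on an invariant plane *)

Section Planes.
Variables (K : fieldType) (L : closedFieldType) (iota : {rmorphism K -> L}).
Hypotheses (c2 : 2%:R != 0 :> K) (c3 : 3%:R != 0 :> K).

Definition diag_pair s (V : {vspace 'M[K]_(2 + s)}) (A : 'M[K]_2) (B : 'M[K]_s) :=
  (block_mx A 0 0 B : 'M_(2 + s)) \in V.

(** As all upper right blocks are present, [V] is determined by the pairs of diagonal blocks it
    contains. *)
Definition transitive_plane s (V : {vspace 'M[K]_(2 + s)}) :=
  [/\ forall M, M \in V -> dlsubmx M = 0,
      forall C, (block_mx 0 C 0 0 : 'M_(2 + s)) \in V
    & forall z : 'cV[K]_2, z != 0 -> forall v, exists2 M, M \in V & ulsubmx M *m z = v].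

Definition unit01 : 'M[K]_2 := mx2 0 1 0 0.

(** The block form of [flagged] at the first vector of the plane. A strictly triangular [B] is
    realized with a multiple of E_01, whose coefficient [r] will turn out to depend on the corner
    entry of [B] alone. *)
Definition plane_flag s (V : {vspace 'M[K]_(2 + s)}) :=
  (forall M, M \in V -> ulsubmx M *m (delta_mx 0 0 : 'cV_2) = 0 ->
     forall i j : 'I_s, (j < i)%N -> drsubmx M i j = 0) /\
  (forall B, strict_upper B -> exists r, diag_pair V (r *: unit01) B).

Lemma diag_pair_lin s (V : {vspace 'M[K]_(2 + s)}) a A B A' B' :
  diag_pair V A B -> diag_pair V A' B' -> diag_pair V (a *: A + A') (a *: B + B').
Proof.
move=> h h'; rewrite /diag_pair.
have -> : block_mx (a *: A + A') 0 0 (a *: B + B') =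
  a *: block_mx A 0 0 B + block_mx A' 0 0 B' :> 'M_(2 + s).
  by rewrite scale_block_mx add_block_mx !scaler0 !addr0.
by rewrite memvD // memvZ.
Qed.

Lemma diag_pairZ s (V : {vspace 'M[K]_(2 + s)}) a A B :
  diag_pair V A B -> diag_pair V (a *: A) (a *: B).
Proof.
move=> h; rewrite -[a *: A]addr0 -[a *: B]addr0; apply: diag_pair_lin => //.
by rewrite /diag_pair; have -> : block_mx 0 0 0 0 = 0 :> 'M[K]_(2 + s); rewrite ?mem0v ?block_mx0.
Qed.

Lemma mem_plane s (V : {vspace 'M[K]_(2 + s)}) M : transitive_plane V ->
  M \in V <-> dlsubmx M = 0 /\ diag_pair V (ulsubmx M) (drsubmx M).
Proof.
case=> h1 h2 _.
have eM : dlsubmx M = 0 -> M =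
    block_mx (ulsubmx M) 0 0 (drsubmx M) + block_mx 0 (ursubmx M) 0 0.
  move=> e; rewrite -{1}[M]submxK e add_block_mx !addr0 !add0r //.
split=> [hM|[e hp]]; last by rewrite (eM e) memvD.
split; first exact: h1.
rewrite /diag_pair -(addrK (block_mx 0 (ursubmx M) 0 0) (block_mx _ _ _ _)).
by rewrite -eM ?h1 // memvB.
Qed.

(** When [A] has two distinct eigenvalues, those of [B] are among them, so [l M] is one of [A];
    otherwise the discriminant of [A] vanishes. Both cases are allowed in [no_eigenvalue_form]. *)
Lemma eigen_form_false s (V : {vspace 'M[K]_(2 + s)}) (l : 'M[K]_(2 + s) -> K) :
  transitive_plane V -> two_spec iota V ->
  (forall a u v, l (a *: u + v) = a * l u + l v) ->
  (forall M, M \in V -> exists2 B, diag_pair V (ulsubmx M) B & \det (B - (l M)%:M) = 0) ->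
  False.
Proof.
move=> pV h2 ll h.
have lu : linear (fun M : 'M[K]_(2 + s) => ulsubmx M).
  by move=> a M N; apply/matrixP => i j; rewrite !mxE.
apply: (no_eigenvalue_form c2 c3 (U := V) lu ll) => [M hM|z z0].
  have [B hB dB] := h M hM.
  have [d0|d0] := eqVneq (disc2 (ulsubmx M)) 0; [by right | left].
  have [a [b [ha hb tA dA]]] := spec2 iota (ulsubmx M).
  have ab : a != b.
    apply: contraNneq d0 => e; rewrite -(fmorph_eq0 iota) /disc2 rmorphB rmorphXn rmorphM.
    rewrite rmorph_nat tA dA e; apply/eqP; ring.
  have sl : spec iota B (iota (l M)).
    have /det0_kernel[y y0 e] := dB.
    apply: (spec_eigvec iota y0); apply/eqP; rewrite -subr_eq0 -mul_scalar_mx -mulmxBl.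
    by rewrite e.
  have sp x : spec iota (ulsubmx M) x || spec iota B x ->
      eigenvalue (map_mx iota (block_mx (ulsubmx M) 0 0 B)) x.
    by move=> hx; rewrite -/(spec iota _ x) spec_ublock.
  have sA : spec iota (ulsubmx M) (iota (l M)).
    have := h2 _ hB a b (iota (l M)); rewrite !sp ?ha ?hb ?sl ?orbT // => /(_ isT isT isT).
    case=> [e|[<-|<-]] //; by rewrite e eqxx in ab.
  have [y y0 e] := spec_K sA; apply/det0_kernel; exists y => //.
  by rewrite mulmxBl mul_scalar_mx e subrr.
have [_ _ tV] := pV.
have [v hv] : exists v : 'cV[K]_2, forall c, v <> c *: z.
  have [z00|z00] := eqVneq (z 0 0) 0.
    exists (delta_mx 0 0) => c /matrixP/(_ 0 0)/eqP.
    by rewrite !mxE !eqxx z00 mulr0 oner_eq0.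
  exists (delta_mx 1 0) => c e; have := congr1 (fun v : 'cV_2 => v 0 0) e.
  rewrite !mxE /= => /esym/eqP; rewrite mulf_eq0 (negPf z00) orbF => /eqP c0.
  by move/matrixP/(_ 1 0)/eqP: e; rewrite !mxE !eqxx c0 mul0r oner_eq0.
by have [M hM eM] := tV z z0 v; exists M => // c; rewrite eM; apply: hv.
Qed.

Section Base.
Variables (t : nat) (V : {vspace 'M[K]_(2 + t.+1)}).
Hypotheses (pV : transitive_plane V) (h2 : two_spec iota V) (fV : plane_flag V).
Local Notation pr := (diag_pair V).

Lemma pair0_space : exists Z : {vspace 'M[K]_t.+1}, forall B, B \in Z <-> pr 0 B.
Proof.
apply: subspace_ex => [|a B B' h h'].
  by rewrite /diag_pair block_mx0 mem0v.
by have := diag_pair_lin a h h'; rewrite scaler0 addr0.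
Qed.

(** Pairs (0, B) then clear the last column off the diagonal, so that its diagonal entry becomes an
    eigenvalue, linear in [M]. *)
Lemma column_false : (forall j : 'I_t.+1, (j < t)%N ->
  exists2 B, pr 0 B & forall i, B i ord_max = (i == j)%:R) -> False.
Proof.
move=> h; have [Z hZ] := pair0_space.
have [B hB] : exists B : 'I_t.+1 -> 'M[K]_t.+1, forall j : 'I_t.+1, (j < t)%N ->
    B j \in Z /\ forall i, B j i ord_max = (i == j)%:R.
  apply: (fin_all_exists (P := fun (j : 'I_t.+1) X => (j < t)%N -> X \in Z /\ forall i, X i ord_max = (i == j)%:R)).
  move=> j; have [jt|jt] := ltnP j t; last by exists 0.
  by have [X hX eX] := h j jt; exists X => _; split=> //; apply/hZ.
apply: (@eigen_form_false _ V (fun M => drsubmx M ord_max ord_max)) => //.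
  by move=> a u v; rewrite !mxE.
move=> M /(mem_plane M pV)[_ hM].
pose S := \sum_(j < t.+1 | (j < t)%N) drsubmx M j ord_max *: B j.
have hS : S \in Z by apply: memv_suml => j jt; rewrite memvZ //; case: (hB j jt).
exists (drsubmx M - S).
  move/hZ: hS => hS; have := diag_pair_lin (-1) hS hM.
  by rewrite scaler0 add0r scaleN1r addrC.
apply/det0_kernel; exists (delta_mx ord_max 0).
  by apply: contraTneq (isT : true) => /matrixP/(_ ord_max 0)/eqP; rewrite !mxE !eqxx oner_eq0.
rewrite mulmxBl mul_scalar_mx -colE; apply/matrixP => i i'; rewrite ord1 !mxE eqxx andbT.
rewrite summxE; have [it|it] := ltnP i t.
  rewrite (bigD1 i) //= big1 => [|j /andP[jt ji]].
    rewrite addr0 !mxE; have [_ ->] := hB i it; rewrite eqxx mulr1 subrr sub0r.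
    by case: eqP it => [->|_ _]; rewrite ?ltnn // mulr0 oppr0.
  by rewrite mxE; have [_ ->] := hB j jt; rewrite eq_sym (negPf ji) mulr0.
have -> : i = ord_max by apply: val_inj; apply/eqP; rewrite eqn_leq it -ltnS ltn_ord.
rewrite eqxx mulr1 big1 ?subr0 ?subrr // => j jt; rewrite mxE; have [_ ->] := hB j jt.
by case: eqP jt => [<-|_ _]; rewrite ?ltnn // mulr0.
Qed.

Lemma row_false : (forall j : 'I_t.+1, (0 < j)%N ->
  exists2 B, pr 0 B & forall i, B ord0 i = (i == j)%:R) -> False.
Proof.
move=> h; have [Z hZ] := pair0_space.
have [B hB] : exists B : 'I_t.+1 -> 'M[K]_t.+1, forall j : 'I_t.+1, (0 < j)%N ->
    B j \in Z /\ forall i, B j ord0 i = (i == j)%:R.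
  apply: (fin_all_exists (P := fun (j : 'I_t.+1) X => (0 < j)%N -> X \in Z /\ forall i, X ord0 i = (i == j)%:R)).
  move=> j; have [jt|jt] := ltnP 0 j; last by exists 0.
  by have [X hX eX] := h j jt; exists X => _; split=> //; apply/hZ.
apply: (@eigen_form_false _ V (fun M => drsubmx M ord0 ord0)) => //.
  by move=> a u v; rewrite !mxE.
move=> M /(mem_plane M pV)[_ hM].
pose S := \sum_(j < t.+1 | (0 < j)%N) drsubmx M ord0 j *: B j.
have hS : S \in Z by apply: memv_suml => j jt; rewrite memvZ //; case: (hB j jt).
exists (drsubmx M - S).
  move/hZ: hS => hS; have := diag_pair_lin (-1) hS hM.
  by rewrite scaler0 add0r scaleN1r addrC.
rewrite -det_tr; apply/det0_kernel; exists (delta_mx ord0 0).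
  by apply: contraTneq (isT : true) => /matrixP/(_ ord0 0)/eqP; rewrite !mxE !eqxx oner_eq0.
rewrite linearB /= tr_scalar_mx.
rewrite mulmxBl mul_scalar_mx -colE; apply/matrixP => i i'; rewrite ord1 !mxE eqxx andbT.
rewrite summxE; have [it|it] := ltnP 0 i.
  rewrite (bigD1 i) //= big1 => [|j /andP[jt ji]].
    rewrite addr0 !mxE; have [_ ->] := hB i it; rewrite eqxx mulr1 subrr sub0r.
    by case: eqP it => [->|_ _] //; rewrite mulr0 oppr0.
  by rewrite mxE; have [_ ->] := hB j jt; rewrite eq_sym (negPf ji) mulr0.
have -> : i = ord0 by apply: val_inj; apply/eqP; rewrite -leqn0.
rewrite eqxx mulr1 big1 ?subr0 ?subrr // => j jt; rewrite mxE; have [_ ->] := hB j jt.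
by case: eqP jt => [<-|_ _] //; rewrite mulr0.
Qed.

Lemma strict_delta (i j : 'I_t.+1) : (i < j)%N -> strict_upper (delta_mx i j : 'M[K]_t.+1).
Proof.
move=> ij a b ab; rewrite mxE; case: eqP => // ea; case: eqP => //= eb.
by move: ab; rewrite ea eb leqNgt ij.
Qed.

(* A pair (r E_01, B) with r <> 0 allows to clear the first component. *)
Lemma last_column_zero r B : pr (r *: unit01) B -> (forall i, B i ord_max = 0) -> r = 0.
Proof.
move=> hB B0; apply/eqP/negPn/negP => r0; apply: column_false => j jt.
have [_ fb] := fV; have [r' hr'] := fb _ (strict_delta (j := ord_max) jt).
exists (- (r' / r) *: B + delta_mx j ord_max).
  have := diag_pair_lin (- (r' / r)) hB hr'.
  by rewrite scalerA mulNr divfK // -scalerDl addNr scale0r.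
by move=> i; rewrite !mxE B0 mulr0 add0r eqxx andbT.
Qed.

Lemma first_row_zero r B : pr (r *: unit01) B -> (forall i, B ord0 i = 0) -> r = 0.
Proof.
move=> hB B0; apply/eqP/negPn/negP => r0; apply: row_false => j jt.
have [_ fb] := fV; have [r' hr'] := fb _ (strict_delta (i := ord0) jt).
exists (- (r' / r) *: B + delta_mx ord0 j).
  have := diag_pair_lin (- (r' / r)) hB hr'.
  by rewrite scalerA mulNr divfK // -scalerDl addNr scale0r.
by move=> i; rewrite !mxE B0 mulr0 add0r eqxx.
Qed.

(** [N] is cut into its last column, which has zero first row, and the rest, which has zero last
    column; each part is paired with 0. *)
Lemma strict_pair0 N : strict_upper N -> N ord0 ord_max = 0 -> pr 0 N.
Proof.
move=> sN N0; have [_ fb] := fV.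
pose N1 : 'M[K]_t.+1 := \matrix_(i, j) (if j == ord_max then N i j else 0).
pose N2 : 'M[K]_t.+1 := \matrix_(i, j) (if j == ord_max then 0 else N i j).
have s1 : strict_upper N1 by move=> i j ij; rewrite mxE sN // if_same.
have s2 : strict_upper N2 by move=> i j ij; rewrite mxE sN // if_same.
have [r1 h1] := fb _ s1; have [r2 h3] := fb _ s2.
have r10 : r1 = 0.
  by apply: (first_row_zero h1) => i; rewrite mxE; case: eqP => // ->.
have r20 : r2 = 0.
  by apply: (last_column_zero h3) => i; rewrite mxE eqxx.
have := diag_pair_lin 1 h1 h3; rewrite r10 r20 !scale0r scaler0 addr0 scale1r.
rewrite (_ : N1 + N2 = N) //; apply/matrixP => i j; rewrite !mxE.
by case: eqP; rewrite ?addr0 ?add0r.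
Qed.

(** If the corner matrix were paired with 0, so would be all elementary matrices in the last column
    above the diagonal, against [column_false]. For t = 0 the hypothesis of that lemma is empty. *)
Lemma corner_pair : (0 < t)%N /\ exists2 c, c != 0 & pr unit01 (c *: delta_mx ord0 ord_max).
Proof.
have t0 : (0 < t)%N.
  rewrite lt0n; apply/negP => /eqP e; by apply: column_false => j; rewrite [X in (_ < X)%N]e.
split=> //; have [_ fb] := fV.
have [r hr] := fb _ (strict_delta (i := ord0) (j := ord_max) t0).
have [r0|r0] := eqVneq r 0; last first.
  exists r^-1; first by rewrite invr_eq0.
  by have := diag_pairZ r^-1 hr; rewrite scalerA mulVf // scale1r.
exfalso; apply: column_false => j jt; exists (delta_mx j ord_max).
  have [->|j0] := eqVneq j ord0; first by rewrite r0 scale0r in hr.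
  apply: strict_pair0; first exact: strict_delta.
  by rewrite mxE eq_sym (negPf j0).
by move=> i; rewrite mxE eqxx andbT.
Qed.

Lemma nil_pair0_strict B : pr 0 B -> nil_mx iota B -> strict_upper B.
Proof.
move=> hB nB; have [fa _] := fV.
have tri (i j : 'I_t.+1) : (j < i)%N -> B i j = 0.
  by have := fa _ hB; rewrite block_mxKul block_mxKdr mul0mx; apply.
move=> i j; rewrite leq_eqVlt => /orP[/eqP ij|]; last exact: tri.
have -> : j = i by apply: val_inj.
apply/eqP; rewrite -(fmorph_eq0 iota); apply/eqP; apply: nB; exact: spec_diag.
Qed.

End Base.

End Planes.

(** * The possible quotients by an invariant plane *)

Section PlaneClassification.
Variables (K : fieldType) (L : closedFieldType) (iota : {rmorphism K -> L}).
Hypotheses (c2 : 2%:R != 0 :> K) (c3 : 3%:R != 0 :> K).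

Definition diag2 m n (P : 'M[K]_m) (Q : 'M[K]_n) : 'M[K]_(m + n) := block_mx P 0 0 Q.

Lemma unit_diag2 m n (P : 'M[K]_m) (Q : 'M[K]_n) : P \in unitmx -> Q \in unitmx ->
  diag2 P Q \in unitmx.
Proof. by rewrite !unitmxE /diag2 det_ublock unitrM => -> ->. Qed.

Lemma inv_diag2 m n (P : 'M[K]_m) (Q : 'M[K]_n) : P \in unitmx -> Q \in unitmx ->
  invmx (diag2 P Q) = diag2 (invmx P) (invmx Q).
Proof.
move=> hP hQ; rewrite -[RHS](mulKmx (unit_diag2 hP hQ)) /diag2 mulmx_block.
by rewrite !mulmx0 !mul0mx !addr0 !add0r !mulmxV // -scalar_mx_block mulmx1.
Qed.

Lemma conj_diag2 m n (P : 'M[K]_m) (Q : 'M[K]_n) A C D B :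
  P \in unitmx -> Q \in unitmx ->
  conj_mx (diag2 P Q) (block_mx A C D B) =
  block_mx (conj_mx P A) (P *m C *m invmx Q) (Q *m D *m invmx P) (conj_mx Q B).
Proof.
move=> hP hQ; rewrite /conj_mx inv_diag2 // /diag2 !mulmx_block.
by rewrite !mulmx0 !mul0mx !addr0 !add0r.
Qed.

Lemma mul_diag2 m n (P P' : 'M[K]_m) (Q Q' : 'M[K]_n) :
  diag2 P Q *m diag2 P' Q' = diag2 (P *m P') (Q *m Q').
Proof. by rewrite /diag2 mulmx_block !mulmx0 !mul0mx !addr0 !add0r. Qed.

Lemma conj_mx0 n (P : 'M[K]_n) : conj_mx P 0 = 0.
Proof. by rewrite /conj_mx mulmx0 mul0mx. Qed.

Lemma diag_pair_conj s (V : {vspace 'M[K]_(2 + s)}) P Q A B :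
  P \in unitmx -> Q \in unitmx ->
  diag_pair (conj_vs (diag2 P Q) V) A B =
  diag_pair V (conj_mx (invmx P) A) (conj_mx (invmx Q) B).
Proof.
move=> hP hQ; rewrite /diag_pair mem_conj_vs ?unit_diag2 // inv_diag2 //.
by rewrite conj_diag2 ?unitmx_inv // !mulmx0 !mul0mx.
Qed.

Lemma transitive_plane_conj s (V : {vspace 'M[K]_(2 + s)}) P Q :
  P \in unitmx -> Q \in unitmx -> transitive_plane V ->
  transitive_plane (conj_vs (diag2 P Q) V).
Proof.
move=> hP hQ [h1 h2 h3]; have hD := unit_diag2 hP hQ; split.
- move=> M; rewrite mem_conj_vs // => /h1 e.
  rewrite -(conj_mxVK M hD); move: e; set M' := conj_mx _ M => e.
  by rewrite -[M']submxK e conj_diag2 // block_mxKdl mulmx0 mul0mx.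
- move=> C; rewrite mem_conj_vs // inv_diag2 // conj_diag2 ?unitmx_inv //.
  by rewrite !conj_mx0 mulmx0 mul0mx; apply: h2.
move=> z z0 v; have z1 : invmx P *m z != 0.
  by apply: contraNneq z0 => e; rewrite -[z](mulKVmx hP) e mulmx0.
have [M hM e] := h3 _ z1 (invmx P *m v).
exists (conj_mx (diag2 P Q) M); first exact: memv_conj.
rewrite -[M]submxK conj_diag2 // block_mxKul /conj_mx -!mulmxA e mulKVmx //.
Qed.

Definition plane_flags s (V : {vspace 'M[K]_(2 + s)}) :=
  forall z : 'cV[K]_2, z != 0 -> exists P Q, [/\ P \in unitmx, Q \in unitmx,
    P *m z = delta_mx 0 0 & plane_flag (conj_vs (diag2 P Q) V)].

Lemma plane_flags_conj s (V : {vspace 'M[K]_(2 + s)}) P Q :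
  P \in unitmx -> Q \in unitmx -> plane_flags V -> plane_flags (conj_vs (diag2 P Q) V).
Proof.
move=> hP hQ fV z z0; have z1 : invmx P *m z != 0.
  by apply: contraNneq z0 => e; rewrite -[z](mulKVmx hP) e mulmx0.
have [P' [Q' [hP' hQ' e hf]]] := fV _ z1.
exists (P' *m invmx P), (Q' *m invmx Q); split; rewrite ?unitmx_mul ?hP' ?hQ' ?unitmx_inv //.
  by rewrite -mulmxA.
rewrite -conj_vs_mul ?unit_diag2 ?unitmx_mul ?hP' ?hQ' ?unitmx_inv //.
by rewrite mul_diag2 !mulmxKV.
Qed.

Lemma two_spec_conj n P (V : {vspace 'M[K]_n}) : P \in unitmx ->
  two_spec iota V -> two_spec iota (conj_vs P V).
Proof.
move=> hP h2 M; rewrite mem_conj_vs // => /h2 h a b c.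
rewrite -!/(spec iota _ _) -!(@spec_conj _ _ iota _ (invmx P) M) ?unitmx_inv //; exact: h.
Qed.

Lemma unit01E : unit01 K = delta_mx 0 0 *m (delta_mx 0 1 : 'rV_2).
Proof.
rewrite mul_delta_mx; apply/matrixP => i j; rewrite !mxE; move: i j.
by apply: ord2_ind; apply: ord2_ind.
Qed.

(** The corner pair, carried back from the flag at z. For the last claim, strictly triangular
    matrices with zero corner are paired with 0, hence are strictly triangular in every flag; for t
    > 1 their common kernel is the first basis line, so every flag of the quotient starts with
    it. *)
Lemma nil_pair t (V : {vspace 'M[K]_(2 + t.+1)}) z :
  transitive_plane V -> two_spec iota V -> plane_flags V -> z != 0 ->
  exists (r : 'rV[K]_2) B, [/\ r != 0, r *m z = 0, diag_pair V (z *m r) B, \tr B = 0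
    & plane_flag V -> (1 < t)%N -> col ord0 B = 0].
Proof.
move=> pV h2 fV z0; have [P [Q [hP hQ Pz hf]]] := fV z z0.
have hD := unit_diag2 hP hQ.
have pV' := transitive_plane_conj hP hQ pV.
have h2' := two_spec_conj hD h2.
have [t0 [c c0 hc]] := corner_pair c2 c3 pV' h2' hf.
exists (delta_mx 0 1 *m P), (conj_mx (invmx Q) (c *: delta_mx ord0 ord_max)); split.
- apply: contraTneq (isT : true) => /(congr1 (mulmx^~ (invmx P))).
  rewrite mulmxK // mul0mx => /matrixP/(_ 0 1)/eqP.
  by rewrite !mxE !eqxx oner_eq0.
- by rewrite -mulmxA Pz mul_delta_mx_0.
- move: hc; rewrite diag_pair_conj // unit01E /conj_mx !invmxK.
  by rewrite -Pz mulmxA mulKmx // -!mulmxA.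
- rewrite /conj_mx invmxK mxtrace_mulC mulmxA mulmxV // mul1mx.
  rewrite linearZ /= /mxtrace big1 ?mulr0 // => i _; rewrite mxE.
  case: eqP => // ->; case: eqP => // /(congr1 val) /= e.
  by move: t0; rewrite -e.
move=> fV0 t1.
(* the first vector of the flag of the quotient does not depend on z *)
pose g : 'cV[K]_t.+1 := invmx Q *m delta_mx ord0 0.
have killed N : strict_upper N -> N ord0 ord_max = 0 -> N *m g = 0.
  move=> sN N0; have h := strict_pair0 c2 c3 pV h2 fV0 sN N0.
  have h' : diag_pair (conj_vs (diag2 P Q) V) 0 (conj_mx Q N).
    by rewrite diag_pair_conj // conj_mx0 conj_mxK.
  have sN' := nil_pair0_strict (iota := iota) hf h'.
  have {}sN' : strict_upper (conj_mx Q N).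
    apply: sN' => a; rewrite spec_conj // => ha.
    have [i ->] : exists i, a = iota (N i i).
      by apply: spec_tri ha => i j ij; rewrite sN // ltnW.
    by rewrite sN ?rmorph0.
  have e : conj_mx Q N *m delta_mx ord0 0 = 0 :> 'cV_t.+1.
    by rewrite -colE; apply/matrixP => i j; rewrite mxE sN' // mxE.
  have e1 : Q *m (N *m g) = 0 by rewrite /g !mulmxA.
  by rewrite -[LHS](mulKmx hQ) e1 mulmx0.
have g_eq b : b != ord0 -> g b 0 = 0.
  move=> b0; have [bm|bm] := eqVneq b ord_max.
    have i1 : (1 < t.+1)%N by rewrite ltnS.
    have := killed (delta_mx (Ordinal i1) ord_max) (strict_delta K (i := Ordinal i1) (j := ord_max) t1).
    rewrite mxE /= => /(_ erefl) /matrixP/(_ (Ordinal i1) 0); rewrite bm [LHS]mxE [RHS]mxE.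
    rewrite (bigD1 ord_max) //= mxE !eqxx mul1r big1 ?addr0 // => k km.
    by rewrite mxE (negPf km) andbF mul0r.
  have b1 : (0 < b)%N by rewrite lt0n; apply: contra b0 => /eqP e; apply/eqP/val_inj.
  have := killed (delta_mx ord0 b) (strict_delta K (i := ord0) b1).
  rewrite mxE eq_sym (negPf bm) andbF => /(_ erefl) /matrixP/(_ ord0 0); rewrite [LHS]mxE [RHS]mxE.
  rewrite (bigD1 b) //= mxE !eqxx mul1r big1 ?addr0 // => k kb.
  by rewrite mxE (negPf kb) andbF mul0r.
have gE : g = g ord0 0 *: delta_mx ord0 0.
  apply/matrixP => i j; rewrite ord1 [RHS]mxE [delta_mx _ _ _ _]mxE eqxx andbT.
  by have [->|i0] := eqVneq i ord0; rewrite ?mulr1 // mulr0 g_eq.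
have g0 : g ord0 0 != 0.
  apply/eqP => e; have : g = 0 by rewrite gE e scale0r.
  move/(congr1 (mulmx Q)); rewrite /g mulKVmx // mulmx0 => /matrixP/(_ ord0 0)/eqP.
  by rewrite !mxE !eqxx oner_eq0.
have Qe : Q *m delta_mx ord0 0 = (g ord0 0)^-1 *: delta_mx ord0 0 :> 'cV_t.+1.
  apply: (scalerI g0); rewrite scalerA divff // scale1r scalemxAr -gE /g mulKVmx //.
rewrite colE /conj_mx invmxK -!mulmxA Qe -scalemxAr -scalemxAl mul_delta_mx_0 ?scaler0 ?mulmx0 //.
by apply/eqP => /(congr1 val) /= e; move: t0; rewrite e.
Qed.

(** Three rank one nilpotents with distinct kernels span the traceless matrices, and the identity
    completes them. Their partners have trace 0, so the trace of [B] comes from the identity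
    alone. *)
Lemma traceless_pairs t (V : {vspace 'M[K]_(2 + t.+1)}) :
  transitive_plane V -> two_spec iota V -> 1%:M \in V -> plane_flags V ->
  forall A, exists B, [/\ diag_pair V A B, \tr B = \tr A / 2%:R *+ t.+1
    & plane_flag V -> (1 < t)%N -> exists l, col ord0 B = l *: delta_mx ord0 0].
Proof.
move=> pV h2 hI fV A.
have nz (z : 'cV[K]_2) i : z i 0 = 1 -> z != 0.
  by move=> e; apply: contraTneq (oner_neq0 K) => z0; rewrite -e z0 mxE eqxx.
pose z1 : 'cV[K]_2 := delta_mx 0 0; pose z2 : 'cV[K]_2 := delta_mx 1 0.
pose z3 : 'cV[K]_2 := z1 + z2.
have [r1 [B1 [r10 rz1 h1 t1 k1]]] := nil_pair pV h2 fV (nz z1 0 (ltac:(by rewrite mxE))).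
have [r2 [B2 [r20 rz2 h3 t2 k2]]] := nil_pair pV h2 fV (nz z2 1 (ltac:(by rewrite mxE))).
have [r3 [B3 [r30 rz3 h4 t3 k3]]] := nil_pair pV h2 fV (nz z3 0 (ltac:(by rewrite !mxE addr0))).
have rE (r : 'rV[K]_2) (z : 'cV[K]_2) : r *m z = 0 -> r 0 0 * z 0 0 + r 0 1 * z 1 0 = 0.
  by move/matrixP/(_ 0 0); rewrite !mxE sum2.
have rN (r : 'rV[K]_2) : r != 0 -> r 0 0 = 0 -> r 0 1 != 0.
  move=> r0 e0; apply: contraNneq r0 => e1; apply/eqP/matrixP => i j; rewrite ord1 mxE.
  by move: j; apply: ord2_ind.
have r1E : r1 0 0 = 0 by have := rE _ _ rz1; rewrite !mxE /= mulr1 mulr0 addr0.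
have r2E : r2 0 1 = 0 by have := rE _ _ rz2; rewrite !mxE /= mulr1 mulr0 add0r.
have r3E : r3 0 0 = - r3 0 1.
  by have := rE _ _ rz3; rewrite !mxE /= addr0 add0r !mulr1 => /eqP; rewrite addr_eq0 => /eqP.
have n1 : r1 0 1 != 0 by apply: rN.
have n2 : r2 0 0 != 0.
  apply: contraNneq r20 => e1; apply/eqP/matrixP => i j; rewrite ord1 mxE.
  by move: j; apply: ord2_ind.
have n3 : r3 0 1 != 0.
  apply: contraNneq r30 => e1; apply/eqP/matrixP => i j; rewrite ord1 mxE.
  by move: j; apply: ord2_ind; rewrite ?r3E ?e1 ?oppr0.
(* The third nilpotent carries the diagonal of the traceless part of [A]; the other two correct the
   off-diagonal entries. *)
pose d := (A 0 0 - A 1 1) / 2%:R; pose a := \tr A / 2%:R.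
pose b3 := - d / r3 0 1; pose b1 := (A 0 1 + d) / r1 0 1; pose b2 := (A 1 0 - d) / r2 0 0.
have hI' : diag_pair V 1%:M 1%:M by rewrite /diag_pair -scalar_mx_block.
exists (a *: 1%:M + (b1 *: B1 + (b2 *: B2 + b3 *: B3))); split.
- have -> : A = a *: 1%:M + (b1 *: (z1 *m r1) + (b2 *: (z2 *m r2) + b3 *: (z3 *m r3))).
    apply: mx2P; rewrite !mxE ?big_ord1 !mxE /= ?r1E ?r2E ?r3E /b1 /b2 /b3 /d /a tr2E;
    by field; rewrite ?n1 ?n2 ?n3 ?c2.
  by do 3!apply: diag_pair_lin => //; apply: diag_pairZ.
- by rewrite !linearD !linearZ /= t1 t2 t3 !mulr0 !addr0 mxtrace1 mulr_natr.
move=> f0 ht; exists a; rewrite !linearD !linearZ /= k1 // k2 // k3 // !scaler0 !addr0.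
by rewrite colE mul1mx.
Qed.

(** Two partners of the same [A] differ by a triangular matrix. For t > 1 every [B] thus has its
    first column on the first basis line, and its first diagonal entry would be a linear
    eigenvalue. *)
Lemma plane_size t (V : {vspace 'M[K]_(2 + t.+1)}) :
  transitive_plane V -> two_spec iota V -> 1%:M \in V -> plane_flags V -> t = 1%N.
Proof.
move=> pV h2 hI fV.
have e0 : (delta_mx 0 0 : 'cV[K]_2) != 0.
  by apply: contraTneq (isT : true) => /matrixP/(_ 0 0)/eqP; rewrite !mxE !eqxx oner_eq0.
have [P [Q [hP hQ _ hf]]] := fV _ e0.
have hD := unit_diag2 hP hQ.
have hI' : 1%:M \in conj_vs (diag2 P Q) V.
  by rewrite mem_conj_vs // conj_mx_scalar // unitmx_inv.
have {}fV := plane_flags_conj hP hQ fV.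
have {}pV := transitive_plane_conj hP hQ pV.
have {}h2 := two_spec_conj hD h2.
move: (conj_vs _ V) hf hI' fV pV h2 => {hI}W hf hI fV pV h2.
have [t0 _] := corner_pair c2 c3 pV h2 hf.
apply/eqP; rewrite eqn_leq t0 andbT leqNgt; apply/negP => t1.
apply: (@eigen_form_false _ _ iota c2 c3 _ W (fun M => drsubmx M ord0 ord0)) => //.
  by move=> a u v; rewrite !mxE.
move=> M /(mem_plane M pV)[_ hM]; exists (drsubmx M) => //.
have [B [hB _ /(_ hf t1)[l el]]] := traceless_pairs pV h2 hI fV (ulsubmx M).
have hZ := diag_pair_lin (-1) hB hM; rewrite !scaleN1r addNr in hZ.
have [fa _] := hf.
have tri (i j : 'I_t.+1) : (j < i)%N -> (- B + drsubmx M) i j = 0.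
  by have := fa _ hZ; rewrite block_mxKul block_mxKdr mul0mx; apply.
apply/det0_kernel; exists (delta_mx ord0 0).
  by apply: contraTneq (isT : true) => /matrixP/(_ ord0 0)/eqP; rewrite !mxE !eqxx oner_eq0.
rewrite mulmxBl mul_scalar_mx -colE; apply/matrixP => i j; rewrite ord1 !mxE eqxx andbT.
have [->|i0] := eqVneq i ord0; first by rewrite mulr1 subrr.
rewrite mulr0 subr0; have := tri i ord0; rewrite [(- B + _) _ _]mxE [(- B) _ _]mxE.
have -> : B i ord0 = 0.
  by move/matrixP/(_ i 0): el; rewrite !mxE (negPf i0) mulr0.
by rewrite oppr0 add0r !mxE; apply; rewrite lt0n; apply: contra i0 => /eqP e; apply/eqP/val_inj.
Qed.

(** [7 + e] is C(4, 2) + 1 + e. The map A -> B preserves the trace by [traceless_pairs]. If [A] is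
    traceless with eigenvalues a, -a, a nonzero, those of [B] are opposite too and lie among them,
    so the determinants agree; singular traceless [A] are reached along a line, all others by adding
    scalars. *)
Lemma plane_classification (e : bool) (V : {vspace 'M[K]_(2 + 2)}) :
  transitive_plane V -> two_spec iota V -> 1%:M \in V -> plane_flags V ->
  \dim V = (7 + e)%N ->
  e /\ exists2 Q : 'M[K]_2, Q \in unitmx &
   (forall M, M \in V <-> exists A C, M = block_mx A C 0 (conj_mx Q A)) \/
   (forall M, M \in V <-> exists A C, M = block_mx A C 0 (conj_mx Q A^T)).
Proof.
move=> pV h2 hI fV dV.
have pairs A : exists B, diag_pair V A B /\ \tr B = \tr A.
  have [B [hB tB _]] := traceless_pairs pV h2 hI fV A.
  by exists B; split=> //; rewrite tB -mulr_natr divfK.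
(* dimension count: V -> M_2(K) is onto, with kernel containing all C *)
pose u (M : 'M[K]_(2 + 2)) := ulsubmx M.
have lu : linear u by move=> a M N; apply/matrixP => i j; rewrite !mxE.
have [G hG] := image_ex V lu; have [Z hZ] := kernel_ex V lu.
have dG : \dim G = 4%N.
  have -> : G = fullv.
    apply/vspaceP => A; rewrite memvf; apply/hG; have [B [hB _]] := pairs A.
    by exists (block_mx A 0 0 B); rewrite // /u block_mxKul.
  by rewrite dimvf dim_matrix.
have dVZ := dim_image_kernel lu hZ hG.
pose h (C : 'M[K]_2) : 'M[K]_(2 + 2) := block_mx 0 C 0 0.
have lh : linear h.
  by move=> a M N; rewrite /h scale_block_mx add_block_mx !scaler0 !addr0.
have hinj C : C \in (fullv : {vspace 'M[K]_2}) -> h C = 0 -> C = 0.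
  move=> _ /(congr1 (@ursubmx _ 2 2 2 2)); rewrite block_mxKur => ->.
  by apply/matrixP => i j; rewrite !mxE.
have hin C : C \in (fullv : {vspace 'M[K]_2}) -> h C \in Z.
  by move=> _; apply/hZ; have [_ hC _] := pV; split; [exact: hC | rewrite /u block_mxKul].
have d4 : \dim (fullv : {vspace 'M[K]_2}) = 4%N by rewrite dimvf dim_matrix.
have dZ : (4 <= \dim Z)%N by rewrite -d4; apply: (dim_inj_leq lh).
have ee : e.
  case: (e) dV => // dV; have aux a b c : a = (b + c)%N -> a = 7%N -> c = 4%N -> (4 <= b)%N -> False.
    by lia.
  by have := aux _ _ _ dVZ dV dG dZ.
split=> //.
have dZ4 : (\dim Z <= \dim (fullv : {vspace 'M[K]_2}))%N.
  rewrite d4; have aux a b c : a = (b + c)%N -> a = 8%N -> c = 4%N -> (b <= 4)%N by lia.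
  by apply: aux dVZ _ dG; rewrite dV ee.
have pair0 B : diag_pair V 0 B -> B = 0.
  move=> hB; have : block_mx 0 0 0 B \in Z by apply/hZ; rewrite /u block_mxKul.
  case/(dim_inj_onto lh hinj hin dZ4) => C _ /(congr1 (@drsubmx _ 2 2 2 2)).
  by rewrite /h !block_mxKdr.
have pair_uniq A B B' : diag_pair V A B -> diag_pair V A B' -> B = B'.
  move=> hB hB'; have := diag_pair_lin (-1) hB' hB; rewrite !scaleN1r addNr => /pair0.
  by rewrite addrC => /eqP; rewrite subr_eq0 => /eqP.
have [B00 [h00 _]] := pairs (mx2 1 0 0 0); have [B01 [h01 _]] := pairs (mx2 0 1 0 0).
have [B10 [h10 _]] := pairs (mx2 0 0 1 0); have [B11 [h11 _]] := pairs (mx2 0 0 0 1).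
pose f (A : 'M[K]_2) : 'M[K]_2 :=
  A 0 0 *: B00 + (A 0 1 *: B01 + (A 1 0 *: B10 + A 1 1 *: B11)).
have lf : linear f.
  by move=> a A B; apply/matrixP => i j; rewrite /f !mxE; ring.
have hf A : diag_pair V A (f A).
  have -> : diag_pair V A (f A) = diag_pair V (A 0 0 *: mx2 1 0 0 0 + (A 0 1 *: mx2 0 1 0 0
      + (A 1 0 *: mx2 0 0 1 0 + A 1 1 *: mx2 0 0 0 1))) (f A).
    by congr (diag_pair V _ _); apply: mx2P; rewrite !mxE /=; ring.
  by do 3!apply: diag_pair_lin => //; apply: diag_pairZ.
have tf A : \tr (f A) = \tr A.
  by have [B [hB <-]] := pairs A; rewrite (pair_uniq _ _ _ hB (hf A)).
have f1 : f 1%:M = 1%:M.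
  by apply: (pair_uniq 1%:M); rewrite ?hf // /diag_pair -scalar_mx_block.
have n4 : 4%:R != 0 :> K by rewrite (natrM _ 2 2) mulf_neq0.
have d1 A : \tr A = 0 -> \det A != 0 -> \det (f A) = \det A.
  move=> tA dA; have [a [b [ha hb tab dab]]] := spec2 iota A.
  have [c [d [hc hd tcd dcd]]] := spec2 iota (f A).
  rewrite tf tA rmorph0 in tcd; rewrite tA rmorph0 in tab.
  have eb : b = - a by apply/eqP; rewrite -addr_eq0 addrC -tab.
  have ed : d = - c by apply/eqP; rewrite -addr_eq0 addrC -tcd.
  have a0 : a != 0.
    by apply: contraNneq dA => e0; rewrite -(fmorph_eq0 iota) dab e0 mul0r.
  have ab : a != b.
    rewrite eb -subr_eq0 opprK -mulr2n -mulr_natl mulf_neq0 //.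
    by rewrite -(rmorph_nat iota) fmorph_eq0.
  have sp x : spec iota A x || spec iota (f A) x ->
      eigenvalue (map_mx iota (block_mx A 0 0 (f A))) x.
    by move=> hx; rewrite -/(spec iota _ x) spec_ublock.
  have := h2 _ (hf A) a b c; rewrite !sp ?ha ?hb ?hc ?orbT // => /(_ isT isT isT).
  move=> hab; apply: (fmorph_inj iota); rewrite dab dcd eb ed.
  case: hab => [e0|[<-|e0]] //; first by rewrite e0 eqxx in ab.
  by rewrite -e0 eb opprK mulrC.
have fD A B t : f (A + t *: B) = f A + t *: f B by rewrite addrC lf addrC.
have d0 A : \tr A = 0 -> \det (f A) = \det A.
  move=> tA; apply/eqP; rewrite -subr_eq0; apply/eqP.
  (* A traceless direction with nonzero determinant: along A + tH the equality is known except where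
     det (A + tH) = 0. *)
  pose H := mx2 1 0 0 (-1) : 'M[K]_2.
  have tH : \tr H = 0 by rewrite tr2E !mx2E subrr.
  have dH : \det H = -1 by rewrite det2E !mx2E; ring.
  pose beta (X Y : 'M[K]_2) := X 0 0 * Y 1 1 + X 1 1 * Y 0 0 - X 0 1 * Y 1 0 - X 1 0 * Y 0 1.
  apply: (@quadratic_alternative _ c2 c3 _ (beta (f A) (f H) - beta A H)
     (\det (f H) - \det H) (\det A) (beta A H) (\det H)).
    by rewrite dH oppr_eq0 oner_eq0.
  move=> t; have tt : \tr (A + t *: H) = 0 by rewrite linearD linearZ /= tA tH mulr0 addr0.
  have [e0|e0] := eqVneq (\det (A + t *: H)) 0.
    by right; rewrite -e0 detD2.
  left; have := d1 _ tt e0; rewrite fD !detD2 -!/(beta _ _) => /eqP.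
  rewrite -subr_eq0 => /eqP e1; rewrite -[RHS]e1; ring.
have df A : \det (f A) = \det A.
  pose a := \tr A / 2%:R; pose A0 := A - a%:M.
  have tA0 : \tr A0 = 0.
    by rewrite linearB /= mxtrace_scalar /a -[(_ / _) *+ 2]mulr_natr divfK // subrr.
  have eA : A = A0 + a *: 1%:M by rewrite scalemx1 subrK.
  have dadd (X : 'M[K]_2) : \det (X + a *: 1%:M) = \det X + a * \tr X + a ^+ 2.
    by rewrite detD2 !mxE tr2E /= !(mulr1n, mulr0n) det1; ring.
  by rewrite eA fD f1 !dadd tf tA0 d0.
have [Q hQ hfQ] := det_preserver lf f1 df.
have memV M : M \in V <-> exists A C, M = block_mx A C 0 (f A).
  split=> [/(mem_plane M pV)[e0 hM]|[A [C ->]]].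
    exists (ulsubmx M), (ursubmx M).
    by rewrite -(pair_uniq _ _ _ hM (hf _)) -{1}[M]submxK e0.
  by apply/(mem_plane _ pV); rewrite block_mxKul block_mxKdl block_mxKdr; split.
exists Q => //; case: hfQ => hfQ; [left | right] => M; split.
- by case/memV => A [C ->]; exists A, C; rewrite hfQ.
- by case=> A [C ->]; apply/memV; exists A, C; rewrite hfQ.
- by case/memV => A [C ->]; exists A, C; rewrite hfQ.
- by case=> A [C ->]; apply/memV; exists A, C; rewrite hfQ.
Qed.

End PlaneClassification.

(** * Orbits of least dimension *)

Section MinimalOrbit.
Variables (K : fieldType) (L : closedFieldType) (iota : {rmorphism K -> L}).
Hypotheses (c2 : 2%:R != 0 :> K) (c3 : 3%:R != 0 :> K).

Definition is_orbit n (V : {vspace 'M[K]_n}) (y : 'cV[K]_n) (S : {vspace 'cV[K]_n}) :=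
  forall w, w \in S <-> exists2 M, M \in V & M *m y = w.

Lemma orbit_ex n (V : {vspace 'M[K]_n}) y : exists S, is_orbit V y S.
Proof. by apply: (image_ex V) => a M N; rewrite mulmxDl -scalemxAl. Qed.

Definition in_flag n (k : nat) (v : 'cV[K]_n) := forall i : 'I_n, (k < i)%N -> v i 0 = 0.

Lemma flag_space n k : exists F : {vspace 'cV[K]_n}, forall v, v \in F <-> in_flag k v.
Proof.
apply: subspace_ex => [i _|a u v hu hv i ki]; first by rewrite mxE.
by rewrite !mxE hu // hv // mulr0 addr0.
Qed.

Lemma flag_dim_inj n (k l : 'I_n) (F G : {vspace 'cV[K]_n}) :
  (forall v, v \in F <-> in_flag k v) -> (forall v, v \in G <-> in_flag l v) ->
  \dim F = \dim G -> k = l.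
Proof.
suff main (k' l' : 'I_n) (F' G' : {vspace 'cV[K]_n}) :
    (forall v, v \in F' <-> in_flag k' v) -> (forall v, v \in G' <-> in_flag l' v) ->
    \dim F' = \dim G' -> (l' <= k')%N.
  move=> hF hG e; apply: val_inj; apply/eqP; rewrite eqn_leq.
  by rewrite (main l k G F) // (main k l F G).
move=> hF hG e; rewrite leqNgt; apply/negP => kl.
have sFG : (F' <= G')%VS.
  by apply/subvP => v /hF hv; apply/hG => i li; apply: hv; apply: ltn_trans li.
have /eqP eFG : F' == G' by rewrite eqEdim sFG e leqnn.
have : delta_mx l' 0 \in F'.
  rewrite eFG; apply/hG => i li; rewrite mxE; case: eqP li => // ->; by rewrite ltnn.
by move/hF/(_ l' kl)/eqP; rewrite mxE !eqxx oner_eq0.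
Qed.

(* Holds for k + 1 the least dimension of an orbit V y, in coordinates adapted to it. *)
Definition minimal_at m (V : {vspace 'M[K]_(1 + m)}) (k : nat) :=
  (forall M (i j : 'I_(1 + m)), M \in V -> (k < i)%N -> (j <= k)%N -> M i j = 0) /\
  (forall z, z != 0 -> in_flag k z -> forall v, in_flag k v ->
     exists2 M, M \in V & M *m z = v).

Definition nontrivial_flags (e : bool) m (V : {vspace 'M[K]_(1 + m)}) :=
  forall y, y != 0 -> exists P I, [/\ P \in unitmx, P *m y = vec0 K m,
        (I != set0) = e & flagged (conj_vs P V) I].

Lemma in_flag_mul n (k : nat) (M : 'M[K]_n) (v : 'cV[K]_n) :
  (forall i j : 'I_n, (k < i)%N -> (j <= k)%N -> M i j = 0) ->
  in_flag k v -> in_flag k (M *m v).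
Proof.
move=> hM hv i ki; rewrite mxE big1 // => j _.
by have [jk|kj] := leqP j k; [rewrite hM ?mul0r | rewrite hv ?mulr0].
Qed.

Lemma saturated_conj n P (V : {vspace 'M[K]_n}) : P \in unitmx ->
  saturated V -> saturated (conj_vs P V).
Proof.
move=> hP sV y v y0 hv.
have y1 : invmx P *m y != 0.
  by apply: contraNneq y0 => e; rewrite -[y](mulKVmx hP) e mulmx0.
rewrite mem_conj_vs // /conj_mx invmxK !mulmxA -mulmxA; apply: sV => // M hM.
have := hv _ (memv_conj hP hM); rewrite /conj_mx !mulmxA //.
Qed.

Lemma nontrivial_flags_conj e m P (V : {vspace 'M[K]_(1 + m)}) : P \in unitmx ->
  nontrivial_flags e V -> nontrivial_flags e (conj_vs P V).
Proof.
move=> hP fV y y0; have y1 : invmx P *m y != 0.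
  by apply: contraNneq y0 => e1; rewrite -[y](mulKVmx hP) e1 mulmx0.
have [Q [I [hQ Qy eI hf]]] := fV _ y1.
exists (Q *m invmx P), I; split=> //; first by rewrite unitmx_mul hQ unitmx_inv.
  by rewrite -mulmxA.
by rewrite -conj_vs_mul ?unitmx_mul ?hQ ?unitmx_inv // mulmxKV.
Qed.

(** By [flag_orbit] the least orbit is an invariant coordinate space. The orbit of any other nonzero
    vector in it is contained in it and not smaller, hence equal to it. *)
Lemma minimal_orbit e m (V : {vspace 'M[K]_(1 + m)}) :
  (2 <= m)%N -> spectral iota e V -> saturated V -> nontrivial_flags e V ->
  exists P I (k : 'I_(1 + m)), [/\ P \in unitmx, (I != set0) = e,
    flagged (conj_vs P V) I & minimal_at (conj_vs P V) k].
Proof.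
move=> m2 hs sV fV.
have [d [y [S [y0 hS dS]]] dmin] : exists2 d, (exists y S, [/\ y != 0, is_orbit V y S & \dim S = d]) &
    forall d', (exists y S, [/\ y != 0, is_orbit V y S & \dim S = d']) -> (d <= d')%N.
  apply: ex_min_nat; have [S hS] := orbit_ex V (vec0 K m).
  by exists (\dim S), (vec0 K m), S; rewrite vec0_neq0.
have [P [I [hP Py eI hf]]] := fV _ y0; exists P, I.
have [hI h2 _] := spectral_conj hP hs.
have [k [hk1 hk2]] := flag_orbit c2 c3 m2 h2 hI (saturated_conj hP sV) hf.
exists k; split=> //; split=> // z z0 hz v hv.
have [F hF] := flag_space (1 + m) k.
have z1 : invmx P *m z != 0.
  by apply: contraNneq z0 => e1; rewrite -[z](mulKVmx hP) e1 mulmx0.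
have [Sz hSz] := orbit_ex V (invmx P *m z).
have dz : (d <= \dim Sz)%N by apply: dmin; exists (invmx P *m z), Sz.
have lP : linear (mulmx P : 'cV_(1 + m) -> 'cV_(1 + m)).
  by move=> a u w; rewrite mulmxDr -scalemxAr.
have iP (w : 'cV[K]_(1 + m)) : P *m w = 0 -> w = 0 by move=> e1; rewrite -[w](mulKmx hP) e1 mulmx0.
have sub w : w \in Sz -> P *m w \in F.
  case/hSz => M hM <-; apply/hF.
  have -> : P *m (M *m (invmx P *m z)) = conj_mx P M *m z by rewrite /conj_mx !mulmxA.
  by apply: in_flag_mul => // i j; apply: hk1; apply: memv_conj.
have dF : (\dim F <= d)%N.
  have lP' : linear (mulmx (invmx P) : 'cV_(1 + m) -> 'cV_(1 + m)).
    by move=> a u w; rewrite mulmxDr -scalemxAr.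
  rewrite -dS; apply: (dim_inj_leq lP') => w hw.
    by move=> e1; rewrite -[w](mulKVmx hP) e1 mulmx0.
  move/hF/hk2: hw => [M]; rewrite mem_conj_vs // => hM <-.
  apply/hS; exists (conj_mx (invmx P) M) => //.
  by rewrite /conj_mx invmxK -!mulmxA Py.
have vF : v \in F by apply/hF.
have [w /hSz[M hM ew] <-] := dim_inj_onto lP (fun w _ => @iP w) sub (leq_trans dF dz) vF.
exists (conj_mx P M); first exact: memv_conj.
by rewrite /conj_mx -!mulmxA ew.
Qed.

(** In the coordinates attached to z, Vz is again a coordinate space by [flag_orbit]. Since Vz is
    the whole minimal orbit, the dimensions agree and the change of coordinates preserves it. *)
Lemma stable_flags e m (V : {vspace 'M[K]_(1 + m)}) (k : 'I_(1 + m)) :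
  (2 <= m)%N -> spectral iota e V -> saturated V -> nontrivial_flags e V ->
  minimal_at V k -> forall z, z != 0 -> in_flag k z -> exists P I,
  [/\ P \in unitmx, P *m z = vec0 K m, flagged (conj_vs P V) I
    & forall i j : 'I_(1 + m), (k < i)%N -> (j <= k)%N -> P i j = 0].
Proof.
move=> m2 hs sV fV [hk1 hk2] z z0 hz.
have [P [I [hP Pz eI hf]]] := fV _ z0; exists P, I; split=> //.
have [hI h2 _] := spectral_conj hP hs.
have [l [hl1 hl2]] := flag_orbit c2 c3 m2 h2 hI (saturated_conj hP sV) hf.
have [F hF] := flag_space (1 + m) k; have [G hG] := flag_space (1 + m) l.
have lP : linear (mulmx P : 'cV_(1 + m) -> 'cV_(1 + m)).
  by move=> a u w; rewrite mulmxDr -scalemxAr.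
have lP' : linear (mulmx (invmx P) : 'cV_(1 + m) -> 'cV_(1 + m)).
  by move=> a u w; rewrite mulmxDr -scalemxAr.
have FG w : w \in F -> P *m w \in G.
  move/hF/(hk2 _ z0 hz) => [M hM <-]; apply/hG.
  have -> : P *m (M *m z) = conj_mx P M *m vec0 K m.
    by rewrite -Pz /conj_mx !mulmxA mulmxKV.
  apply: in_flag_mul => [i j|]; first by apply: hl1; apply: memv_conj.
  by move=> i li; rewrite mxE; case: (i =P 0) li => // ->; rewrite ltn0.
have GF w : w \in G -> invmx P *m w \in F.
  move/hG/hl2 => [M]; rewrite mem_conj_vs // => hM <-; apply/hF.
  have -> : invmx P *m (M *m vec0 K m) = conj_mx (invmx P) M *m z.
    by rewrite -Pz /conj_mx invmxK !mulmxA.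
  by apply: in_flag_mul => // i j; apply: hk1.
have ekl : k = l.
  apply: (flag_dim_inj hF hG); apply/eqP; rewrite eqn_leq.
  rewrite (dim_inj_leq lP _ FG); last by move=> w _ e1; rewrite -[w](mulKmx hP) e1 mulmx0.
  by rewrite (dim_inj_leq lP' _ GF) // => w _ e1; rewrite -[w](mulKVmx hP) e1 mulmx0.
move=> i j ki jk; have : (delta_mx j 0 : 'cV_(1 + m)) \in F.
  apply/hF => i' ki'; rewrite mxE; case: eqP ki' => // ->; by rewrite ltnNge jk.
move/FG/hG; rewrite -ekl => /(_ i ki); rewrite -colE mxE //.
Qed.

Lemma DI_restrict k s (I : {set 'I_(k + s)}) :
  exists J : {set 'I_k}, forall i j, DI K J i j = DI K I (lshift s i) (lshift s j).
Proof.
exists [set i | lshift s i \in I] => i j; rewrite !DI_diag inE.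
by rewrite (inj_eq (@lshift_inj _ _)).
Qed.

(** The splittings 1 + (k + s) and (1 + k) + s are convertible, and vectors and matrices are read in
    either. *)
Lemma vec0_cat k s : vec0 K (k + s) = col_mx (vec0 K k) 0 :> 'cV_((1 + k) + s).
Proof.
rewrite vec0_col; apply/matrixP => i j; rewrite !ord1 !mxE.
case: splitP => i' ei; case: splitP => i2 ei2; rewrite !mxE ?ord1 ?eqxx ?andbT //.
- suff -> : i2 = 0 by rewrite eqxx.
  by apply: val_inj; rewrite /= -ei2 ei ord1.
- by have := ltn_ord i'; rewrite -ei ei2 add1n addSn.
- by case: (i2 =P 0) => // e0; move: ei; rewrite ei2 e0.
Qed.

Lemma mul_vec0_cat k s (M : 'M[K]_((1 + k) + s)) :
  (M : 'M_(1 + (k + s))) *m vec0 K (k + s) =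
  col_mx (ulsubmx M *m vec0 K k) (dlsubmx M *m vec0 K k) :> 'cV_((1 + k) + s).
Proof.
transitivity (M *m col_mx (vec0 K k) 0); first by rewrite -vec0_cat.
by rewrite -{1}[M]submxK mul_block_col !mulmx0 !addr0.
Qed.

Lemma flagged_restrict k s (V : {vspace 'M[K]_(1 + (k + s))}) I (VS : {vspace 'M[K]_(1 + k)}) :
  flagged V I ->
  (forall M, M \in V -> dlsubmx (M : 'M_((1 + k) + s)) = 0) ->
  (forall A, A \in VS <-> exists2 M : 'M_((1 + k) + s), M \in V & ulsubmx M = A) ->
  exists J, flagged VS J.
Proof.
move=> [fa fb] hdl hVS; have [J hJ] := DI_restrict I; exists J.
have dr_ul (M : 'M[K]_((1 + k) + s)) i j :
    drsubmx (ulsubmx M) i j = drsubmx (M : 'M_(1 + (k + s))) (lshift s i) (lshift s j).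
  by rewrite !mxE; congr (M _ _); apply: val_inj.
have ur_ul (M : 'M[K]_((1 + k) + s)) i j :
    ursubmx (ulsubmx M) i j = ursubmx (M : 'M_(1 + (k + s))) i (lshift s j).
  by rewrite !mxE; congr (M _ _); apply: val_inj.
split.
  move=> A /hVS[M hM <-] e0.
  have M0 : (M : 'M_(1 + (k + s))) *m vec0 K (k + s) = 0.
    by rewrite mul_vec0_cat (hdl _ hM) mul0mx e0; apply: (@col_mx0 K (1 + k) s 1).
  have [b [N [sN e]]] := fa M hM M0.
  exists b, (\matrix_(i, j) N (lshift s i) (lshift s j)); split.
    by move=> i j ij; rewrite mxE sN.
  by apply/matrixP => i j; rewrite dr_ul e [LHS]mxE [RHS]mxE [(b *: DI K I) _ _]mxE [(b *: DI K J) _ _]mxE hJ [(\matrix_(_, _) _) _ _]mxE.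
move=> b N sN.
pose N' : 'M[K]_(k + s) := block_mx N 0 0 0.
have sN' : strict_upper N'.
  move=> i j ij; rewrite /N' mxE; case: splitP => i' ei; rewrite mxE; case: splitP => j' ej;
    rewrite ?mxE //.
  by apply: sN; rewrite -ei -ej.
have [R hR] := fb b N' sN'.
pose M : 'M[K]_(1 + (k + s)) := block_mx 0 R 0 (b *: DI K I + N').
exists (lsubmx R); apply/hVS; exists M => //.
have M0 : (M : 'M_(1 + (k + s))) *m vec0 K (k + s) = 0.
  by rewrite mul_block_vec0 col_mx0.
have A0 : ulsubmx (M : 'M_((1 + k) + s)) *m vec0 K k = 0.
  have := M0; rewrite mul_vec0_cat => /(congr1 (@usubmx _ (1 + k) s 1)).
  by rewrite col_mxKu linear0.
rewrite (mul_vec0_eq0 A0); congr block_mx.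
  apply/matrixP => i j; by rewrite ur_ul block_mxKur mxE.
apply/matrixP => i j; rewrite dr_ul block_mxKdr [LHS]mxE [RHS]mxE [(b *: DI K I) _ _]mxE [(b *: DI K J) _ _]mxE hJ.
by rewrite /N' block_mxEul.
Qed.

End MinimalOrbit.

(** * Least orbits of dimension at least three *)

Section LargeOrbit.
Variables (K : fieldType) (L : closedFieldType) (iota : {rmorphism K -> L}).
Hypotheses (c2 : 2%:R != 0 :> K) (c3 : 3%:R != 0 :> K).

Lemma conj_ublock m n (P : 'M[K]_m) X (R : 'M[K]_n) :
  block_mx P X 0 R \in unitmx -> [/\ P \in unitmx, R \in unitmx &
    forall A B D, exists Y, conj_mx (block_mx P X 0 R) (block_mx A B 0 D) =
      block_mx (conj_mx P A) Y 0 (conj_mx R D)].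
Proof.
set Q := block_mx P X 0 R => hQ.
have : \det P * \det R \is a GRing.unit by move: hQ; rewrite unitmxE det_ublock.
rewrite unitrM -!unitmxE => /andP[hP hR]; split=> // A B D.
pose Z := invmx Q; have eZ : Z = block_mx (invmx P) (ursubmx Z) 0 (invmx R).
  have := mulmxV hQ; rewrite -/Z -{1}[Z]submxK /Q mulmx_block !mul0mx !add0r scalar_mx_block.
  case/eq_block_mx => e1 _ e3 e4.
  have dl0 : dlsubmx Z = 0 by rewrite -[LHS](mulKmx hR) e3 mulmx0.
  have ul0 : ulsubmx Z = invmx P.
    by rewrite -[LHS](mulKmx hP) -[P *m _](addr0) -(mulmx0 _ X) -{1}dl0 e1 mulmx1.
  have dr0 : drsubmx Z = invmx R by rewrite -[LHS](mulKmx hR) e4 mulmx1.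
  by rewrite -{1}[Z]submxK dl0 ul0 dr0.
exists (ursubmx (conj_mx Q (block_mx A B 0 D))).
rewrite /conj_mx -/Z eZ /Q !mulmx_block !mulmx0 !mul0mx !addr0 !add0r.
by rewrite !mul0mx add0r block_mxKur.
Qed.

Lemma usubmx_mul_col0 m n p (M : 'M[K]_(m + n)) (z : 'M[K]_(m, p)) :
  usubmx (M *m col_mx z 0) = ulsubmx M *m z.
Proof. by rewrite -{1}[M]submxK mul_block_col !mulmx0 !addr0 col_mxKu. Qed.

Lemma dim_addv_line (vT : vectType K) (W : {vspace vT}) v : v \notin W ->
  (\dim W < \dim (W + <[v]>))%N.
Proof.
move=> hv; rewrite ltnNge; apply: contra hv => hd.
have /eqP -> : W == (W + <[v]>)%VS by rewrite eqEdim addvSl.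
by apply: (subvP (addvSr _ _)); apply: memv_line.
Qed.

(** The orbit contributes 1 + m and the flag the rest, so a transitive flagged space has the
    extremal dimension without any spectral assumption. *)
Lemma flagged_dim m (V : {vspace 'M[K]_(1 + m)}) I : transitive_vs V -> flagged V I ->
  ('C(1 + m, 2) + 1 + (I != set0) <= \dim V)%N.
Proof.
move=> tV [fa fb].
pose f (M : 'M[K]_(1 + m)) := M *m vec0 K m.
have lf : linear f by move=> a M N; rewrite /f mulmxDl -scalemxAl.
have [S hS] := image_ex V lf; have [W hW] := kernel_ex V lf.
pose g (M : 'M[K]_(1 + m)) := drsubmx M.
have lg : linear g by move=> a M N; apply/matrixP => i j; rewrite !mxE.
have [G hG] := image_ex W lg; have [U hU] := kernel_ex W lg.
have dS : \dim S = (1 + m)%N.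
  rewrite -[RHS](dim_cV K); congr (\dim _); apply/vspaceP => v; rewrite memvf; apply/hS.
  exact: tV (vec0_neq0 K m) v.
have inG b N : strict_upper N -> b *: DI K I + N \in G.
  move=> sN; have [R hR] := fb b N sN; apply/hG; exists (block_mx 0 R 0 (b *: DI K I + N) : 'M_(1 + m)); last by rewrite /g block_mxKdr.
  by apply/hW; split=> //; rewrite /f mul_block_vec0 col_mx0.
have [T [hT dT]] := strict_upper_ex K m.
have dG : ('C(m, 2) + (I != set0) <= \dim G)%N.
  rewrite -dT; have [I0|I0] := eqVneq I set0.
    rewrite addn0; apply: dimvS; apply/subvP => N /hT sN.
    by have := inG 0 N sN; rewrite scale0r add0r.
  rewrite addn1; have : DI K I \notin T.
    apply: contra_neqN I0 => /hT sD; apply/setP => i; rewrite inE; apply/negP => iI.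
    have := sD i i (leqnn i); rewrite DI_diag eqxx iI => /eqP; by rewrite oner_eq0.
  move/dim_addv_line => /leq_trans; apply; apply: dimvS; apply/subvP => M.
  case/memv_addP => N /hT sN [_ /vlineP[b ->] ->]; rewrite addrC; exact: inG.
rewrite (dim_image_kernel lf hW hS) (dim_image_kernel lg hU hG) dS binS2.
move: dG; lia.
Qed.

(** The Boolean is not inherited from the ambient space. If some flag has a nonempty [I], the
    dimension suffices for [e = true]; if none has, every singular element is strictly triangular in
    some flag, and [e = false] applies. *)
Lemma transitive_flags_false m (V : {vspace 'M[K]_(1 + m)}) : (2 <= m)%N ->
  1%:M \in V -> two_spec iota V -> transitive_vs V -> (forall e, bound iota e m) ->
  (forall z, z != 0 -> exists P I, [/\ P \in unitmx, P *m z = vec0 K m &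
    flagged (conj_vs P V) I]) -> False.
Proof.
move=> m2 h1 h2 tV hB hf.
have big z P I : z != 0 -> P \in unitmx -> P *m z = vec0 K m -> flagged (conj_vs P V) I ->
    ('C(1 + m, 2) + 1 + (I != set0) <= \dim V)%N.
  by move=> z0 hP Pz hI; have := flagged_dim (transitive_conj hP tV) hI; rewrite dim_conj_vs.
case: (classic (exists z P I, [/\ z != 0, P \in unitmx, P *m z = vec0 K m,
    flagged (conj_vs P V) I & I != set0])) => [[z [P [I [z0 hP Pz hI I0]]]]|hn].
  apply: (no_transitive c2 c3 m2 (e := true) (iota := iota) (V := V)) => //.
    by split=> // M hM d0; apply: two_spec_one d0; apply: h2.
  by have := big z P I z0 hP Pz hI; rewrite I0.
have f0 z : z != 0 -> exists P, [/\ P \in unitmx, P *m z = vec0 K m &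
    flagged (conj_vs P V) set0].
  move=> z0; have [P [I [hP Pz hI]]] := hf z z0; exists P; split=> //.
  have [<-//|I0] := eqVneq I set0; case: hn; by exists z, P, I.
apply: (no_transitive c2 c3 m2 (e := false) (iota := iota) (V := V)) => //.
  split=> // M hM /det0_kernel[z z0 Mz] a.
  have [P [hP Pz [fa _]]] := f0 z z0.
  have M0 : conj_mx P M *m vec0 K m = 0 by rewrite -Pz /conj_mx !mulmxA mulmxKV // -mulmxA Mz mulmx0.
  have [b [N [sN e]]] := fa _ (memv_conj hP hM) M0.
  have e0 : DI K set0 = 0 :> 'M_m by apply/matrixP => i j; rewrite DI_diag inE andbF mxE.
  rewrite -(spec_conj _ _ _ hP) (mul_vec0_eq0 M0) e e0 scaler0 add0r.
  by apply: strict_upper_nil; apply: strict_upper_block.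
have [P [hP Pz hI]] := f0 _ (vec0_neq0 K m).
by have := big _ P _ (vec0_neq0 K m) hP Pz hI; rewrite eqxx.
Qed.

(** The restriction of [V] to the orbit is transitive, and by [stable_flags] it has a flag at each
    nonzero vector of the orbit. *)
Lemma large_orbit_false e k s (V : {vspace 'M[K]_(1 + (k + s))}) :
  (2 <= k)%N -> spectral iota e V -> saturated V -> nontrivial_flags e V ->
  (forall e', bound iota e' k) -> ~ minimal_at V k.
Proof.
move=> kk2 hs sV fV hB hmin; have [hk1 hk2] := hmin.
have [h1 h2 _] := hs.
have lt_k : (k < 1 + (k + s))%N by lia.
have dl0 (M : 'M[K]_((1 + k) + s)) :
    (forall i j : 'I_(1 + (k + s)), (k < i)%N -> (j <= k)%N -> M i j = 0) -> dlsubmx M = 0.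
  move=> h; apply/matrixP => i j; rewrite !mxE; apply: h => /=; first by lia.
  by have := ltn_ord j; lia.
have hdl (M : 'M[K]_((1 + k) + s)) : M \in V -> M = block_mx (ulsubmx M) (ursubmx M) 0 (drsubmx M).
  move=> hM; rewrite -{1}[M]submxK dl0 // => i j; exact: hk1.
pose f (M : 'M[K]_((1 + k) + s)) := ulsubmx M.
have lf : linear f by move=> a M N; apply/matrixP => i j; rewrite !mxE.
have [VS hVS] := image_ex (V : {vspace 'M[K]_((1 + k) + s)}) lf.
have fl (z : 'cV[K]_(1 + k)) : in_flag k (col_mx z 0 : 'cV_((1 + k) + s)).
  move=> i ki; rewrite mxE; case: splitP => j ej; last by rewrite mxE.
  by have := ltn_ord j; rewrite -ej; lia.
have nz (z : 'cV[K]_(1 + k)) : z != 0 -> (col_mx z 0 : 'cV_((1 + k) + s)) != 0.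
  by apply: contra_neq => /(congr1 usubmx); rewrite col_mxKu linear0.
apply: (@transitive_flags_false k VS) => //.
- apply/hVS; exists 1%:M => //; rewrite /f (scalar_mx_block (1 + k) s) block_mxKul //.
- move=> A /hVS[M hM <-] a b c ha hb hc.
  have sub x : spec iota (f M) x -> spec iota M x.
    move=> hx; rewrite (hdl _ hM).
    have : spec iota (block_mx (ulsubmx M) (ursubmx M) 0 (drsubmx M)) x by rewrite spec_ublock hx.
    by [].
  by apply: (h2 _ hM); apply: sub.
- move=> z z0 v.
  have [M hM eM] := hk2 _ (nz z z0) (fl z) _ (fl v); exists (f M); first by apply/hVS; exists M.
  have := congr1 (@usubmx _ (1 + k) s 1) (eM : (M : 'M_((1 + k) + s)) *m col_mx z 0 = col_mx v 0).
  by rewrite usubmx_mul_col0 col_mxKu.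
move=> z z0.
have [Q [I [hQ Qz hI Qk]]] := @stable_flags _ _ _ c2 c3 e _ V (Ordinal lt_k) (leq_trans kk2 (leq_addr _ _)) hs sV fV hmin _ (nz z z0) (fl z).
pose Q' : 'M[K]_((1 + k) + s) := Q.
have eQ : Q' = block_mx (ulsubmx Q') (ursubmx Q') 0 (drsubmx Q').
  by rewrite -{1}[Q']submxK dl0 //.
have [hP hR hconj] : [/\ ulsubmx Q' \in unitmx, drsubmx Q' \in unitmx &
    forall A B D, exists Y, conj_mx Q' (block_mx A B 0 D) =
      block_mx (conj_mx (ulsubmx Q') A) Y 0 (conj_mx (drsubmx Q') D)].
  have hQ' : Q' \in unitmx by [].
  by have := @conj_ublock _ _ (ulsubmx Q') (ursubmx Q') (drsubmx Q'); rewrite -eQ; apply.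
set P := ulsubmx Q' in hP hconj.
have hul (M : 'M[K]_((1 + k) + s)) : M \in V ->
    ulsubmx (conj_mx Q' M) = conj_mx P (f M) /\ dlsubmx (conj_mx Q' M) = 0.
  move=> hM; have [Y eY] := hconj (ulsubmx M) (ursubmx M) (drsubmx M).
  by rewrite -(hdl M hM) in eY; rewrite eY block_mxKul block_mxKdl.
have back (M : 'M[K]_((1 + k) + s)) : M \in conj_vs Q V ->
    exists2 N : 'M[K]_((1 + k) + s), N \in V & M = conj_mx Q' N.
  rewrite mem_conj_vs // => hM; exists (conj_mx (invmx Q) M) => //.
  by rewrite [RHS](conj_mxVK _ hQ).
have [J hJ] : exists J, flagged (conj_vs P VS) J.
  apply: (flagged_restrict hI) => [M /back[N hN ->]|A]; first by case: (hul N hN).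
  rewrite mem_conj_vs //; split.
    move/hVS => [M hM eM]; exists (conj_mx Q' M); first exact: (memv_conj hQ hM).
    by have [-> _] := hul M hM; rewrite eM conj_mxVK.
  move=> [M /back[N hN ->] <-]; have [-> _] := hul N hN.
  by rewrite conj_mxK //; apply/hVS; exists N.
exists P, J; split=> //.
have : Q' *m col_mx z 0 = col_mx (vec0 K k) 0 by rewrite -vec0_cat -Qz.
by move/(congr1 usubmx); rewrite usubmx_mul_col0 col_mxKu.
Qed.

End LargeOrbit.

(** * Least orbits of dimension two *)

Section PlaneOrbit.
Variables (K : fieldType) (L : closedFieldType) (iota : {rmorphism K -> L}).
Hypotheses (c2 : 2%:R != 0 :> K) (c3 : 3%:R != 0 :> K).

Lemma low_block0 p s (M : 'M[K]_(p.+1 + s)) :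
  (forall i j : 'I_(p.+1 + s), (p < i)%N -> (j <= p)%N -> M i j = 0) -> dlsubmx M = 0.
Proof.
move=> h; apply/matrixP => i j; rewrite !mxE; apply: h => /=; first by rewrite leq_addr.
by rewrite -ltnS.
Qed.

(** For z in the plane, a form [c] vanishing on the plane vanishes on Vz, so saturation puts z c
    into [V]; such products span the upper right blocks. *)
Lemma minimal_plane s (V : {vspace 'M[K]_(2 + s)}) : saturated V ->
  minimal_at (V : {vspace 'M[K]_(1 + (1 + s))}) 1 -> transitive_plane V.
Proof.
move=> sV [hk1 hk2].
have hdl (M : 'M[K]_(2 + s)) : M \in V -> dlsubmx M = 0.
  by move=> hM; apply: low_block0 => i j; apply: hk1.
have fl (z : 'cV[K]_2) : in_flag 1 (col_mx z 0 : 'cV_(2 + s)).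
  move=> i ki; rewrite mxE; case: splitP => j ej; last by rewrite mxE.
  by have := ltn_ord j; rewrite -ej ltnNge ki.
have nz (z : 'cV[K]_2) : z != 0 -> (col_mx z 0 : 'cV_(2 + s)) != 0.
  by apply: contra_neq => /(congr1 usubmx); rewrite col_mxKu linear0.
split=> //; last first.
  move=> z z0 v; have [M hM eM] := hk2 _ (nz z z0) (fl z) _ (fl v); exists M => //.
  have := congr1 (@usubmx _ 2 s 1) (eM : (M : 'M_(2 + s)) *m col_mx z 0 = col_mx v 0).
  by rewrite usubmx_mul_col0 col_mxKu.
have one (z : 'cV[K]_2) (c : 'rV[K]_s) : z != 0 -> (block_mx 0 (z *m c) 0 0 : 'M_(2 + s)) \in V.
  move=> z0; have -> : block_mx 0 (z *m c) 0 0 = col_mx z 0 *m row_mx 0 c :> 'M[K]_(2 + s).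
    by rewrite mul_col_row !mulmx0 !mul0mx.
  apply: sV; first exact: nz.
  move=> M hM; rewrite -{1}[M : 'M_(2 + s)]submxK (hdl _ hM) mul_row_block !mul0mx !add0r.
  by rewrite mulmx0 mul_row_col mul0mx mulmx0 addr0.
move=> C; have -> : block_mx 0 C 0 0 = \sum_(i < 2) block_mx 0 (delta_mx i 0 *m row i C) 0 0 :> 'M[K]_(2 + s).
  rewrite big_ord_recl big_ord1 add_block_mx !addr0; congr block_mx; apply/matrixP => i j.
  have -> : lift ord0 ord0 = 1 :> 'I_2 by apply: val_inj.
  rewrite [RHS]mxE !mxE !big_ord1 !mxE /=; move: i; apply: ord2_ind => /=.
    by rewrite mul1r mul0r addr0.
  by rewrite mul1r mul0r add0r.
apply: memv_suml => i _; apply: one; apply/eqP => /matrixP/(_ i 0)/eqP.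
by rewrite !mxE !eqxx oner_eq0.
Qed.

Lemma minimal_plane_flags e s (V : {vspace 'M[K]_(2 + s)}) : (0 < s)%N ->
  spectral iota e V -> saturated V ->
  nontrivial_flags e (V : {vspace 'M[K]_(1 + (1 + s))}) ->
  minimal_at (V : {vspace 'M[K]_(1 + (1 + s))}) 1 -> plane_flags V.
Proof.
move=> s0 hs sV fV hmin z z0.
have tV := minimal_plane sV hmin; have [hdl _ _] := tV.
have fl : in_flag 1 (col_mx z 0 : 'cV_(2 + s)).
  move=> i ki; rewrite mxE; case: splitP => j ej; last by rewrite mxE.
  by have := ltn_ord j; rewrite -ej ltnNge ki.
have nz : (col_mx z 0 : 'cV_(2 + s)) != 0.
  by apply: contra_neq z0 => /(congr1 usubmx); rewrite col_mxKu linear0.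
have [Q [I [hQ Qz [fa fb] Qk]]] := @stable_flags _ _ _ c2 c3 e (1 + s) V
  (Ordinal (isT : (1 < 1 + (1 + s))%N)) s0 hs sV fV hmin _ nz fl.
pose Q' : 'M[K]_(2 + s) := Q.
have hQ' : Q' \in unitmx by [].
have eQ : Q' = block_mx (ulsubmx Q') (ursubmx Q') 0 (drsubmx Q').
  by rewrite -{1}[Q']submxK low_block0 //.
have [hP hR hconj] : [/\ ulsubmx Q' \in unitmx, drsubmx Q' \in unitmx &
    forall A B D, exists Y, conj_mx Q' (block_mx A B 0 D) =
      block_mx (conj_mx (ulsubmx Q') A) Y 0 (conj_mx (drsubmx Q') D)].
  by have := @conj_ublock _ _ _ (ulsubmx Q') (ursubmx Q') (drsubmx Q'); rewrite -eQ; apply.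
set P := ulsubmx Q' in hP hconj; set R := drsubmx Q' in hR hconj.
have tW := transitive_plane_conj hP hR tV.
have corr A D : diag_pair (conj_vs (diag2 P R) V) A D <->
    exists Y, (block_mx A Y 0 D : 'M_(2 + s)) \in conj_vs Q' V.
  rewrite diag_pair_conj //; split=> [h|[Y]].
    have [Y eY] := hconj (conj_mx (invmx P) A) 0 (conj_mx (invmx R) D).
    by exists Y; have := memv_conj hQ' h; rewrite eY !conj_mxVK.
  rewrite mem_conj_vs // => hM; set M := conj_mx _ _ in hM.
  have eM : conj_mx Q' M = block_mx A Y 0 D by rewrite conj_mxVK.
  have := hconj (ulsubmx M) (ursubmx M) (drsubmx M).
  have eM' : M = block_mx (ulsubmx M) (ursubmx M) 0 (drsubmx M).
    by rewrite -{1}[M]submxK hdl.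
  rewrite -eM' eM => -[Y' /eq_block_mx[-> _ _ ->]].
  by rewrite !conj_mxK //; case/(mem_plane _ tV): hM.
exists P, R; split=> //.
  have := Qz; rewrite (vec0_cat K 1 s) => /(congr1 (@usubmx _ 2 s 1)).
  by rewrite usubmx_mul_col0 col_mxKu.
split.
  move=> M /(mem_plane _ tW)[_ /corr[Y hY]] M0 i j ji.
  set M' := block_mx _ _ _ _ in hY.
  have M'0 : (M' : 'M_(1 + (1 + s))) *m vec0 K (1 + s) = 0.
    rewrite (@mul_vec0_cat _ 1 s M') block_mxKul block_mxKdl mul0mx M0.
    exact: (@col_mx0 K 2 s 1).
  have [b [N [sN e1]]] := fa _ hY M'0.
  have -> : drsubmx M i j = drsubmx (M' : 'M_(1 + (1 + s))) (rshift 1 i) (rshift 1 j).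
    rewrite -[drsubmx M](@block_mxKdr _ 2 s 2 s (ulsubmx M) Y 0) -/M'.
    rewrite [LHS]mxE [LHS]mxE [RHS]mxE [RHS]mxE; congr (M' _ _); exact: val_inj.
  rewrite e1 mxE [(b *: DI K I) _ _]mxE DI_diag sN /= ?leq_add2l ?(ltnW ji) // addr0.
  by rewrite -val_eqE /= eqn_add2l gtn_eqF //= mulr0.
move=> B sB.
(* Prescribing [B] bordered by zeros leaves one unknown in the plane block, the entry [X 0 0] in the
   place of E_01. *)
pose N : 'M[K]_(1 + s) := block_mx 0 0 0 B.
have sN : strict_upper N by apply: strict_upper_block.
have [X] := fb 0 N sN; rewrite scale0r add0r => hM.
set M := block_mx _ _ _ _ in hM.
exists (X 0 0); apply/corr; exists (ursubmx (M : 'M_(2 + s))).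
suff <- : (M : 'M_(2 + s)) = block_mx (X 0 0 *: unit01 K) (ursubmx (M : 'M_(2 + s))) 0 B by [].
rewrite -[LHS](@submxK _ 2 s 2 s M).
have ent0 (a b : 'I_(2 + s)) : (b = 0%N :> nat) -> M a b = 0.
  move=> b0; rewrite (_ : b = lshift (1 + s) (0 : 'I_1)); last exact: val_inj.
  by case: (splitP (a : 'I_(1 + (1 + s)))) => a' ea; rewrite mxE; case: splitP => ? _; rewrite mxE; case: splitP => //= ? _; rewrite mxE.
have ent1 (a b : 'I_(2 + s)) (a' b' : 'I_(1 + s)) :
    a = (1 + a')%N :> nat -> b = (1 + b')%N :> nat -> M a b = N a' b'.
  move=> ea eb; transitivity (M (rshift 1 a') (rshift 1 b')); last exact: block_mxEdr.
  by congr (M _ _); apply: val_inj.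
have ent2 (a b : 'I_(2 + s)) (b' : 'I_(1 + s)) :
    a = 0%N :> nat -> b = (1 + b')%N :> nat -> M a b = X 0 b'.
  move=> ea eb; transitivity (M (lshift (1 + s) 0) (rshift 1 b')); last exact: block_mxEur.
  by congr (M _ _); apply: val_inj.
congr block_mx.
- apply/matrixP => i j; rewrite [LHS]mxE [LHS]mxE [RHS]mxE.
  move: j; apply: ord2_ind.
    by rewrite ent0 //; move: i; apply: ord2_ind; rewrite mx2E mulr0.
  move: i; apply: ord2_ind; first by rewrite (ent2 _ _ 0) // mx2E mulr1.
  by rewrite (ent1 _ _ 0 0) // mx2E mulr0 sN.
- apply/matrixP => i j; rewrite [LHS]mxE [LHS]mxE [RHS]mxE.
  move: j; apply: ord2_ind; first by rewrite ent0.
  by rewrite (ent1 _ _ (rshift 1 i) (lshift s (0 : 'I_1))) // /N block_mxEdl mxE.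
apply/matrixP => i j; rewrite [LHS]mxE [LHS]mxE.
by rewrite (ent1 _ _ (rshift 1 i) (rshift 1 j)) // /N block_mxEdr.
Qed.

End PlaneOrbit.

(** * Structure of extremal spaces containing the identity *)

Section Structure.
Variables (K : fieldType) (L : closedFieldType) (iota : {rmorphism K -> L}).
Hypotheses (c2 : 2%:R != 0 :> K) (c3 : 3%:R != 0 :> K).

Definition triangular_form n (V : {vspace 'M[K]_n}) (e : bool) :=
  exists P (I : {set 'I_n}), [/\ P \in unitmx, (I != set0) = e, I != setT &
    forall M, M \in V <-> V2 I (conj_mx P M)].

(** The equation n = 2 + 2 is part of the data because the structure theorem is stated in size 1 +
    m. *)
Definition exceptional_form n (V : {vspace 'M[K]_n}) :=
  exists (h : (n = 2 + 2)%N) P, P \in unitmx /\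
  ((forall M, M \in V <-> G4 (castmx (h, h) (conj_mx P M))) \/
   (forall M, M \in V <-> G4' (castmx (h, h) (conj_mx P M)))).

Lemma triangular_form_conj n P (V : {vspace 'M[K]_n}) e : P \in unitmx ->
  triangular_form (conj_vs P V) e -> triangular_form V e.
Proof.
move=> hP [Q [I [hQ h1 h2 h]]]; exists (Q *m P), I; split=> //.
  by rewrite unitmx_mul hQ.
move=> M; rewrite conj_mx_mul //; apply: (iff_trans _ (h _)).
by rewrite mem_conj_vs // conj_mxK.
Qed.

Lemma exceptional_form_conj n P (V : {vspace 'M[K]_n}) : P \in unitmx ->
  exceptional_form (conj_vs P V) -> exceptional_form V.
Proof.
move=> hP [hn [Q [hQ h]]]; exists hn, (Q *m P); split; first by rewrite unitmx_mul hQ.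
have e M : M \in V <-> conj_mx P M \in conj_vs P V by rewrite mem_conj_vs // conj_mxK.
case: h => h; [left|right] => M; rewrite conj_mx_mul //; exact: (iff_trans (e M) (h _)).
Qed.

Lemma DI_shift m (I : {set 'I_m}) :
  DI K (@rshift 1 m @: I) = block_mx 0 0 0 (DI K I) :> 'M_(1 + m).
Proof.
have i0 (i : 'I_(1 + m)) (i' : 'I_1) : i = i' :> nat -> (i \in @rshift 1 m @: I) = false.
  by move=> ei; apply/negP => /imsetP[a _ e]; move: ei; rewrite e ord1.
apply/matrixP => i j; rewrite DI_diag [RHS]mxE.
case: (splitP i) => i' ei; rewrite [RHS]mxE; case: (splitP j) => j' ej.
- by rewrite (i0 _ _ ei) andbF mxE.
- by rewrite (i0 _ _ ei) andbF mxE.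
- by rewrite mxE; case: eqP => // e; rewrite e (i0 _ _ ej).
rewrite DI_diag; have -> : i = rshift 1 i' by apply: val_inj.
have -> : j = rshift 1 j' by apply: val_inj.
by rewrite (mem_imset _ _ (@rshift_inj _ _)) (inj_eq (@rshift_inj _ _)).
Qed.

(** The first basis vector is a common eigenvector, so subtracting [M 0 0] makes [M] kill it.
    Shifting [I] past index 0 is what makes the new set proper. *)
Lemma fixed_line_form e m (V : {vspace 'M[K]_(1 + m)}) I : 1%:M \in V -> saturated V ->
  flagged V I -> (I != set0) = e -> minimal_at V 0 -> triangular_form V e.
Proof.
move=> h1 sV [fa fb] eI [hk1 _].
exists 1%:M, (@rshift 1 m @: I); split.
- exact: unitmx1.
- by rewrite imset_eq0.
- apply: contraTneq (in_setT (0 : 'I_(1 + m))) => <-; apply/imsetP => -[a _].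
  by move/(congr1 val).
have eM0 M : M \in V -> M *m vec0 K m = M 0 0 *: vec0 K m.
  move=> hM; rewrite -colE; apply/matrixP => i j; rewrite !ord1 !mxE eqxx andbT.
  have [->|i0] := eqVneq i 0; first by rewrite mulr1.
  by rewrite mulr0 hk1 // lt0n.
have free (X : 'rV[K]_m) : block_mx (0 : 'M_1) X 0 0 \in V.
  rewrite -vec0_mul_row; apply: sV => [|M hM]; first exact: vec0_neq0.
  rewrite -mulmxA eM0 // -scalemxAr vec0_col mul_row_col mul0mx mulmx0 addr0 scaler0 //.
move=> M; have -> : conj_mx 1%:M M = M by rewrite /conj_mx invmx1 mul1mx mulmx1.
split=> [hM|[a [b [N [sN ->]]]]].
  have hM' : M - (M 0 0)%:M \in V by rewrite memvB // -scalemx1 memvZ.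
  have M'0 : (M - (M 0 0)%:M) *m vec0 K m = 0.
    by rewrite mulmxBl eM0 // mul_scalar_mx subrr.
  have [b [N [sN eN]]] := fa _ hM' M'0; set M' := M - _ in hM' M'0 eN.
  exists (M 0 0), b, (block_mx 0 (ursubmx M') 0 N); split; first exact: strict_upper_block.
  rewrite DI_shift scale_block_mx !scaler0 -addrA add_block_mx !add0r.
  by rewrite -eN -(mul_vec0_eq0 M'0) /M' addrC subrK.
have eN : N = block_mx 0 (ursubmx N) 0 (drsubmx N).
  exact: mul_vec0_eq0 (strict_upper_vec0 sN).
have [X hX] := fb b _ (strict_upper_dr sN).
rewrite eN DI_shift scale_block_mx !scaler0 -addrA add_block_mx !add0r.
rewrite memvD //; first by rewrite -scalemx1 memvZ.
have -> : block_mx 0 (ursubmx N) 0 (b *: DI K I + drsubmx N) =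
  block_mx 0 X 0 (b *: DI K I + drsubmx N) + block_mx 0 (ursubmx N - X) 0 0 :> 'M_(1 + m).
  by rewrite add_block_mx !addr0 [X + _]addrC subrK.
by rewrite memvD.
Qed.

Lemma plane_exceptional (e : bool) (V : {vspace 'M[K]_(2 + 2)}) :
  transitive_plane V -> two_spec iota V -> 1%:M \in V -> plane_flags V ->
  \dim V = (7 + e)%N -> e /\ exceptional_form V.
Proof.
move=> tV h2 h1 fV dV.
have [he [Q hQ h]] := plane_classification c2 c3 tV h2 h1 fV dV; split=> //.
have hiQ : invmx Q \in unitmx by rewrite unitmx_inv.
exists erefl, (diag2 1%:M (invmx Q)); split; first by rewrite unit_diag2 ?unitmx1.
have cj A C B : conj_mx (diag2 1%:M (invmx Q)) (block_mx A C 0 B) =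
    block_mx A (C *m Q) 0 (conj_mx (invmx Q) B).
  by rewrite conj_diag2 ?unitmx1 // invmxK mulmx0 mul0mx mul1mx /conj_mx invmx1 mul1mx mulmx1.
case: h => h; [left|right] => M; rewrite castmx_id.
  split=> [/h[A [C ->]]|[A [B eM]]]; first by exists A, (C *m Q); rewrite cj conj_mxK.
  apply/h; exists A, (B *m invmx Q).
  rewrite -[LHS](@conj_mxK _ _ (diag2 1%:M (invmx Q))) ?unit_diag2 ?unitmx1 // eM.
  rewrite inv_diag2 ?unitmx1 // invmx1 invmxK conj_diag2 ?unitmx1 //.
  by rewrite mulmx0 mul0mx mul1mx /conj_mx invmx1 mul1mx mulmx1.
split=> [/h[A [C ->]]|[A [B eM]]]; first by exists A, (C *m Q); rewrite cj conj_mxK.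
apply/h; exists A, (B *m invmx Q).
rewrite -[LHS](@conj_mxK _ _ (diag2 1%:M (invmx Q))) ?unit_diag2 ?unitmx1 // eM.
rewrite inv_diag2 ?unitmx1 // invmx1 invmxK conj_diag2 ?unitmx1 //.
by rewrite mulmx0 mul0mx mul1mx /conj_mx invmx1 mul1mx mulmx1.
Qed.

(** The cases are least orbits of dimension 1, 2 and more. All sizes up to m are assumed in [bound]
    because the last case works inside the orbit. *)
Theorem spectral_structure e m (V : {vspace 'M[K]_(1 + m)}) : (2 <= m)%N ->
  (forall e' k, (2 <= k <= m)%N -> bound iota e' k) -> spectral iota e V ->
  ('C(1 + m, 2) + 1 + e <= \dim V)%N ->
  \dim V = ('C(1 + m, 2) + 1 + e)%N /\ (triangular_form V e \/ e /\ exceptional_form V).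
Proof.
move=> m2 hB hs hd.
have hBm : bound iota e m by apply: hB; rewrite m2 leqnn.
have [dV sV fV] := spectral_flag c2 c3 m2 hs hBm hd; split=> //.
have [P [I [k [hP eI hI hk]]]] := minimal_orbit c2 c3 m2 hs sV fV.
have hs' := spectral_conj hP hs; have sV' := saturated_conj hP sV.
have fV' := nontrivial_flags_conj hP fV; have [h1 h2 _] := hs'.
have km := ltn_ord k; move: hk; move: (k : nat) km => {}k km hk.
have dV' : \dim (conj_vs P V) = ('C(1 + m, 2) + 1 + e)%N by rewrite dim_conj_vs.
suff : triangular_form (conj_vs P V) e \/ e /\ exceptional_form (conj_vs P V).
  case=> [h|[he h]]; [left|right]; first exact: triangular_form_conj h.
  by split=> //; apply: exceptional_form_conj h.
move: (conj_vs P V) hs' sV' fV' h1 h2 hk hI dV' => W hs' sW fW h1 h2 hk hI dW.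
case: k km hk => [|[|k]] km hk; first by left; apply: fixed_line_form hI eI hk.
  right; have [t et] : exists t, m = t.+2 by exists m.-2; lia.
  subst m; have tW := minimal_plane sW hk.
  have pW := minimal_plane_flags c2 c3 (isT : (0 < t.+1)%N) hs' sW fW hk.
  have t1 := plane_size c2 c3 tW h2 h1 pW; subst t.
  exact: plane_exceptional.
have [s es] : exists s, m = (k.+2 + s)%N by exists (m - k.+2)%N; lia.
subst m; by case: (large_orbit_false c2 c3 (isT : (2 <= k.+2)%N) hs' sW fW _ hk) => e'; apply: hB; rewrite leq_addr.
Qed.

End Structure.

(** * Spaces of matrices with one eigenvalue or one nonzero eigenvalue *)

Section BoundTwo.
Variables (K : fieldType) (L : closedFieldType) (iota : {rmorphism K -> L}).
Hypotheses (c2 : 2%:R != 0 :> K) (c3 : 3%:R != 0 :> K).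

(** In size 2 the spectral conditions become polynomial equations over [K]. *)
Lemma good_det_disc (e : bool) (M : 'M[K]_2) : good iota e M ->
  (e -> \det M = 0 \/ disc2 M = 0) /\ (~~ e -> \tr M = 0 /\ \det M = 0).
Proof.
have [a [b [ha hb et ed]]] := spec2 iota M.
case: e => h; split=> // _; last first.
  by split; apply: (fmorph_inj iota); rewrite rmorph0 ?et ?ed (h _ ha) (h _ hb) ?addr0 ?mulr0.
have [a0|a0] := eqVneq a 0.
  by left; apply: (fmorph_inj iota); rewrite rmorph0 ed a0 mul0r.
have [b0|b0] := eqVneq b 0.
  by left; apply: (fmorph_inj iota); rewrite rmorph0 ed b0 mulr0.
right; apply: (fmorph_inj iota); rewrite rmorph0 /disc2 rmorphB rmorphXn rmorphM /= et ed.
by rewrite rmorph_nat (h _ _ ha hb a0 b0); ring.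
Qed.

Lemma square_zero_conj (M : 'M[K]_2) : M != 0 -> \tr M = 0 -> \det M = 0 ->
  exists2 P, P \in unitmx & conj_mx P M = unit01 K.
Proof.
move=> M0 t0 d0.
have MM : M *m M = 0.
  have d1 := d0; have t1 := t0; rewrite tr2E in t1; rewrite det2E in d1.
  have e11 : M 1 1 = - M 0 0 by apply/eqP; rewrite -addr_eq0 addrC t1.
  rewrite e11 in d1.
  by apply: mx2P; rewrite mul2mxE mxE ?e11; (try by ring); rewrite -[RHS]oppr0 -d1; ring.
have [z yz] : exists z : 'cV[K]_2, M *m z != 0.
  apply: NNPP => hn; case/eqP: M0; apply/matrixP => i j; rewrite [RHS]mxE.
  have [e|h] := eqVneq (M *m (delta_mx j 0 : 'cV_2)) 0; last by case: hn; exists (delta_mx j 0).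
  by have := congr1 (fun v : 'cV_2 => v i 0) e; rewrite /= -colE !mxE.
set y := M *m z in yz; have My : M *m y = 0 by rewrite mulmxA MM mul0mx.
pose B := mx2 (y 0 0) (z 0 0) (y 1 0) (z 1 0).
have hB : B \in unitmx.
  rewrite unitmxE unitfE det2E !mx2E; apply/eqP => e.
  have [c zc] : exists c, z = c *: y.
    by apply: (bracket_eq0 yz); rewrite /bracket -[RHS]oppr0 -e; ring.
  by case/eqP: yz; rewrite /y zc -scalemxAr My scaler0.
exists (invmx B); first by rewrite unitmx_inv.
rewrite /conj_mx invmxK -mulmxA; suff -> : M *m B = B *m unit01 K by rewrite mulKmx.
have eY i : M i 0 * y 0 0 + M i 1 * y 1 0 = 0 by rewrite -mul2E My mxE.
have eZ i : M i 0 * z 0 0 + M i 1 * z 1 0 = y i 0 by rewrite -mul2E.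
by apply: mx2P; rewrite !mul2mxE !mx2E ?eY ?eZ; ring.
Qed.

Lemma strict_upper_unit01 c : strict_upper (c *: unit01 K).
Proof. by do 2![apply: ord2_ind] => //= _; rewrite !mxE /= mulr0. Qed.

Lemma strict_upper2 (N : 'M[K]_2) : strict_upper N <-> N = N 0 1 *: unit01 K.
Proof.
split=> [h|->]; last exact: strict_upper_unit01.
by apply: mx2P; rewrite mxE mx2E ?mulr1 ?mulr0 // h.
Qed.

(** By dimension there is a nonzero nilpotent element, which may be taken to be E_01; adding its
    multiples forces triangularity, and only the diagonals remain to be found. *)
Lemma bound2 e : bound iota e 2.
Proof.
move=> V hV; rewrite binn.
suff main : (1 + e <= \dim V)%N -> (\dim V <= 1 + e)%N /\ exists P (I : {set 'I_2}),
    [/\ P \in unitmx, (I != set0) = e & forall M, M \in V <->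
       exists b N, strict_upper N /\ conj_mx P M = b *: DI K I + N].
  split=> [|d]; last by case: main; rewrite ?d.
  by case: (ltnP (\dim V) (1 + e)) => [/ltnW//|h]; case: (main h).
move=> hd.
have n4 : 4%:R != 0 :> K by rewrite (natrM _ 2 2) mulf_neq0.
have [M hM [M0 t0 d0]] : exists2 M, M \in V & [/\ M != 0, \tr M = 0 & \det M = 0].
  (* For [e = true] these are the traceless elements: their discriminant is -4 times the
     determinant, so both alternatives give determinant 0. *)
  have [U [sU dU tU]] : exists U : {vspace 'M[K]_2},
      [/\ (U <= V)%VS, (0 < \dim U)%N & forall M, M \in U -> \tr M = 0].
    have [e0|e1] := boolP (~~ e).
      exists V; split=> // [|M /hV/good_det_disc[_ /(_ e0)[]]//]; exact: leq_trans hd.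
    pose f (M : 'M[K]_2) : 'rV[K]_1 := (\tr M)%:M.
    have lf : linear f.
      by move=> a A B; rewrite /f linearD linearZ /= raddfD /= -scale_scalar_mx.
    have [S hS] := image_ex V lf; have [U hU] := kernel_ex V lf.
    exists U; split.
    - by apply/subvP => A /hU[].
    - have dS : (\dim S <= 1)%N by rewrite -[X in (_ <= X)%N](dim_rV K 1) dimvS ?subvf.
      have aux (u v : nat) : (1 + true <= u + v)%N -> (v <= 1)%N -> (0 < u)%N by clear; lia.
      by move: hd; rewrite (dim_image_kernel lf hU hS) (negPn e1) => /aux; apply.
    by move=> A /hU[_ /matrixP/(_ 0 0)]; rewrite !mxE mulr1n.
  have U0 : vpick U != 0 by rewrite vpick0 -dimv_eq0 -lt0n.
  exists (vpick U); first by apply: (subvP sU); apply: memv_pick.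
  have tr0 := tU _ (memv_pick U); split=> //.
  have [h1 h0] := good_det_disc (hV _ (subvP sU _ (memv_pick U))).
  have [e0|/negPn e1] := boolP (~~ e); first by case: (h0 e0).
  case: (h1 e1) => //; rewrite /disc2 tr0 expr0n /= sub0r => /eqP.
  by rewrite oppr_eq0 mulf_eq0 (negPf n4) => /eqP.
have [P hP eP] := square_zero_conj M0 t0 d0.
set W := conj_vs P V.
have hE : unit01 K \in W by rewrite -eP memv_conj.
have hW N : N \in W -> good iota e N.
  rewrite mem_conj_vs // => /hV; apply: good_spec => a; by rewrite spec_conj ?unitmx_inv.
have entE (N : 'M[K]_2) t : [/\ (N + t *: unit01 K) 0 0 = N 0 0, (N + t *: unit01 K) 0 1 = N 0 1 + t,
    (N + t *: unit01 K) 1 0 = N 1 0 & (N + t *: unit01 K) 1 1 = N 1 1].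
  by rewrite !mxE /= !mulr0 mulr1 !addr0.
have low N : N \in W -> N 1 0 = 0 /\ (N 0 0 = 0 \/ N 1 1 = 0 \/ N 0 0 = N 1 1).
  move=> hN.
  have alt t : \det (N + t *: unit01 K) = 0 \/ disc2 (N + t *: unit01 K) = 0.
    have hNt : N + t *: unit01 K \in W by rewrite memvD // memvZ.
    have [h1 h0] := good_det_disc (hW _ hNt).
    by have [/h0[]|/negPn/h1//] := boolP (~~ e); left.
  have N10 : N 1 0 = 0.
    apply/eqP/negPn/negP => n0.
    (* With N_10 nonzero, determinant and discriminant are nonconstant affine functions of [t];
       these are their zeros. *)
    pose t1 := (N 0 0 * N 1 1) / N 1 0 - N 0 1.
    pose t2 := - (N 0 0 - N 1 1) ^+ 2 / (4%:R * N 1 0) - N 0 1.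
    have [t ht] := avoidK iota c2 c3 (s := [:: t1; t2]) isT.
    have [a1 a2 a3 a4] := entE N t.
    move: ht; rewrite !inE negb_or => /andP[/eqP h1 /eqP h2].
    case: (alt t); rewrite /disc2 ?tr2E det2E a1 a2 a3 a4 => e1.
      by apply: h1; apply: (mulIf n0); rewrite /t1 mulrBl divfK // -[LHS]addr0 -e1; ring.
    apply: h2; apply: (mulIf (mulf_neq0 n4 n0)); rewrite /t2 mulrBl divfK ?mulf_neq0 //.
    by rewrite -[LHS]subr0 -e1; ring.
  split=> //; case: (alt 0); rewrite scale0r addr0 /disc2 ?tr2E det2E N10 mulr0 subr0.
    by move/eqP; rewrite mulf_eq0 => /orP[/eqP|/eqP]; [left | right; left].
  move=> e1; right; right; apply/eqP; rewrite -subr_eq0 -sqrf_eq0 -e1; apply/eqP; ring.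
(* The diagonals (x, y) form a linear space inside the union of x = 0, y = 0 and x = y, hence inside
   one of these lines: [I] is {1}, {0} or everything, and empty if all diagonals vanish. *)
have [I [hI hIe hN]] : exists I : {set 'I_2}, [/\ DI K I \in W, I != set0 -> e &
    forall N, N \in W -> exists b, N 0 0 = b * DI K I 0 0 /\ N 1 1 = b * DI K I 1 1].
  have diag I p : (forall N, N \in W -> exists b, N 0 0 = b * DI K I 0 0 /\ N 1 1 = b * DI K I 1 1) ->
      p \in W -> p 0 0 != 0 \/ p 1 1 != 0 -> DI K I \in W.
    move=> h hp p0; have [b [b0 b1]] := h p hp; have [p10 _] := low p hp.
    have bn : b != 0 by case: p0; rewrite ?b0 ?b1 mulf_eq0 negb_or => /andP[].
    have [a1 a2 a3 a4] := entE p (- p 0 1).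
    have -> : DI K I = b^-1 *: (p + (- p 0 1) *: unit01 K).
      by apply: mx2P; rewrite [RHS]mxE ?a1 ?a2 ?a3 ?a4 ?p10 ?b0 ?b1 ?subrr ?mulr0 ?mulKf // DI_diag.
    by rewrite memvZ // memvD // memvZ.
  case: (classic (exists2 N, N \in W & N 0 0 != 0 \/ N 1 1 != 0)) => [[p hp p0]|hn]; last first.
    exists set0; split; rewrite ?eqxx //.
      by rewrite (_ : DI K set0 = 0) ?mem0v //; apply/matrixP => i j; rewrite DI_diag inE andbF mxE.
    move=> N hN; exists 0; rewrite !mul0r; split; apply/eqP/negPn/negP => h; apply: hn; exists N => //.
      by left.
    by right.
  have he : e.
    apply/negPn/negP => e0; have [_ /(_ e0)[]] := good_det_disc (hW _ hp).
    have [p10 _] := low _ hp; rewrite tr2E det2E p10 mulr0 subr0 => /eqP.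
    rewrite addr_eq0 => /eqP e1 /eqP; rewrite mulf_eq0 => e2; move: e1 e2 p0.
    by case: (eqVneq (p 1 1) 0) => [->|p1]; rewrite ?oppr0 ?orbF => -> //; rewrite ?eqxx ?oppr_eq0 ?(negPf p1) // => _ [].
  have mixed N t : N \in W -> (N 0 0 + t * p 0 0 = 0 \/ N 1 1 + t * p 1 1 = 0 \/
      N 0 0 + t * p 0 0 = N 1 1 + t * p 1 1).
    move=> hN; have hNp : N + t *: p \in W by rewrite memvD // memvZ.
    by have [_] := low _ hNp; rewrite !mxE.
  suff [I I0 hI] : exists2 I : {set 'I_2}, I != set0 &
      forall N, N \in W -> exists b, N 0 0 = b * DI K I 0 0 /\ N 1 1 = b * DI K I 1 1.
    by exists I; split=> //; apply: (diag I p).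
  have [_ alts] := low p hp.
  have [p00|p00] := eqVneq (p 0 0) 0.
    have p1 : p 1 1 != 0 by case: p0; rewrite ?p00 ?eqxx.
    exists [set 1]; first by apply/set0Pn; exists 1; rewrite inE.
    move=> N hN; exists (N 1 1); rewrite !DI_diag !inE /= mulr0 mulr1; split=> //.
    have [t] := avoidK iota c2 c3 (s := [:: - N 1 1 / p 1 1; (N 0 0 - N 1 1) / p 1 1]) isT.
    rewrite !inE negb_or => /andP[/eqP t1 /eqP t2].
    case: (mixed N t hN) => [|[]] e1; first by move: e1; rewrite p00 mulr0 addr0.
      by case: t1; apply: (mulIf p1); rewrite divfK // -[LHS]subr0 -e1; ring.
    case: t2; apply: (mulIf p1); rewrite divfK //; move: e1; rewrite p00 mulr0 addr0 => ->; ring.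
  have [p11|p11] := eqVneq (p 1 1) 0.
    exists [set 0]; first by apply/set0Pn; exists 0; rewrite inE.
    move=> N hN; exists (N 0 0); rewrite !DI_diag !inE /= mulr0 mulr1; split=> //.
    have [t] := avoidK iota c2 c3 (s := [:: - N 0 0 / p 0 0; (N 1 1 - N 0 0) / p 0 0]) isT.
    rewrite !inE negb_or => /andP[/eqP t1 /eqP t2].
    case: (mixed N t hN) => [|[]] e1; last first.
      case: t2; apply: (mulIf p00); rewrite divfK //; move: e1; rewrite p11 mulr0 addr0 => <-; ring.
      by move: e1; rewrite p11 mulr0 addr0.
    by case: t1; apply: (mulIf p00); rewrite divfK // -[LHS]subr0 -e1; ring.
  have p01 : p 0 0 = p 1 1 by case: alts => [/eqP|[/eqP|//]]; rewrite ?(negPf p00) ?(negPf p11).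
  exists setT; first by apply/set0Pn; exists 0; rewrite inE.
  move=> N hN; exists (N 0 0); rewrite !DI_diag !inE /= !mulr1; split=> //.
  have [t] := avoidK iota c2 c3 (s := [:: - N 0 0 / p 0 0; - N 1 1 / p 0 0]) isT.
  rewrite !inE negb_or => /andP[/eqP t1 /eqP t2].
  case: (mixed N t hN) => [|[]] e1.
  - by case: t1; apply: (mulIf p00); rewrite divfK // -[LHS]subr0 -e1; ring.
  - by case: t2; apply: (mulIf p00); rewrite divfK // -[LHS]subr0 -e1 p01; ring.
  by move: e1; rewrite p01 => /addIr ->.
have form N : N \in W -> exists b, N = b *: DI K I + N 0 1 *: unit01 K.
  move=> hNW; have [N10 _] := low N hNW; have [b [e0 e1]] := hN N hNW; exists b.
  have [a1 a2 a3 a4] := entE (b *: DI K I) (N 0 1).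
  by apply: mx2P; rewrite ?a1 ?a2 ?a3 ?a4 [(b *: DI K I) _ _]mxE ?N10 // DI_diag mulr0 ?add0r.
have sW : (W <= <[unit01 K]> + <[DI K I]>)%VS.
  apply/subvP => N /form[b ->]; by rewrite addrC memv_add // memvZ // memv_line.
have dW : (\dim W <= 1 + (I != set0))%N.
  apply: (leq_trans (dimvS sW)); apply: (leq_trans (dimv_add_leqif _ _)).
  rewrite !dim_vline; apply: leq_add; first exact: leq_b1.
  have [I0|I0] := eqVneq I set0; last exact: leq_b1.
  have -> : DI K I = 0 by apply/matrixP => i j; rewrite DI_diag I0 inE andbF mxE.
  by rewrite eqxx.
rewrite -(dim_conj_vs V hP) -/W in hd *.
have eI : (I != set0) = e.
  apply/idP/idP => // he; apply: contraTT hd => /negPf I0; rewrite -ltnNge he.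
  by move: dW; rewrite I0.
split; first by rewrite -eI.
exists P, I; split=> // N; rewrite -[N \in V](_ : (conj_mx P N \in W) = _); last by rewrite mem_conj_vs // conj_mxK.
split=> [/form[b eb]|[b [N' [/strict_upper2 -> ->]]]]; last by rewrite memvD // memvZ.
by exists b, (conj_mx P N 0 1 *: unit01 K); split=> //; apply: strict_upper_unit01.
Qed.

End BoundTwo.

(** * Adjoining the identity *)

Section BoundStep.
Variables (K : fieldType) (L : closedFieldType) (iota : {rmorphism K -> L}).
Hypotheses (c2 : 2%:R != 0 :> K) (c3 : 3%:R != 0 :> K).

Lemma mem_add_one n (V : {vspace 'M[K]_n}) N :
  N \in (V + <[1%:M]>)%VS <-> exists c, N - c%:M \in V.
Proof.
split=> [/memv_addP[M hM [_ /vlineP[c ->] ->]]|[c hM]].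
  by exists c; rewrite scalemx1 addrK.
by rewrite -(subrK c%:M N); apply: memv_add => //; rewrite -(scalemx1 _ c) memvZ ?memv_line.
Qed.

Lemma spec_sub n (M : 'M[K]_n) c a : spec iota M a = spec iota (M - c%:M) (a - iota c).
Proof. by rewrite -spec_addc subrK. Qed.

Lemma one_nonzero_two n (M : 'M[K]_n) c : one_nonzero iota (M - c%:M) ->
  at_most_two_eigenvalues iota M.
Proof.
move=> h x y z hx hy hz; rewrite -!/(spec iota _ _) !(spec_sub M c) in hx hy hz.
have inj u v : u - iota c = v - iota c -> u = v by move/addIr.
have [x0|x0] := eqVneq (x - iota c) 0; last first.
  have [y0|y0] := eqVneq (y - iota c) 0; last by left; apply/inj/h.
  have [z0|z0] := eqVneq (z - iota c) 0; last by right; left; apply/inj/h.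
  by right; right; apply: inj; rewrite y0 z0.
have [y0|y0] := eqVneq (y - iota c) 0; first by left; apply: inj; rewrite x0 y0.
have [z0|z0] := eqVneq (z - iota c) 0; first by right; left; apply: inj; rewrite x0 z0.
by right; right; apply/inj/h.
Qed.

Lemma spec_one n c : spec iota (c%:M : 'M[K]_(1 + n)) (iota c).
Proof. by apply: (@spec_eigvec _ _ iota _ _ (vec0 K n)); rewrite ?vec0_neq0 ?mul_scalar_mx. Qed.

Lemma dim_add_one n (V : {vspace 'M[K]_n}) : 1%:M \notin V ->
  \dim (V + <[1%:M]>) = (\dim V).+1.
Proof.
move=> h; apply/eqP; rewrite eqn_leq dim_addv_line // andbT.
apply: (leq_trans (dimv_add_leqif _ _)); rewrite dim_vline -addn1 leq_add2l; exact: leq_b1.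
Qed.

Definition bound_form (e : bool) n (V : {vspace 'M[K]_n}) := exists P (I : {set 'I_n}),
   [/\ P \in unitmx, (I != set0) = e & forall M, M \in V <->
       exists b N, strict_upper N /\ conj_mx P M = b *: DI K I + N].

Lemma bound_from e n : (forall V : {vspace 'M[K]_n}, (forall M, M \in V -> good iota e M) ->
    ('C(n, 2) + e <= \dim V)%N -> \dim V = ('C(n, 2) + e)%N /\ bound_form e V) ->
  bound iota e n.
Proof.
move=> h V hV; split=> [|d]; last by case: (h V hV); rewrite ?d.
by case: (ltnP (\dim V) ('C(n, 2) + e)) => [/ltnW//|/(h V hV)[->]].
Qed.

Lemma DI_set0 n : DI K set0 = 0 :> 'M_n.
Proof. by apply/matrixP => i j; rewrite DI_diag inE andbF mxE. Qed.

Lemma DI_setC n (I : {set 'I_n}) : DI K (~: I) = 1%:M - DI K I.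
Proof.
apply/matrixP => i j; rewrite [RHS]mxE [(- DI K I) _ _]mxE !DI_diag mxE inE.
by case: eqP => //= _; [case: (_ \in _); rewrite ?subrr ?subr0 | rewrite subr0].
Qed.

(** Nilpotent matrices plus scalars have one eigenvalue each, so the structure theorem applies in
    the same size; [V] is recovered as the elements with eigenvalue 0. *)
Lemma bound_step_nil m : (2 <= m)%N ->
  (forall e' k, (2 <= k <= m)%N -> bound iota e' k) -> bound iota false (1 + m).
Proof.
move=> m2 hB; apply: bound_from => V hV; rewrite addn0 => hd.
have hn1 : 1%:M \notin V.
  by apply/negP => /hV/(_ _ (spec_one m 1))/eqP; rewrite rmorph1 oner_eq0.
pose W := (V + <[1%:M]>)%VS.
have single M a b : M \in W -> spec iota M a -> spec iota M b -> a = b.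
  case/mem_add_one => c /hV h; rewrite !(spec_sub M c) => /h /eqP ha /h /eqP hb.
  by move: ha hb; rewrite !subr_eq0 => /eqP-> /eqP->.
have hs : spectral iota false W.
  split.
  - by apply: (subvP (addvSr _ _)); apply: memv_line.
  - by move=> M hM a b c ha hb _; left; apply: (single M).
  move=> M hM /det0_kernel[y y0 e0] a ha; rewrite -(rmorph0 iota).
  by apply: (single M) => //; apply: (@spec_eigvec _ _ iota _ M y 0 y0); rewrite scale0r.
have [|dW [[P [I [hP I0 _ hI]]]|[]//]] := spectral_structure c2 c3 m2 hB hs.
  by rewrite dim_add_one // addn0 addn1 ltnS.
split; first by move: dW; rewrite dim_add_one // addn0 addn1 => -[].
move/eqP: I0 => I0; exists P, set0; split; rewrite ?eqxx // => M.
split=> [hM|[b [N [sN eN]]]].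
  have /hI[a [b [N [sN eN]]]] : M \in W by apply: (subvP (addvSl _ _)).
  exists b, N; split=> //; rewrite I0 in eN *; rewrite eN.
  suff -> : a = 0 by rewrite (_ : 0%:M = 0) ?add0r //; apply/matrixP => i j; rewrite !mxE mul0rn.
  apply: (fmorph_inj iota); rewrite rmorph0; apply: (hV _ hM).
  rewrite -(spec_conj _ _ _ hP) eN DI_set0 scaler0 addr0.
  have tri (i j : 'I_(1 + m)) : (j < i)%N -> (a%:M + N) i j = 0.
    move=> ij; rewrite mxE sN ?(ltnW ij) // addr0 mxE.
    by case: eqP ij => // ->; rewrite ltnn.
  have := @spec_diag _ _ iota _ (a%:M + N) 0 tri.
  by rewrite mxE (sN 0 0) // addr0 mxE mulr1n.
have : M \in W by apply/hI; exists 0, b, N; rewrite I0 raddf0 add0r.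
case/mem_add_one => c hM; suff c0 : c = 0 by move: hM; rewrite c0 raddf0 subr0.
have nM : nil_mx iota M.
  by move=> a; rewrite -(spec_conj _ _ _ hP) eN DI_set0 scaler0 add0r; apply: strict_upper_nil.
have [a ha] := spec_ex iota M isT.
have := hV _ hM (a - iota c); rewrite -spec_sub => /(_ ha); rewrite (nM a ha) sub0r => /eqP.
by rewrite oppr_eq0 fmorph_eq0 => /eqP.
Qed.

Lemma no_eigenvector2 (z : 'cV[K]_2) : z != 0 -> exists A : 'M[K]_2, forall c, A *m z <> c *: z.
Proof.
move=> z0; have [z00|z00] := eqVneq (z 0 0) 0.
  have z1 : z 1 0 != 0.
    apply: contraNneq z0 => e; apply/eqP/matrixP => i j; rewrite ord1 mxE.
    by move: i; apply: ord2_ind.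
  exists (mx2 0 1 0 0) => c /matrixP/(_ 0 0); rewrite mul2E !mx2E mxE z00.
  by rewrite !mulr0 add0r => /eqP; rewrite mul1r (negPf z1).
have [e1|e1] := eqVneq (z 1 0) 0.
  exists (mx2 0 0 1 0) => c /matrixP/(_ 1 0); rewrite mul2E !mx2E mxE e1.
  by rewrite !mulr0 addr0 mul1r => /eqP; rewrite (negPf z00).
exists (mx2 1 0 0 0) => c e.
have e0 : z 0 0 = c * z 0 0.
  by have := congr1 (fun v : 'cV_2 => v 0 0) e; rewrite /= mul2E !mx2E mul1r mul0r addr0 => {1}->; rewrite mxE.
have /esym/eqP : 0 = c * z 1 0.
  by have := congr1 (fun v : 'cV_2 => v 1 0) e; rewrite /= mul2E !mx2E !mul0r addr0 => ->; rewrite mxE.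
rewrite mulf_eq0 (negPf e1) orbF => /eqP c0.
by move: e0; rewrite c0 mul0r => /eqP; rewrite (negPf z00).
Qed.

Lemma disc2_shift (A : 'M[K]_2) c : disc2 (A - c%:M) = disc2 A.
Proof. by rewrite /disc2 !tr2E !det2E !mxE /= !mulr1n !mulr0n; ring. Qed.

(** The scalar [l M] for which M - l M lies in [V] is linear in [M]. As M - l M has at most one
    nonzero eigenvalue, [l M] is an eigenvalue of the upper left block or that block has
    discriminant 0, which [no_eigenvalue_form] forbids. *)
Lemma no_exceptional_extension (V : {vspace 'M[K]_(2 + 2)}) P : P \in unitmx ->
  1%:M \notin V -> (forall M, M \in V -> one_nonzero iota M) ->
  (forall M, M \in (V + <[1%:M]>)%VS -> dlsubmx (conj_mx P M) = 0) ->
  (forall A, exists D, conj_mx (invmx P) (block_mx A 0 0 D) \in (V + <[1%:M]>)%VS) -> False.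
Proof.
move=> hP h1 hV hdl hA; set W := (V + _)%VS in hdl hA.
have cap0 : (<[1%:M]> :&: V = 0)%VS.
  apply/eqP; rewrite -subv0; apply/subvP => M; rewrite memv_cap memv0.
  case/andP=> /vlineP[c ->] hc; have [->|c0] := eqVneq c 0; first by rewrite scale0r.
  by case/negP: h1; rewrite -(scalerK c0 1%:M) memvZ.
(* The component of [M] along the identity, read off its first diagonal entry. *)
pose l (M : 'M[K]_(2 + 2)) := daddv_pi <[1%:M]> V M 0 0.
have hl M : M \in W -> M - (l M)%:M \in V.
  rewrite /W addvC => hM; have /vlineP[c ec] := memv_pi <[1%:M]> V M.
  have -> : l M = c by rewrite /l ec mxE [1%:M _ _]mxE mulr1.
  rewrite -{1}(daddv_pi_add cap0 hM) ec scalemx1 addrC addKr; exact: memv_pi.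
pose f (M : 'M[K]_(2 + 2)) := ulsubmx (conj_mx P M).
apply: (@no_eigenvalue_form K c2 c3 _ W f l).
- by move=> a M N; rewrite /f conj_mx_lin; apply/matrixP => i j; rewrite !mxE.
- by move=> a M N; rewrite /l linearP !mxE.
- move=> M hM; have hM' := hl M hM.
  have g : good iota true (f M - (l M)%:M).
    have gM : good iota true (M - (l M)%:M) := hV _ hM'.
    apply: good_spec gM => a ha.
    have e1 : conj_mx P (M - (l M)%:M) = conj_mx P M - (l M)%:M.
      by rewrite -scaleN1r addrC conj_mx_lin conj_mx_scalar // scaleN1r addrC.
    have e2 : ulsubmx (conj_mx P (M - (l M)%:M)) = f M - (l M)%:M.
      by rewrite e1; apply/matrixP => i j; rewrite !mxE.
    have e3 : dlsubmx (conj_mx P (M - (l M)%:M)) = 0.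
      by apply: hdl; apply: (subvP (addvSl _ _)).
    rewrite -(spec_conj _ _ _ hP) -[conj_mx P _]submxK e3 (@spec_ublock _ _ iota 2 2) e2.
    by rewrite ha.
  by have [/(_ isT)[h|h] _] := good_det_disc g; [left | right; rewrite -(disc2_shift _ (l M))].
move=> z /no_eigenvector2[A nA]; have [D hD] := hA A.
by exists (conj_mx (invmx P) (block_mx A 0 0 D)) => //; rewrite /f conj_mxVK // block_mxKul.
Qed.

End BoundStep.

(** * Induction on the size *)

Section BoundAll.
Variables (K : fieldType) (L : closedFieldType) (iota : {rmorphism K -> L}).
Hypotheses (c2 : 2%:R != 0 :> K) (c3 : 3%:R != 0 :> K).

Lemma exceptional_blocks (V : {vspace 'M[K]_(2 + 2)}) : exceptional_form V ->
  exists P, [/\ P \in unitmx, forall M, M \in V -> dlsubmx (conj_mx P M) = 0 &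
    forall A, exists D, conj_mx (invmx P) (block_mx A 0 0 D) \in V].
Proof.
case=> h [P [hP]]; have e M : castmx (h, h) M = M :> 'M[K]_(2 + 2) by rewrite castmx_id.
case=> hV; exists P; split=> // [M /hV|A]; rewrite ?e.
- by case=> A [B ->]; rewrite block_mxKdl.
- by exists A; apply/hV; rewrite e conj_mxVK //; exists A, 0.
- by case=> A [B ->]; rewrite block_mxKdl.
by exists A^T; apply/hV; rewrite e conj_mxVK //; exists A, 0.
Qed.

(** Up to conjugation [V] is a complement of the scalars in K 1 + K D_I + NT. An element D_I - d + t
    (N - c) has diagonal values 1 - d - tc and -d - tc, one of which must vanish. Varying [t] gives
    c = 0, so NT lies in [V]; t = 0 gives d = 0 or d = 1, so D_I or the matrix of the complementary
    set does too. *)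
Lemma triangular_bound_form m (V : {vspace 'M[K]_(1 + m)}) : 1%:M \notin V ->
  (forall M, M \in V -> one_nonzero iota M) ->
  triangular_form (V + <[1%:M]>)%VS true -> bound_form true V.
Proof.
move=> h1 hV [P [I [hP I0 I1 hI]]]; pose W := conj_vs P V.
have hW N : N \in W -> one_nonzero iota N.
  rewrite mem_conj_vs // => /hV h; apply: (@good_spec _ _ iota true _ _ _ _ _ h) => a.
  by rewrite spec_conj ?unitmx_inv.
have W1 a : a%:M \in W -> a = 0.
  rewrite mem_conj_vs // conj_mx_scalar ?unitmx_inv // => ha.
  apply/eqP/negPn/negP => a0; case/negP: h1.
  by rewrite -(scalerK a0 1%:M) scalemx1 memvZ.
have hc X : V2 I X -> exists c, X - c%:M \in W.
  move=> hX; have /mem_add_one[c hM] : conj_mx (invmx P) X \in (V + <[1%:M]>)%VS.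
    by apply/hI; rewrite conj_mxVK.
  exists c; rewrite mem_conj_vs // -(addrC _ X) -scaleN1r conj_mx_lin conj_mx_scalar ?unitmx_inv //.
  by rewrite scaleN1r addrC.
have /set0Pn[i iI] : I != set0 by rewrite I0.
have [j jI] : exists j, j \notin I.
  apply: NNPP => hn; case/eqP: I1; apply/setP => j; rewrite inE; apply/negPn/negP => jI.
  by apply: hn; exists j.
have [d hd] := hc _ (ex_intro _ 0 (ex_intro _ 1 (ex_intro _ 0 (conj (@strict_upper0 K _) erefl)))).
rewrite scale1r raddf0 add0r addr0 in hd.
have alt N c t : strict_upper N -> N - c%:M \in W -> 1 - d - t * c = 0 \/ - d - t * c = 0.
  move=> sN hN; pose M := DI K I - d%:M + t *: (N - c%:M).
  have hM : M \in W by rewrite memvD // memvZ.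
  have ent k l : M k l = DI K I k l - d *+ (k == l) + t * (N k l - c *+ (k == l)).
    by rewrite /M; move: (DI K I) => D; rewrite !mxE.
  have diag k : M k k = (k \in I)%:R - d - t * c.
    by rewrite ent DI_diag eqxx sN // sub0r mulrN.
  have tri (k l : 'I_(1 + m)) : (l < k)%N -> M k l = 0.
    move=> kl; rewrite ent DI_diag sN ?(ltnW kl) // -val_eqE /= gtn_eqF //=.
    by rewrite !mulr0n !subr0 mulr0 addr0.
  have si := spec_diag iota i tri; have sj := spec_diag iota j tri.
  rewrite diag iI in si; rewrite diag (negPf jI) sub0r in sj.
  have [e1|e1] := eqVneq (1 - d - t * c) 0; first by left.
  have [e2|e2] := eqVneq (- d - t * c) 0; first by right.
  have := hW _ hM _ _ si sj; rewrite !fmorph_eq0 => /(_ e1 e2)/fmorph_inj/addIr.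
  by move/(canRL (addrK _)); rewrite subrr => /eqP; rewrite oner_eq0.
have strictW N : strict_upper N -> N \in W.
  move=> sN; have [c hN] : exists c, N - c%:M \in W.
    by apply: hc; exists 0, 0, N; rewrite raddf0 scale0r !add0r.
  suff c0 : c = 0 by move: hN; rewrite c0 raddf0 subr0.
  apply/eqP/negPn/negP => c0.
  have [t] := avoidK iota c2 c3 (s := [:: (1 - d) / c; - d / c]) isT.
  rewrite !inE negb_or => /andP[/eqP t1 /eqP t2].
  by case: (alt N c t sN hN) => /eqP; rewrite subr_eq0 => /eqP e; [case: t1 | case: t2]; rewrite e mulfK.
have [I' [I'0 hD hV2]] : exists I' : {set 'I_(1 + m)}, [/\ I' != set0, DI K I' \in W &
    forall X : 'M[K]_(1 + m), V2 I X -> V2 I' X].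
  have W0 : (0 : 'M[K]_(1 + m)) - 0%:M \in W by rewrite raddf0 subr0 mem0v.
  case: (alt 0 0 0 (@strict_upper0 K _) W0); rewrite mul0r subr0.
    move/eqP; rewrite subr_eq0 => /eqP d1; exists (~: I); split.
    - by apply/set0Pn; exists j; rewrite inE.
    - by rewrite DI_setC -opprB memvN d1.
    move=> _ [a [b [N [sN ->]]]]; exists (a + b), (- b), N; split=> //.
    rewrite DI_setC; congr (_ + _); rewrite raddfD /= scaleNr scalerBr opprB scalemx1.
    by rewrite -addrA [b%:M + _]addrC subrK.
  move/eqP; rewrite oppr_eq0 => /eqP d0; exists I; split; rewrite ?I0 //.
  by move: hd; rewrite d0 raddf0 subr0.
exists P, I'; split=> // M; split=> [hM|[b [N [sN eM]]]].
  have /hI/hV2[a [b [N [sN eM]]]] : M \in (V + <[1%:M]>)%VS by apply: (subvP (addvSl _ _)).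
  exists b, N; split=> //; rewrite eM; suff -> : a = 0 by rewrite raddf0 add0r.
  apply: W1; have -> : a%:M = conj_mx P M - (b *: DI K I' + N) by rewrite eM -(addrA a%:M) addrK.
  by rewrite memvB ?memv_conj // memvD ?memvZ // strictW.
have : conj_mx P M \in W by rewrite eM memvD ?memvZ // strictW.
by rewrite mem_conj_vs // conj_mxK.
Qed.

(** If the identity is in [V], a scalar shift makes any two eigenvalues of an element nonzero, hence
    equal; then [I] is the full set. Otherwise the identity is adjoined. *)
Lemma bound_step m : (2 <= m)%N ->
  (forall e' k, (2 <= k <= m)%N -> bound iota e' k) -> forall e, bound iota e (1 + m).
Proof.
move=> m2 hB [|]; last exact: bound_step_nil c2 c3 _ m2 hB.
apply: bound_from => V hV hd; have [h1|h1] := boolP (1%:M \in V).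
  have single M a b : M \in V -> spec iota M a -> spec iota M b -> a = b.
    move=> hM ha hb; have [t] := five_avoid iota c2 c3 (s := [:: - a; - b]) isT.
    rewrite !inE negb_or => /andP[t1 t2].
    have hMt : M + t%:M \in V by rewrite memvD // -(scalemx1 _ t) memvZ.
    apply: (addIr (iota t)); apply: (hV _ hMt); rewrite ?spec_addc ?addrK //.
      by rewrite addrC addr_eq0.
    by rewrite addrC addr_eq0.
  have hs : spectral iota false V.
    split=> // [M hM a b c ha hb _|M hM /det0_kernel[y y0 e0] a ha]; first by left; apply: (single M).
    rewrite -(rmorph0 iota).
    by apply: (single M) => //; apply: (@spec_eigvec _ _ iota _ M y 0 y0); rewrite scale0r.
  have [|dV [[P [I [hP I0 _ hI]]]|[]//]] := spectral_structure c2 c3 m2 hB hs; first by rewrite addn0.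
  split; first by rewrite dV addn0.
  move/eqP: I0 => I0; rewrite I0 in hI.
  have eT : DI K [set: 'I_(1 + m)] = 1%:M.
    by apply/matrixP => i j; rewrite DI_diag inE andbT mxE.
  exists P, setT; split=> //; first by apply/set0Pn; exists 0; rewrite inE.
  move=> M; split=> [/hI[a [b [N [sN eM]]]]|[b [N [sN eM]]]].
    by exists a, N; split=> //; rewrite eM eT DI_set0 scaler0 addr0 scalemx1.
  by apply/hI; exists b, 0, N; split=> //; rewrite eM eT DI_set0 scaler0 addr0 scalemx1.
pose W := (V + <[1%:M]>)%VS.
have hs : spectral iota true W.
  have two : two_spec iota W by move=> M /mem_add_one[c /hV hM]; apply: one_nonzero_two hM.
  split=> // [|M hM d0]; last by apply: two_spec_one d0; apply: two.
  by apply: (subvP (addvSr _ _)); apply: memv_line.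
have dW : \dim W = (\dim V).+1 by apply: dim_add_one.
have [|dW' hW] := spectral_structure c2 c3 m2 hB hs; first by rewrite dW addnAC addn1 ltnS.
split; first by move: dW'; rewrite dW addnAC addn1 => -[].
case: hW => [hW|[_ hW]]; first exact: triangular_bound_form.
have [m3 _] := hW; have {m3} m3 : m = 3 by lia.
subst m; have [P [hP hdl hA]] := exceptional_blocks hW.
by case: (no_exceptional_extension c2 c3 hP h1 hV hdl hA).
Qed.

Lemma bound_all e n : (2 <= n)%N -> bound iota e n.
Proof.
elim/ltn_ind: n e => -[|[|[|m]]] // IH e _; first exact: bound2.
by apply: bound_step => // e' k /andP[k2 km]; apply: IH.
Qed.

(** Adjoining the identity preserves the spectral hypothesis, and the dimension bound shows that it
    was in [V] already. *)
Lemma two_spec_structure m (V : {vspace 'M[K]_(1 + m)}) : (2 <= m)%N ->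
  \dim V = ('C(1 + m, 2) + 2)%N -> two_spec iota V ->
  triangular_form V true \/ exceptional_form V.
Proof.
move=> m2 dV h2; pose W := (V + <[1%:M]>)%VS.
have two : two_spec iota W.
  move=> M /mem_add_one[c /h2 hM] x y z hx hy hz.
  have inj u v : u - iota c = v - iota c -> u = v by move/addIr.
  rewrite -!/(spec iota _ _) !(spec_sub _ M c) in hx hy hz.
  by case: (hM _ _ _ hx hy hz) => [/inj|[/inj|/inj]]; auto.
have h1 : 1%:M \in W by apply: (subvP (addvSr _ _)); apply: memv_line.
have hs : spectral iota true W.
  by split=> // M hM d0; apply: two_spec_one d0; apply: two.
have sVW : (V <= W)%VS by apply: addvSl.
have hB e' k : (2 <= k <= m)%N -> bound iota e' k by case/andP => k2 _; apply: bound_all.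
have [|dW hW] := spectral_structure c2 c3 m2 hB hs; first by rewrite -addnA -dV; apply: dimvS.
have /eqP -> : V == W by rewrite eqEdim sVW dW dV -addnA leqnn.
by case: hW => [|[]]; auto.
Qed.

(** * Mutual exclusion of the three types in size four *)

Lemma triangular_eigenvector m (I : {set 'I_(1 + m)}) (M : 'M[K]_(1 + m)) : V2 I M ->
  exists c, M *m vec0 K m = c *: vec0 K m.
Proof.
case=> a [b [N [sN ->]]]; exists (a + b * (0 \in I)%:R).
rewrite !mulmxDl mul_scalar_mx (strict_upper_vec0 sN) addr0 -scalemxAl scalerDl; congr (_ + _).
rewrite -scalerA; congr (_ *: _); rewrite -colE; apply/matrixP => i j.
by rewrite ord1 [LHS]mxE [RHS]mxE DI_diag mxE eqxx andbT mulrC -natrM mulnb; case: eqP => // ->.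
Qed.

(** The blocks [B] force the lower half of a common eigenvector to vanish; its upper half would then
    be an eigenvector of every 2x2 matrix. *)
Lemma no_common_eigenvector (W : 'M[K]_(2 + 2) -> Prop) (w : 'cV[K]_(2 + 2)) :
  (forall B, W (block_mx 0 B 0 0)) -> (forall A, exists D, W (block_mx A 0 0 D)) ->
  w != 0 -> (forall M, W M -> exists c, M *m w = c *: w) -> False.
Proof.
move=> hB hA w0 hw; rewrite -[w]vsubmxK in w0 hw; move: (usubmx w) (dsubmx w) w0 hw => x y w0 hw.
have y0 : y = 0.
  apply/eqP/negPn/negP => y0; have [A nA] := no_eigenvector2 y0.
  have [c] := hw _ (hB A); rewrite mul_block_col !mul0mx add0r addr0 scale_col_mx.
  case/eq_col_mx => e1 /esym/eqP; rewrite scaler_eq0 (negPf y0) orbF => /eqP c0.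
  by apply: (nA 0); rewrite e1 c0 scale0r scale0r.
rewrite y0 in w0 hw; have x0 : x != 0.
  by apply: contraNneq w0 => ->; rewrite col_mx0.
have [A nA] := no_eigenvector2 x0; have [D /hw[c]] := hA A.
rewrite mul_block_col !mulmx0 !mul0mx !addr0 scale_col_mx => /eq_col_mx[e _].
exact: nA e.
Qed.

Lemma triangular_not_exceptional (V : {vspace 'M[K]_(2 + 2)}) (I : {set 'I_(1 + 3)})
    (W : 'M[K]_(2 + 2) -> Prop) :
  (forall B, W (block_mx 0 B 0 0)) -> (forall A, exists D, W (block_mx A 0 0 D)) ->
  vsimilar V (V2 I : 'M_(2 + 2) -> Prop) -> vsimilar V W -> False.
Proof.
move=> hB hA [P hP hI] [Q hQ hW].
pose w := Q *m (invmx P *m vec0 K 3).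
apply: (@no_common_eigenvector W w) => //.
  apply: contraNneq (vec0_neq0 K 3) => w0.
  by rewrite -(mulKVmx hP (vec0 K 3)) -(mulKmx hQ (invmx P *m _)) -/w w0 !mulmx0.
move=> M WM; have hM : conj_mx (invmx Q) M \in V.
  by apply/hW; rewrite -/(conj_mx Q _) conj_mxVK.
have /hI/triangular_eigenvector[c e] := hM; exists c.
rewrite /w !scalemxAr -e.
by rewrite /conj_mx invmxK !mulmxA mulmxKV // mulmxV // mul1mx.
Qed.

Lemma G4_mulmx (M N : 'M[K]_(2 + 2)) : G4 M -> G4 N -> G4 (M *m N).
Proof.
case=> A [B ->] [A' [B' ->]]; exists (A *m A'), (A *m B' + B *m A').
by rewrite mulmx_block !mulmx0 !mul0mx !addr0 !add0r.
Qed.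

(** The first space is closed under products. The second is not: transposition reverses products,
    and E_01 and E_10 do not commute. *)
Lemma G4_not_G4' (V : {vspace 'M[K]_(2 + 2)}) :
  vsimilar V (@G4 K) -> vsimilar V (@G4' K) -> False.
Proof.
move=> [P hP hG] [Q hQ hG'].
have clV M N : M \in V -> N \in V -> M *m N \in V.
  move=> /hG hM /hG hN; apply/hG.
  by have := G4_mulmx hM hN; rewrite -!/(conj_mx _ _) -conj_mxM.
have inV A : conj_mx (invmx Q) (block_mx A 0 0 A^T) \in V.
  by apply/hG'; rewrite -/(conj_mx Q _) conj_mxVK //; exists A, 0.
pose A : 'M[K]_2 := mx2 0 1 0 0; pose B : 'M[K]_2 := mx2 0 0 1 0.
have /hG' := clV _ _ (inV A) (inV B).
rewrite -conj_mxM ?unitmx_inv // -/(conj_mx Q _) conj_mxVK // => -[X [Y]].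
rewrite mulmx_block !mulmx0 !mul0mx !addr0 !add0r => /eq_block_mx[<- _ _].
move/matrixP/(_ 0 0); rewrite trmx_mul => /eqP.
by rewrite !mul2mxE !mxE /= !(mulr0, mul0r, mulr1, addr0, add0r) eq_sym oner_eq0.
Qed.

End BoundAll.

Theorem mainTheorem5 (K : fieldType) (L : closedFieldType)
    (iota : {rmorphism K -> L}) :
  2%N \notin [pchar K] -> 3%N \notin [pchar K] ->
  is_alg_closure iota ->
  (forall (n : nat) (V : {vspace 'M[K]_n}),
     (n = 3 \/ 5 <= n)%N ->
     \dim V = ('C(n, 2) + 2)%N ->
     (forall M, M \in V -> at_most_two_eigenvalues iota M) ->
     exists I : {set 'I_n}, [/\ I != set0, I != setT & vsimilar V (V2 I)])
  /\
  (forall V : {vspace 'M[K]_4},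
     \dim V = ('C(4, 2) + 2)%N ->
     (forall M, M \in V -> at_most_two_eigenvalues iota M) ->
     let P1 := exists I : {set 'I_4},
                 [/\ I != set0, I != setT & vsimilar V (V2 I)] in
     let P2 := vsimilar V (@G4 K) in
     let P3 := vsimilar V (@G4' K) in
     [/\ P1 \/ P2 \/ P3, ~ (P1 /\ P2), ~ (P1 /\ P3) & ~ (P2 /\ P3)]).
Proof.
move=> p2 p3 _.
have c2 : 2%:R != 0 :> K by apply: contraNneq p2 => e; rewrite inE /= e eqxx.
have c3 : 3%:R != 0 :> K by apply: contraNneq p3 => e; rewrite inE /= e eqxx.
split=> [n V hn dV h2|V dV h2 P1 P2 P3].
  have {}hn : (3 <= n)%N && (n != 4) by case: hn => [->|]; lia.
  case: n V dV h2 hn => // m V dV h2 /andP[m2 n4].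
  case: (two_spec_structure c2 c3 (m2 : (2 <= m)%N) dV h2) => [[P [I [hP I0 I1 hI]]]|[e]].
    by exists I; split; rewrite ?I0 //; exists P.
  by have e4 : m.+1 = 4 := e; rewrite e4 in n4.
split.
- case: (two_spec_structure c2 c3 (isT : (2 <= 3)%N) dV h2) => [[P [I [hP I0 I1 hI]]]|[e [P [hP hG]]]].
    by left; exists I; split; rewrite ?I0 //; exists P.
  have eid M : castmx (e, e) M = M :> 'M[K]_4 by rewrite castmx_id.
  right; case: hG => hG; [left|right]; exists P => // M; have := hG M; rewrite eid //.
- case=> -[I [_ _ hI]] hG; apply: (triangular_not_exceptional _ _ hI hG) => [B|A].
    by exists 0, B.
  by exists A, A, 0.
- case=> -[I [_ _ hI]] hG; apply: (triangular_not_exceptional _ _ hI hG) => [B|A].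
    by exists 0, B; rewrite trmx0.
  by exists A^T, A, 0.
by case; apply: G4_not_G4'.
Qed.
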